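(* Assume that $\frac23\omega\le h<\omega$ and let $\Phi=(\varphi_1,\varphi_2,\varphi_3)$ with $\varphi_j\in B_\omega$. Suppose that there exist positive constants $\delta,\gamma,\sigma,\eta$ such that $\delta\le\sum_{j=1}^3|\widehat{\varphi_j}|^2\le\gamma$ a.e. in $(-\omega,\omega)$, $[J_{\Phi,t_o}]_2\ge\sigma$ a.e. in $K$, and $|\det J_{\Phi,t_o}|\ge\eta$ a.e. in $K_-\cup K_+$ (i.e. that $E_{\Phi,t_o}$ is a frame for $B_\omega$). Then the Fourier transform of the vector of dual generators $\Phi^*=(\varphi_1^*,\varphi_2^*,\varphi_3^* )$ is $$\widehat{\Phi^*}=\begin{cases} D\ \tau_h\overline{\widehat\Phi}\times\tau_{2h}\overline{\widehat\Phi} & \text{in }(-\omega,\omega-2h),\\ E\ \big(\tau_h\widehat\Phi\times\widehat\Phi\big)\times\tau_h\overline{\widehat\Phi} & \text{in }(\omega-2h,h-\omega),\\ D\ \tau_h\overline{\widehat\Phi}\times\tau_{-h}\overline{\widehat\Phi} & \text{in }(h-\omega,\omega-h),\\ -E\ \tau_{-h}\overline{\widehat\Phi}\times\big(\tau_{-h}\widehat\Phi\times\widehat\Phi\big) & \text{in }(\omega-h,2h-\omega),\\ D\ \tau_{-2h}\overline{\widehat\Phi}\times\tau_{-h}\overline{\widehat\Phi} & \text{in }(2h-\omega,\omega),\end{cases}$$ where $E=h\,(\det \mathbb J_{\Phi,t_o}\mathbb J_{\Phi,t_o}^* )^{-1}$ and $D=\sqrt h\,(\det J_{\Phi,t_o}^*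 )^{-1}$. If $h=\frac{2\omega}{3}$ the intervals $(\omega-h,2h-\omega)$ and $(\omega-2h,h-\omega)$ are empty.
   Context: Conventions: $\hat f(\xi)=\frac{1}{\sqrt{2\pi}}\int f(t)e^{-it\xi}\,dt$ (extended to $L^2(\mathbb R)$); $\tau_a f(x)=f(x+a)$, applied componentwise to vectors; bar denotes complex conjugation. Fix $\omega>0$ and $B_\omega=\{f\in L^2(\mathbb R):\operatorname{supp}\hat f\subset[-\omega,\omega]\}$; $t_o>0$ and $h=2\pi/t_o$. $\widehat\Phi=(\widehat{\varphi_1},\widehat{\varphi_2},\widehat{\varphi_3})$; $\times$ is the usual (bilinear) cross product in $\mathbb C^3$. $E_{\Phi,t_o}=\{\tau_{nt_o}\varphi_j:n\in\mathbb Z,\ 1\le j\le3\}$ is a frame for $B_\omega$ if there are $0<A\le B$ with $A\|f\|^2\le\sum_j\sum_n|\langle f,\tau_{nt_o}\varphi_j\rangle|^2\le B\|f\|^2$ for all $f\in B_\omega$. In that case the frame operator $Sf=\sum_j\sum_n\langle f,\tau_{nt_o}\varphi_j\rangle\tau_{nt_o}\varphi_j$ is invertible on $B_\omega$, and the dual generators are $\varphi_j^*=S^{-1}\varphi_j$. Intervals: $K_-=(0,\omega-h)$, $K=(\omega-h,2h-\omega)$, $K_+=(2h-\omega,h)$. The pre-Gramian $J_{\Phi,t_o}$ is the $3\times3$ matrix-valued function with rows, from top to bottom: $\sqrt h\,\tau_{-h}\widehat\Phi,\ \sqrt h\,\widehat\Phi,\ \sqrt h\,\tau_h\widehat\Phi$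 on $K_-$; $\sqrt h\,\tau_{-h}\widehat\Phi,\ \sqrt h\,\widehat\Phi,\ 0$ on $K$; $\sqrt h\,\tau_{-2h}\widehat\Phi,\ \sqrt h\,\tau_{-h}\widehat\Phi,\ \sqrt h\,\widehat\Phi$ on $K_+$; it is extended to $\mathbb R$ with period $h$. On $K$ (and its translates by multiples of $h$), $\mathbb J_{\Phi,t_o}$ is the $2\times3$ matrix obtained from $J_{\Phi,t_o}$ by deleting the zero row. $^*$ on a matrix denotes conjugate transpose. Thus $D$ (on $K_-\cup K_+$ and translates) and $E$ (on $K$ and translates) are $h$-periodic functions. $[J]_n$ denotes the sum of the squares of the absolute values of the minors of order $n$ of $J$. Equalities hold almost everywhere. *)

(* Defs.v *)
From HB Require Import structures.
From mathcomp Require Import all_boot all_order all_algebra finmap.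
From mathcomp Require Import complex.
From mathcomp Require Import all_classical all_reals all_analysis.

Set Implicit Arguments.
Unset Strict Implicit.
Unset Printing Implicit Defensive.

Import Order.TTheory GRing.Theory Num.Theory.

Local Open Scope classical_set_scope.
Local Open Scope ring_scope.
Local Open Scope complex_scope.

Notation cabs := ComplexField.Normc.normc.

Section L2.
Context {R : realType}.
Local Notation C := R[i].
Local Notation mu := (@lebesgue_measure R).

Definition cmeasurable (f : R -> C) : Prop :=
  measurable_fun setT (fun x => complex.Re (f x)) /\
  measurable_fun setT (fun x => complex.Im (f x)).

Definition cintegral (f : R -> C) : C :=
  (\int[mu]_x complex.Re (f x))%R +i* (\int[mu]_x complex.Im (f x))%R.

Definition sqnormL2 (f : R -> C) : \bar R :=
  (\int[mu]_x ((cabs (f x)) ^+ 2)%:E)%E.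

Definition L1 (f : R -> C) : Prop :=
  cmeasurable f /\ (\int[mu]_x (cabs (f x))%:E < +oo)%E.

Definition L2 (f : R -> C) : Prop :=
  cmeasurable f /\ (sqnormL2 f < +oo)%E.

Definition innerL2 (f g : R -> C) : C := cintegral (fun x => f x * (g x)^*).

Definition cvgL2 (u : nat -> R -> C) (f : R -> C) : Prop :=
  sqnormL2 (fun x => u n x - f x) @[n --> \oo] --> 0%E.

Definition fourierL1 (f : R -> C) (xi : R) : C :=
  ((Num.sqrt (2 * pi))^-1)%:C *
  cintegral (fun t => f t * (cos (t * xi) -i* sin (t * xi))).

(* Continuous extension of [fourierL1] from the dense subspace L1 /\ L2. *)
Definition is_fourier (f g : R -> C) : Prop :=
  L2 f /\ L2 g /\
  exists u : nat -> R -> C,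
    [/\ forall n, L1 (u n) /\ L2 (u n),
        forall n, L2 (fourierL1 (u n)),
        cvgL2 u f & cvgL2 (fun n => fourierL1 (u n)) g].

(* A representative, determined up to a null set when [f] is in L2. *)
Definition fourier (f : R -> C) : R -> C :=
  xget (fun=> 0) [set g | is_fourier f g].

Definition translate {T : Type} (a : R) (f : R -> T) : R -> T :=
  fun x => f (x + a).

Definition bandlimited (omega : R) (f : R -> C) : Prop :=
  L2 f /\ {ae mu, forall xi, xi \notin `[- omega, omega] -> fourier f xi = 0}.

End L2.

Section Frames.
Context {R : realType}.
Local Notation C := R[i].
Local Notation mu := (@lebesgue_measure R).

Definition atom (phi : 'I_3 -> R -> C) (t0 : R) (j : 'I_3) (n : int) : R -> C :=
  translate (n%:~R * t0) (phi j).

Definition is_frame (omega t0 : R) (phi : 'I_3 -> R -> C) : Prop :=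
  exists A B : R, [/\ 0 < A, A <= B & forall f, bandlimited omega f ->
    (A%:E * sqnormL2 f <=
       \sum_(j < 3) \esum_(n in [set: int])
          ((cabs (innerL2 f (atom phi t0 j n))) ^+ 2)%:E)%E /\
    (\sum_(j < 3) \esum_(n in [set: int])
          ((cabs (innerL2 f (atom phi t0 j n))) ^+ 2)%:E
       <= B%:E * sqnormL2 f)%E].

(* [g = S f]; the series over Z converges unconditionally in L2, i.e. along the
   net of finite sets of integers. *)
Definition frame_operator (phi : 'I_3 -> R -> C) (t0 : R) (f g : R -> C) : Prop :=
  L2 g /\
  forall e : R, 0 < e -> exists N0 : {fset int}, forall N : {fset int},
    (N0 `<=` N)%fset ->
    (sqnormL2 (fun x => (g x - \sum_(j < 3) \sum_(n <- enum_fset N)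
        innerL2 f (atom phi t0 j n) * atom phi t0 j n x)%R) < e%:E)%E.

(* [phistar j = S^-1 (phi j)] in the space of [omega]-bandlimited functions. *)
Definition dual_generators (omega t0 : R) (phi phistar : 'I_3 -> R -> C) : Prop :=
  forall j, bandlimited omega (phistar j) /\
            frame_operator phi t0 (phistar j) (phi j).

Definition fourier_row (phi : 'I_3 -> R -> C) (xi : R) : 'rV[C]_3 :=
  \row_j fourier (phi j) xi.

End Frames.

Section Matrices.
Context {R : realType}.
Local Notation C := R[i].

Definition conj_mx {m n} (A : 'M[C]_(m, n)) : 'M[C]_(m, n) := map_mx conjc A.

Definition conj_trmx {m n} (A : 'M[C]_(m, n)) : 'M[C]_(n, m) := (conj_mx A)^T.

(* Indices are taken in 'I_3 = Z/3. *)
Definition crossmul (u v : 'rV[C]_3) : 'rV[C]_3 :=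
  \row_(k < 3) (u 0 (k + 1) * v 0 (k + 2%:R) - u 0 (k + 2%:R) * v 0 (k + 1)).

Definition strictly_increasing {n p} (f : {ffun 'I_n -> 'I_p}) : bool :=
  [forall i : 'I_n, forall j : 'I_n, (i < j)%N ==> (f i < f j)%N].

Definition minors_sqsum (n : nat) {p q} (A : 'M[C]_(p, q)) : R :=
  \sum_(f : {ffun 'I_n -> 'I_p} | strictly_increasing f)
    \sum_(g : {ffun 'I_n -> 'I_q} | strictly_increasing g)
      (cabs (\det (mxsub f g A))) ^+ 2.

Definition rows3 (a b c : 'rV[C]_3) : 'M[C]_3 := \matrix_(i < 3) [:: a; b; c]`_i.

End Matrices.

Section PreGramian.
Context {R : realType}.
Local Notation C := R[i].
Variables (omega t0 : R) (phi : 'I_3 -> R -> C).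
Let h : R := 2 * pi / t0.
Let P : R -> 'rV[C]_3 := fourier_row phi.

(* The pre-Gramian on the period (0, h); the value at the finitely many
   breakpoints is irrelevant. *)
Definition preGramian0 (x : R) : 'M[C]_3 :=
  (Num.sqrt h)%:C *:
  (if x \in `]0, omega - h[ then
     rows3 (translate (- h) P x) (P x) (translate h P x)
   else if x \in `]omega - h, 2 * h - omega[ then
     rows3 (translate (- h) P x) (P x) 0
   else if x \in `]2 * h - omega, h[ then
     rows3 (translate (- (2 * h)) P x) (translate (- h) P x) (P x)
   else 0).

Definition preGramian (x : R) : 'M[C]_3 :=
  preGramian0 (x - (Num.floor (x / h))%:~R * h).

(* Deletes the last row, which is the zero row on K and its translates. *)
Definition preGramian2 (x : R) : 'M[C]_(2, 3) := row' ord_max (preGramian x).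

Definition dualD (x : R) : C := (Num.sqrt h)%:C * (\det (conj_trmx (preGramian x)))^-1.

Definition dualE (x : R) : C :=
  h%:C * (\det (preGramian2 x *m conj_trmx (preGramian2 x)))^-1.

End PreGramian.

(* Main.v *)
(* By Parseval for Fourier series on [0, h), the coefficients
   <f, tau_(n t0) phi_l> are those of the h-periodization w_l of
   f^ conj(phi_l^).  At a point x of (0, h) the vector w(x) depends only on the
   fibre (f^(x + k h))_k, which for f in the band has three entries on
   K_- and K_+ and two on K, and the frame operator acts on fibres by a matrix
   built from the pre-Gramian at x.  Inverting it is Cramer's rule on K_- and
   K_+, and the pseudo-inverse of a 2 x 3 matrix on K; both are expressed by
   cross products.  The resulting functions Psi_j are bounded, satisfy
   h sum_l Psi_l(x + k h) w_l(x) = f^(x + k h) for every f in the band, and are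
   mapped to phi_j^ by the frame operator: the first property gives the lower
   frame bound and uniqueness, the second one existence.

   The Fourier transform on L2 is the isometry extending fourierL1 from step
   functions, whose transforms have the same Gram matrix because
   int (1 - cos(a t)) / t^2 dt = pi |a|. *)

Require Import Defs.
From HB Require Import structures.
From mathcomp Require Import all_boot all_order all_algebra finmap.
From mathcomp Require Import complex.
From mathcomp Require Import all_classical all_reals all_analysis.
From mathcomp Require Import measurable_realfun.
From mathcomp Require Import ring lra zify.

Set Implicit Arguments.
Unset Strict Implicit.
Unset Printing Implicit Defensive.

Import Order.TTheory GRing.Theory Num.Theory.
Import numFieldNormedType.Exports.

Local Open Scope classical_set_scope.
Local Open Scope ring_scope.
Local Open Scope complex_scope.

(** * Pre-Hilbert spaces *)

(** The delicate point is the L2 convergence of Fourier series on one period. It is derived from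
    Plancherel instead of from trigonometric approximation. For f supported in [0, h), the
    coefficients of e^{-isx} f are samples of f^ on s + t0 Z. Bessel bounds their energy for each s,
    while integrating over s in [0, t0) recovers the whole norm of f, so no interval of s can carry
    a fixed deficit. Hence some arbitrarily small s gives a modulation close to its Fourier sum, and
    this modulation is close to f. The rest is shaped by null sets, since functions are not
    identified when they agree almost everywhere. The transforms P_l and the duals Q_j are replaced
    by truncations whose bound and support hold at every point; fibre identities are checked at
    regular points of one cell and carried to [-2h, 2h) by four shifts. The lower bounds on the
    determinants enter quantitatively: they make the Q_j bounded, so that multiplication by Q_j acts
    on L2. Determinants are invariant under cyclic permutations of three rows, which is why a single
    periodic factor D serves all translates. *)

Section ComplexModulus.
Context {R : realType}.
Implicit Types z w : R[i].

Lemma cabs2E z : cabs z ^+ 2 = complex.Re z ^+ 2 + complex.Im z ^+ 2.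
Proof. by case: z => a b /=; rewrite sqr_sqrtr // addr_ge0 ?sqr_ge0. Qed.

Lemma cabs_ge0 z : 0 <= cabs z.
Proof. by case: z => a b /=; exact: sqrtr_ge0. Qed.

Lemma cabs2J z : (cabs z ^+ 2)%:C = z * conjc z.
Proof. by rewrite cabs2E; case: z => a b; simpc; congr Complex; ring. Qed.

Lemma cabsJ z : cabs (conjc z) = cabs z.
Proof. by case: z => a b /=; rewrite sqrrN. Qed.

Lemma cabs2D_le z w : cabs (z + w) ^+ 2 <= 2 * cabs z ^+ 2 + 2 * cabs w ^+ 2.
Proof.
rewrite !cabs2E; case: z w => [a b] [c d] /=.
have := sqr_ge0 (a - c); have := sqr_ge0 (b - d); lra.
Qed.

Lemma cabs_Re z : `|complex.Re z| <= cabs z.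
Proof.
by case: z => a b /=; rewrite -(sqrtr_sqr a) ler_wsqrtr // lerDl sqr_ge0.
Qed.

Lemma cabs_Im z : `|complex.Im z| <= cabs z.
Proof.
by case: z => a b /=; rewrite -(sqrtr_sqr b) ler_wsqrtr // lerDr sqr_ge0.
Qed.

Lemma cabs_le_ReIm z : cabs z <= `|complex.Re z| + `|complex.Im z|.
Proof.
rewrite -(@ler_pXn2r _ 2) ?nnegrE ?cabs_ge0 ?addr_ge0 //.
rewrite cabs2E sqrrD !real_normK ?num_real //.
by rewrite -addrA lerD2l lerDr mulrn_wge0 // mulr_ge0.
Qed.

Lemma ReD z w : complex.Re (z + w) = complex.Re z + complex.Re w.
Proof. by case: z w => [a b] [c d]. Qed.
Lemma ImD z w : complex.Im (z + w) = complex.Im z + complex.Im w.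
Proof. by case: z w => [a b] [c d]. Qed.
Lemma ReM z w : complex.Re (z * w) =
  complex.Re z * complex.Re w - complex.Im z * complex.Im w.
Proof. by case: z w => [a b] [c d]. Qed.
Lemma ImM z w : complex.Im (z * w) =
  complex.Re z * complex.Im w + complex.Im z * complex.Re w.
Proof. by case: z w => [a b] [c d] /=; rewrite [b * c]mulrC. Qed.
Lemma ReN z : complex.Re (- z) = - complex.Re z.
Proof. by case: z. Qed.
Lemma ImN z : complex.Im (- z) = - complex.Im z.
Proof. by case: z. Qed.
Lemma ReJ z : complex.Re (conjc z) = complex.Re z.
Proof. by case: z. Qed.
Lemma ImJ z : complex.Im (conjc z) = - complex.Im z.
Proof. by case: z. Qed.

Lemma conjcD z w : conjc (z + w) = conjc z + conjc w.
Proof. exact: (rmorphD (@conjc R)). Qed.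
Lemma conjcN z : conjc (- z) = - conjc z.
Proof. exact: (rmorphN (@conjc R)). Qed.
Lemma conjcM z w : conjc (z * w) = conjc z * conjc w.
Proof. exact: (rmorphM (@conjc R)). Qed.
Lemma conjc_sum (I : Type) (r : seq I) (F : I -> R[i]) :
  conjc (\sum_(i <- r) F i) = \sum_(i <- r) conjc (F i).
Proof. exact: (rmorph_sum (@conjc R)). Qed.

End ComplexModulus.

Section PreHilbert.
Context {R : realType} {V : lmodType R[i]}.

(** The form is only semidefinite: the instance used below is the space of square-integrable
    functions, not of their classes, where [nsq x = 0] means that [x] vanishes almost everywhere. *)
Record inner_product := InnerProduct {
  ip :> V -> V -> R[i];
  ipDl : forall x y z, ip (x + y) z = ip x z + ip y z;
  ipZl : forall a x y, ip (a *: x) y = a * ip x y;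
  ipJ : forall x y, conjc (ip x y) = ip y x;
  ip_ge0 : forall x, 0 <= complex.Re (ip x x) }.

Variable b : inner_product.

(** Estimates are made on the squared norm, with the factor 2 of [nsqD_le] in place of the triangle
    inequality, so that no square root enters. *)
Definition nsq (x : V) : R := complex.Re (b x x).

Lemma nsq_ge0 x : 0 <= nsq x.
Proof. exact: ip_ge0. Qed.

Lemma ip_nsq x : b x x = (nsq x)%:C.
Proof.
rewrite /nsq; have := ipJ b x x; case: (b x x) => [r s] [] /= hs.
by congr Complex; lra.
Qed.

Lemma ip0l y : b 0 y = 0.
Proof. by rewrite -(scale0r (0 : V)) ipZl mul0r. Qed.

Lemma ip0r y : b y 0 = 0.
Proof. by rewrite -ipJ ip0l conjc0. Qed.

Lemma ipNl x y : b (- x) y = - b x y.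
Proof. by rewrite -scaleN1r ipZl mulN1r. Qed.

Lemma ipBl x y z : b (x - y) z = b x z - b y z.
Proof. by rewrite ipDl ipNl. Qed.

Lemma ipDr x y z : b x (y + z) = b x y + b x z.
Proof. by rewrite -ipJ ipDl conjcD !ipJ. Qed.

Lemma ipNr x y : b x (- y) = - b x y.
Proof. by rewrite -ipJ ipNl conjcN !ipJ. Qed.

Lemma ipBr x y z : b x (y - z) = b x y - b x z.
Proof. by rewrite ipDr ipNr. Qed.

Lemma ipZr a x y : b x (a *: y) = conjc a * b x y.
Proof. by rewrite -ipJ ipZl conjcM !ipJ. Qed.

Lemma ip_suml (I : Type) (r : seq I) (F : I -> V) y :
  b (\sum_(i <- r) F i) y = \sum_(i <- r) b (F i) y.
Proof. exact: (big_morph (fun x => b x y) (fun x z => ipDl b x z y) (ip0l y)). Qed.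

Lemma ip_sumr (I : Type) (r : seq I) (F : I -> V) y :
  b y (\sum_(i <- r) F i) = \sum_(i <- r) b y (F i).
Proof. exact: (big_morph (b y) (ipDr y) (ip0r y)). Qed.

Lemma nsq0 : nsq 0 = 0.
Proof. by rewrite /nsq ip0l. Qed.

Lemma nsqN x : nsq (- x) = nsq x.
Proof. by rewrite /nsq ipNl ipNr opprK. Qed.

Lemma nsqBC x y : nsq (x - y) = nsq (y - x).
Proof. by rewrite -nsqN opprB. Qed.

Lemma nsqZ a x : nsq (a *: x) = cabs a ^+ 2 * nsq x.
Proof.
rewrite /nsq ipZl ipZr ip_nsq cabs2E.
by case: a => [r s]; simpc => /=; rewrite /nsq; ring.
Qed.

Lemma nsqD x y : nsq (x + y) = nsq x + nsq y + 2 * complex.Re (b x y).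
Proof.
rewrite /nsq ipDl !ipDr !ReD -(ipJ b x y) ReJ; ring.
Qed.

Lemma nsqB x y : nsq (x - y) = nsq x + nsq y - 2 * complex.Re (b x y).
Proof. by rewrite nsqD nsqN ipNr ReN mulrN. Qed.

Lemma parallelogram x y : nsq (x + y) + nsq (x - y) = 2 * nsq x + 2 * nsq y.
Proof. rewrite nsqD nsqB; ring. Qed.

Lemma nsqD_le x y : nsq (x + y) <= 2 * nsq x + 2 * nsq y.
Proof. by rewrite -parallelogram lerDl nsq_ge0. Qed.

Lemma nsqB_le x y z : nsq (x - z) <= 2 * nsq (x - y) + 2 * nsq (y - z).
Proof. by have := nsqD_le (x - y) (y - z); rewrite addrA subrK. Qed.

Lemma polar_Re x y : complex.Re (b x y) = (nsq x + nsq y - nsq (x - y)) / 2.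
Proof. rewrite nsqB; lra. Qed.

(** Multiplying the second argument by ['i] turns the imaginary part into a real part, to which
    [polar_Re] applies. *)
Lemma polar_Im x y :
  complex.Im (b x y) = (nsq x + nsq y - nsq (x - 'i *: y)) / 2.
Proof.
have -> : complex.Im (b x y) = complex.Re (b x ('i *: y)).
  by rewrite ipZr; case: (b x y) => r s; simpc.
rewrite polar_Re; congr ((_ + _ - _) / _).
by rewrite nsqZ cabs2E /= expr0n /= expr1n add0r mul1r.
Qed.

(** Pythagoras for the projection onto the line of [y]. Its nonnegativity is Cauchy-Schwarz, and in
    [projection_dense] it measures what one more step along [y] gains. *)
Lemma nsq_proj x y : 0 < nsq y ->
  nsq (x - (b x y / (nsq y)%:C) *: y) = nsq x - cabs (b x y) ^+ 2 / nsq y.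
Proof.
move=> y0; have y0' : nsq y != 0 by rewrite gt_eqF.
rewrite nsqB nsqZ ipZr; set w := b x y.
have -> : conjc (w / (nsq y)%:C) * w = (cabs w ^+ 2 / nsq y)%:C.
  rewrite conjcM conjc_inv conjc_real [RHS]rmorphM fmorphV /= cabs2J.
  by rewrite -mulrA [_^-1 * _]mulrC mulrA [conjc w * w]mulrC.
have -> : cabs (w / (nsq y)%:C) ^+ 2 = cabs w ^+ 2 / nsq y ^+ 2.
  rewrite ComplexField.Normc.normcM ComplexField.Normc.normcV exprMn exprVn.
  by congr (_ * _^-1); rewrite cabs2E /= expr0n addr0.
rewrite [complex.Re _]/=; field.
by [].
Qed.

(** A nonzero [y] may have [nsq y = 0]. Then the quadratic term of [nsq (x - t b(x,y) y)] disappears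
    and an affine function of t remains; a nonzero slope would make it negative. *)
Lemma ip_nsq0 x y : nsq y = 0 -> b x y = 0.
Proof.
move=> y0; apply: ComplexField.Normc.eq0_normc.
apply/eqP; rewrite -sqrf_eq0; apply/eqP.
set c := cabs _ ^+ 2; have c0 : 0 <= c by exact: sqr_ge0.
have key t : 0 <= nsq x - 2 * t * c.
  have := nsq_ge0 (x - (t%:C * b x y) *: y).
  rewrite nsqB nsqZ y0 mulr0 addr0 ipZr.
  suff -> : complex.Re (conjc (t%:C * b x y) * b x y) = t * c by rewrite mulrA.
  by rewrite /c cabs2E; case: (b x y) => r s; simpc => /=; ring.
apply/eqP; rewrite eq_le c0 andbT leNgt; apply/negP => cp.
(* At this value of [t] the affine function equals -1. *)
have := key ((nsq x + 1) / (2 * c)).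
have -> : 2 * ((nsq x + 1) / (2 * c)) * c = nsq x + 1.
  by field; rewrite gt_eqF.
lra.
Qed.

Lemma cauchy_schwarz x y : cabs (b x y) ^+ 2 <= nsq x * nsq y.
Proof.
have [y0|y0] := eqVneq (nsq y) 0.
  by rewrite ip_nsq0 // ComplexField.Normc.normc0 expr0n y0 mulr0.
have yp : 0 < nsq y by rewrite lt_neqAle eq_sym y0 nsq_ge0.
have := nsq_ge0 (x - (b x y / (nsq y)%:C) *: y).
by rewrite nsq_proj // subr_ge0 ler_pdivrMr.
Qed.

Definition sq_cvg (u : nat -> V) (x : V) := forall e : R, 0 < e ->
  exists N, forall n, (N <= n)%N -> nsq (u n - x) < e.

Definition sq_cauchy (u : nat -> V) := forall e : R, 0 < e ->
  exists N, forall m n, (N <= m)%N -> (N <= n)%N -> nsq (u m - u n) < e.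

Definition sq_complete := forall u, sq_cauchy u -> exists x, sq_cvg u x.

Lemma sq_cvg_cauchy u x : sq_cvg u x -> sq_cauchy u.
Proof.
move=> ux e e0; have e4 : 0 < e / 4 by lra.
have [N HN] := ux _ e4; exists N => m n /HN hm /HN hn.
have := nsqB_le (u m) x (u n); rewrite (nsqBC x) => h; lra.
Qed.

Lemma sq_cvgD u v x y : sq_cvg u x -> sq_cvg v y ->
  sq_cvg (fun n => u n + v n) (x + y).
Proof.
move=> ux vy e e0; have e4 : 0 < e / 4 by lra.
have [N HN] := ux _ e4; have [M HM] := vy _ e4.
exists (maxn N M) => n; rewrite geq_max => /andP[/HN h1 /HM h2].
rewrite opprD addrACA; have := nsqD_le (u n - x) (v n - y); lra.
Qed.

Lemma sq_cvgZ a u x : sq_cvg u x -> sq_cvg (fun n => a *: u n) (a *: x).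
Proof.
move=> ux e e0.
have e1 : 0 < e / (cabs a ^+ 2 + 1).
  by rewrite divr_gt0 // ltr_wpDl ?sqr_ge0.
have [N HN] := ux _ e1; exists N => n /HN h.
rewrite -scalerBr nsqZ.
have a1 : 0 < cabs a ^+ 2 + 1 by rewrite ltr_wpDl ?sqr_ge0.
rewrite ltr_pdivlMr // in h; apply: le_lt_trans h.
rewrite mulrDr mulr1 mulrC lerDl; exact: nsq_ge0.
Qed.

(** Inner products are continuous by Cauchy-Schwarz. The two sides carry different sequences and
    test vectors because the identities passed to the limit relate a function to its transform. *)
Lemma sq_cvg_ip2 u v x y z w : sq_cvg u x -> sq_cvg v y ->
  (forall n, b (u n) z = b (v n) w) -> b x z = b y w.
Proof.
move=> ux vy uv; apply/eqP; rewrite -subr_eq0; apply/eqP.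
apply: ComplexField.Normc.eq0_normc; apply/eqP; rewrite -sqrf_eq0.
rewrite eq_le sqr_ge0 andbT; apply/ler_addgt0Pr => e e0; rewrite add0r.
pose K := nsq z + nsq w + 1.
have z0 := nsq_ge0 z; have w0 := nsq_ge0 w.
have K0 : 0 < K by rewrite /K; lra.
have d0 : 0 < e / 4 / K by rewrite !divr_gt0.
have [N HN] := ux _ d0; have [M HM] := vy _ d0; pose n := maxn N M.
have := HN n (leq_maxl _ _); have := HM n (leq_maxr _ _).
rewrite !ltr_pdivlMr // => h2 h1.
have -> : b x z - b y w = b (x - u n) z + b (v n - y) w.
  by rewrite !ipBl uv addrA subrK.
apply: le_trans (cabs2D_le _ _) _.
have := cauchy_schwarz (x - u n) z; have := cauchy_schwarz (v n - y) w.
rewrite (nsqBC x) => g2 g1.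
have p1 : nsq (u n - x) * nsq z <= nsq (u n - x) * K.
  by rewrite ler_wpM2l ?nsq_ge0 // /K; lra.
have p2 : nsq (v n - y) * nsq w <= nsq (v n - y) * K.
  by rewrite ler_wpM2l ?nsq_ge0 // /K; lra.
lra.
Qed.

End PreHilbert.

(** * Density, extension of isometries, Bessel's inequality *)

Section HilbertTheory.
Context {R : realType} {V : lmodType R[i]}.
Variable b : @inner_product R V.
Local Notation nsq := (nsq b).

Lemma le0_eps (x : R) : (forall e : R, 0 < e -> x <= e) -> x <= 0.
Proof. by move=> h; apply/ler_addgt0Pr => e e0; rewrite add0r h. Qed.

(** A sequence in [W] minimising the distance to [x] is Cauchy; its limit [p] has [x - p] orthogonal
    to [W], hence of norm zero by totality. As [W] is not closed, [p] itself may lie outside, and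
    the conclusion is an approximation. *)
Lemma projection_dense (W : V -> Prop) :
  sq_complete b -> W 0 -> (forall a x y, W x -> W y -> W (a *: x + y)) ->
  (forall x, (forall w, W w -> b x w = 0) -> nsq x = 0) ->
  forall x e, 0 < e -> exists2 w, W w & nsq (x - w) < e.
Proof.
move=> cV W0 WD Wtot x.
pose S := [set r : R | exists2 w, W w & r = nsq (x - w)].
have infS : has_inf S.
  split; first by exists (nsq (x - 0)), 0.
  by exists 0 => r [w _ ->]; exact: nsq_ge0.
have dle w : W w -> inf S <= nsq (x - w).
  by move=> Ww; apply: ge_inf => //; [case: infS | exists w].
have [w Hw] : {w : nat -> V & forall n, W (w n) /\
    nsq (x - w n) < inf S + n.+1%:R^-1}.
  apply: (choice (P := fun n v => W v /\ nsq (x - v) < inf S + n.+1%:R^-1)) => n.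
  have n0 : 0 < (n.+1%:R^-1 : R) by rewrite invr_gt0 ltr0Sn.
  have [r [v Wv ->] h] := inf_adherent n0 infS.
  by exists v.
have small e : 0 < e -> exists N, forall n, (N <= n)%N -> n.+1%:R^-1 < e :> R.
  move=> e0; exists (Num.truncn e^-1) => n hn.
  rewrite invf_plt ?posrE ?ltr0Sn //.
  have /andP[_] := Num.Theory.truncn_itv (ltW (etrans (invr_gt0 e) e0)).
  by move=> /lt_le_trans; apply; rewrite ler_nat.
(* The midpoint of [w m] and [w n] lies in [W], so its squared distance to [x] is at least [inf S];
   the parallelogram law then bounds [nsq (w m - w n)] by 2/(m+1) + 2/(n+1). *)
have wC : sq_cauchy b w.
  move=> e e0; have e4 : 0 < e / 4 by lra.
  have [N HN] := small _ e4; exists N => m n /HN hm /HN hn.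
  have := parallelogram b (x - w m) (x - w n).
  have -> : (x - w m) - (x - w n) = w n - w m.
    by rewrite opprB addrC addrA subrK.
  rewrite (nsqBC b (w n)) => h.
  have : inf S <= nsq (x - (2^-1 *: w m + 2^-1 *: w n)).
    apply: dle; apply: (WD); first exact: (Hw m).1.
    by rewrite -[_ *: _]addr0; apply: (WD); [exact: (Hw n).1|].
  have -> : x - (2^-1 *: w m + 2^-1 *: w n) =
            2^-1 *: ((x - w m) + (x - w n)).
    have hx : 2^-1 *: (x + x) = x.
      by rewrite -[x + x]mulr2n -[x *+ 2]scaler_nat scalerA mulVf ?pnatr_eq0 // scale1r.
    by rewrite addrACA -opprD scalerBr hx scalerDr.
  rewrite nsqZ.
  have -> : cabs (2^-1 : R[i]) ^+ 2 = 4^-1.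
    rewrite ComplexField.Normc.normcV exprVn cabs2E /= ; congr _^-1; ring.
  have := (Hw m).2; have := (Hw n).2; move: h hm hn.
  set A := nsq _; set B := nsq _; set D := nsq _; set E := nsq _.
  move: (m.+1%:R^-1) (n.+1%:R^-1) (inf S) A B D E => X Y Z A B D E; lra.
have [p wp] := cV _ wC.
(* Moving [w n] along [v] stays in [W], so the gain computed by [nsq_proj] is at most 1/(n+1), and
   it vanishes in the limit. *)
have orth v : W v -> b (x - p) v = 0.
  move=> Wv; have [v0|v0] := eqVneq (nsq v) 0; first exact: ip_nsq0.
  have vp : 0 < nsq v by rewrite lt_neqAle eq_sym v0 nsq_ge0.
  have bnd n : cabs (b (x - w n) v) ^+ 2 <= nsq v / n.+1%:R.
    rewrite -ler_pdivrMl // mulrC.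
    have : inf S <= nsq (x - w n - (b (x - w n) v / (nsq v)%:C) *: v).
      rewrite -addrA -opprD; apply: dle; rewrite addrC.
      by apply: WD => //; exact: (Hw n).1.
    rewrite nsq_proj //; have := (Hw n).2; move: (n.+1%:R^-1) => t; lra.
  apply: ComplexField.Normc.eq0_normc; apply/eqP; rewrite -sqrf_eq0.
  rewrite eq_le sqr_ge0 andbT; apply: le0_eps => e e0.
  have e4 : 0 < e / 4 / nsq v by rewrite !divr_gt0.
  have [N HN] := small _ e4; have [M HM] := wp _ e4.
  pose n := maxn N M.
  have h1 := HN n (leq_maxl _ _); have h2 := HM n (leq_maxr _ _).
  have -> : x - p = (x - w n) + (w n - p) by rewrite addrA subrK.
  rewrite ipDl; apply: le_trans (cabs2D_le _ _) _.
  have := cauchy_schwarz b (w n - p) v.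
  rewrite ltr_pdivlMr // in h1; rewrite ltr_pdivlMr // in h2.
  have := bnd n; move: h1 h2; move: (n.+1%:R^-1) => t; lra.
move=> e e0; have e2 : 0 < e / 2 by lra.
have [N HN] := wp _ e2; exists (w N); first exact: (Hw N).1.
have := nsqB_le b x p (w N); rewrite (Wtot _ orth).
by have := HN N (leqnn N); rewrite (nsqBC b (w N)); lra.
Qed.

Definition lincomb {I : Type} (s : I -> V) (l : seq (R[i] * I)) : V :=
  \sum_(p <- l) p.1 *: s p.2.

Lemma lincombD I (s : I -> V) l l' :
  lincomb s (l ++ l') = lincomb s l + lincomb s l'.
Proof. by rewrite /lincomb big_cat. Qed.

Lemma lincombZ I (s : I -> V) a l :
  lincomb s [seq (a * p.1, p.2) | p <- l] = a *: lincomb s l.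
Proof.
rewrite /lincomb big_map scaler_sumr; apply: eq_bigr => p _.
by rewrite scalerA.
Qed.

Lemma lincomb_gram I (s k : I -> V) (l l' : seq (R[i] * I)) :
  (forall i j, b (s i) (s j) = b (k i) (k j)) ->
  b (lincomb s l) (lincomb s l') = b (lincomb k l) (lincomb k l').
Proof.
move=> gram; rewrite /lincomb !ip_suml.
apply: eq_bigr => p _; rewrite !ip_sumr; apply: eq_bigr => q _.
by rewrite !ipZl !ipZr gram.
Qed.

(** Approximate [x] by combinations of the total family [s]. Equal Gram matrices make the same
    combinations of [k] Cauchy, and norms survive the limit. The combinations are returned too,
    since they serve as the approximants required by [is_fourier]. *)
Lemma isometry_extension (I : Type) (s k : I -> V) : sq_complete b ->
  (forall i j, b (s i) (s j) = b (k i) (k j)) ->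
  (forall x, (forall i, b x (s i) = 0) -> nsq x = 0) ->
  forall x, exists (l : nat -> seq (R[i] * I)) (y : V),
    [/\ sq_cvg b (fun n => lincomb s (l n)) x,
        sq_cvg b (fun n => lincomb k (l n)) y & nsq x = nsq y].
Proof.
move=> cV gram tot x.
have [l Hl] : {l : nat -> seq (R[i] * I) &
    forall n, nsq (x - lincomb s (l n)) < n.+1%:R^-1}.
  apply: (choice (P := fun n l => nsq (x - lincomb s l) < n.+1%:R^-1)) => n.
  have n0 : 0 < (n.+1%:R^-1 : R) by rewrite invr_gt0 ltr0Sn.
  have [_ [l ->] h] : exists2 w, (exists l, w = lincomb s l) &
      nsq (x - w) < n.+1%:R^-1.
    apply: projection_dense => //.
    - by exists [::]; rewrite /lincomb big_nil.
    - move=> a y z [l ->] [l' ->].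
      by exists ([seq (a * p.1, p.2) | p <- l] ++ l'); rewrite lincombD lincombZ.
    - move=> y yW; apply: tot => i; apply: yW; exists [:: (1, i)].
      by rewrite /lincomb big_seq1 scale1r.
  by exists l.
have lx : sq_cvg b (fun n => lincomb s (l n)) x.
  move=> e e0; exists (Num.truncn e^-1) => n hn; rewrite nsqBC.
  apply: lt_trans (Hl n) _; rewrite invf_plt ?posrE ?ltr0Sn //.
  have /andP[_] := Num.Theory.truncn_itv (ltW (etrans (invr_gt0 e) e0)).
  by move=> /lt_le_trans; apply; rewrite ler_nat.
have [y ly] : exists y, sq_cvg b (fun n => lincomb k (l n)) y.
  apply: cV => e e0; have [N HN] := sq_cvg_cauchy lx e0.
  exists N => m n hm hn; have := HN m n hm hn.
  (* A difference of two combinations is again one, with the same coefficients for [s] and [k], so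
     [lincomb_gram] compares the Cauchy conditions. *)
  have E (t : I -> V) : lincomb t (l m) - lincomb t (l n) =
      lincomb t (l m ++ [seq (-1 * p.1, p.2) | p <- l n]).
    by rewrite lincombD lincombZ scaleN1r.
  by rewrite !E /nsq (lincomb_gram _ _ gram).
exists l, y; split => //.
have xy l' : b x (lincomb s l') = b y (lincomb k l').
  by apply: (sq_cvg_ip2 lx ly) => n; exact: lincomb_gram.
congr complex.Re; apply: (sq_cvg_ip2 lx ly) => n.
by rewrite -ipJ xy ipJ.
Qed.

Section Bessel.
Context {I : eqType} (e : I -> V) (h : R).
Hypothesis h_gt0 : 0 < h.
Hypothesis orth : forall i j, b (e i) (e j) = (h * (i == j)%:R)%:C.

Definition fourier_sum (x : V) (N : seq I) : V :=
  \sum_(i <- N) ((h^-1)%:C * b x (e i)) *: e i.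

Lemma fourier_sum_orth x N i : uniq N -> i \in N ->
  b (x - fourier_sum x N) (e i) = 0.
Proof.
move=> uN iN; rewrite ipBl ip_suml (bigD1_seq i) //= ipZl orth eqxx mulr1.
rewrite big1 => [|j /negbTE ji]; last by rewrite ipZl orth ji mulr0 mulr0.
rewrite addr0 mulrAC -rmorphM /= mulVf ?gt_eqF // mul1r subrr //.
Qed.

Lemma bessel_eq x N : uniq N ->
  nsq (x - fourier_sum x N) =
  nsq x - h^-1 * \sum_(i <- N) cabs (b x (e i)) ^+ 2.
Proof.
move=> uN; have orthx : b (x - fourier_sum x N) (fourier_sum x N) = 0.
  rewrite {2}/fourier_sum ip_sumr big_seq big1 // => i iN.
  by rewrite ipZr fourier_sum_orth ?mulr0.
have -> : nsq (x - fourier_sum x N) = complex.Re (b x x - b (fourier_sum x N) x).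
  by rewrite /nsq ipBr orthx subr0 ipBl.
rewrite ReD ReN; congr (_ - _).
rewrite ip_suml (big_morph _ (@ReD R) (erefl _)) mulr_sumr.
apply: eq_bigr => i _; rewrite ipZl -(ipJ b x) -mulrA -cabs2J.
by rewrite -rmorphM.
Qed.

Lemma bessel_le x N : uniq N ->
  \sum_(i <- N) cabs (b x (e i)) ^+ 2 <= h * nsq x.
Proof.
move=> uN; have := nsq_ge0 b (x - fourier_sum x N).
by rewrite bessel_eq // subr_ge0 mulrC ler_pdivrMr // mulrC.
Qed.

(** The residual of the Fourier sum is orthogonal to all [e i] with [i] in [N]. Thus one good
    combination, however it was found, controls the Fourier sums over every larger index set. *)
Lemma best_approx x (N0 N : seq I) (a : I -> R[i]) : uniq N ->
  {subset N0 <= N} ->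
  nsq (x - fourier_sum x N) <= nsq (x - \sum_(i <- N0) a i *: e i).
Proof.
move=> uN sN; set p := \sum_(i <- N0) _.
have -> : x - p = (x - fourier_sum x N) + (fourier_sum x N - p).
  by rewrite addrA subrK.
rewrite (nsqD b (x - fourier_sum x N)).
suff -> : b (x - fourier_sum x N) (fourier_sum x N - p) = 0.
  by rewrite mulr0 addr0 lerDl nsq_ge0.
rewrite ipBr {2}/fourier_sum /p !ip_sumr big_seq big1 ?sub0r.
  rewrite big_seq big1 ?oppr0 // => i iN.
  by rewrite ipZr fourier_sum_orth ?mulr0 ?sN.
by move=> i iN; rewrite ipZr fourier_sum_orth ?mulr0.
Qed.

End Bessel.
End HilbertTheory.

(** * Square-integrable functions *)

Section ComplexIntegration.
Context {R : realType}.
Local Notation C := R[i].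
Local Notation mu := (@lebesgue_measure R).
Implicit Types (f g : R -> C) (p q : R -> R).

Lemma ae_imp (P Q : R -> Prop) : {ae mu, forall x, P x} ->
  (forall x, P x -> Q x) -> {ae mu, forall x, Q x}.
Proof.
by move=> aeP PQ; apply: (@filterS _ _ (ae_filter_ringOfSetsType mu) P).
Qed.

Lemma ae_and (P Q : R -> Prop) : {ae mu, forall x, P x} ->
  {ae mu, forall x, Q x} -> {ae mu, forall x, P x /\ Q x}.
Proof.
by move=> aeP aeQ; apply: (@filterI _ _ (ae_filter_ringOfSetsType mu)).
Qed.

Lemma cmeasurable_cst (c : C) : cmeasurable (fun=> c : C).
Proof. by split; exact: measurable_cst. Qed.

Lemma cmeasurableD f g : cmeasurable f -> cmeasurable g ->
  cmeasurable (fun x => f x + g x).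
Proof.
move=> [rf jf] [rg jg]; split.
  by under eq_fun do rewrite ReD; exact: measurable_funD.
by under eq_fun do rewrite ImD; exact: measurable_funD.
Qed.

Lemma cmeasurableM f g : cmeasurable f -> cmeasurable g ->
  cmeasurable (fun x => f x * g x).
Proof.
move=> [rf jf] [rg jg]; split.
  by under eq_fun do rewrite ReM; apply: measurable_funB; exact: measurable_funM.
by under eq_fun do rewrite ImM; apply: measurable_funD; exact: measurable_funM.
Qed.

Lemma cmeasurableZ c f : cmeasurable f -> cmeasurable (fun x => c * f x).
Proof. by move=> mf; apply: cmeasurableM => //; exact: cmeasurable_cst. Qed.

Lemma cmeasurableN f : cmeasurable f -> cmeasurable (fun x => - f x).
Proof.
move=> mf; have -> : (fun x => - f x) = (fun x => -1 * f x).
  by apply/funext => x; rewrite mulN1r.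
exact: cmeasurableZ.
Qed.

Lemma cmeasurableB f g : cmeasurable f -> cmeasurable g ->
  cmeasurable (fun x => f x - g x).
Proof. by move=> mf mg; apply: cmeasurableD => //; exact: cmeasurableN. Qed.

Lemma cmeasurableJ f : cmeasurable f -> cmeasurable (fun x => conjc (f x)).
Proof.
move=> [rf jf]; split; first by under eq_fun do rewrite ReJ.
by under eq_fun do rewrite ImJ; exact: measurable_funN.
Qed.

Lemma cmeasurable_real p : measurable_fun setT p -> cmeasurable (fun x => (p x)%:C).
Proof. by move=> mp; split => //=; exact: measurable_cst. Qed.

Lemma cmeasurable_sum (I : Type) (r : seq I) (F : I -> R -> C) :
  (forall i, cmeasurable (F i)) -> cmeasurable (fun x => \sum_(i <- r) F i x).
Proof.
move=> mF; elim: r => [|i r IH].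
  by under eq_fun do rewrite big_nil; exact: cmeasurable_cst.
by under eq_fun do rewrite big_cons; exact: cmeasurableD.
Qed.

Lemma cmeasurable_comp f p : measurable_fun setT p -> cmeasurable f ->
  cmeasurable (fun x => f (p x)).
Proof.
move=> mp [rf jf]; split.
  exact: (@measurableT_comp _ _ _ _ _ _ (fun x => complex.Re (f x)) _ p).
exact: (@measurableT_comp _ _ _ _ _ _ (fun x => complex.Im (f x)) _ p).
Qed.

Lemma measurable_sqrtr : measurable_fun setT (@Num.sqrt R).
Proof. by apply: continuous_measurable_fun; exact: sqrt_continuous. Qed.

Lemma measurable_cabs f : cmeasurable f -> measurable_fun setT (fun x => cabs (f x)).
Proof.
move=> [rf jf].
have -> : (fun x => cabs (f x)) =
    (fun x => Num.sqrt (complex.Re (f x) ^+ 2 + complex.Im (f x) ^+ 2)).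
  by apply/funext => x; case: (f x).
apply: measurableT_comp; first exact: measurable_sqrtr.
by apply: measurable_funD; exact: measurable_funX.
Qed.

Lemma measurable_cabs2 f : cmeasurable f ->
  measurable_fun setT (fun x => cabs (f x) ^+ 2).
Proof. by move=> mf; apply: measurable_funX; exact: measurable_cabs. Qed.

Lemma measurable_EFinR p : measurable_fun setT p ->
  measurable_fun setT (fun x => (p x)%:E).
Proof. by move=> mp; exact/measurable_EFinP. Qed.

Lemma emeasurable_cabs2 f : cmeasurable f ->
  measurable_fun setT (fun x => (cabs (f x) ^+ 2)%:E).
Proof. by move=> mf; apply/measurable_EFinP; exact: measurable_cabs2. Qed.

Definition rint p : Prop := mu.-integrable setT (EFin \o p).

Lemma rintP p : rint p <->
  measurable_fun setT p /\ (\int[mu]_x `|p x|%:E < +oo)%E.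
Proof.
split=> [/integrableP[mp fp]|[mp fp]]; first by split => //; exact/measurable_EFinP.
by apply/integrableP; split => //; exact/measurable_EFinP.
Qed.

Lemma rint_le p q : measurable_fun setT p -> (forall x, `|p x| <= q x) ->
  rint q -> rint p.
Proof.
move=> mp pq; apply: le_integrable => //; first exact/measurable_EFinP.
by move=> x _ /=; rewrite lee_fin (le_trans (pq x)) // ler_norm.
Qed.

Lemma rint_ge0 p : measurable_fun setT p -> (forall x, 0 <= p x) ->
  (\int[mu]_x (p x)%:E < +oo)%E -> rint p.
Proof.
move=> mp p0 fp; apply/rintP; split => //.
by under eq_integral do rewrite ger0_norm //.
Qed.

Lemma rint_lty p : (forall x, 0 <= p x) -> rint p -> (\int[mu]_x (p x)%:E < +oo)%E.
Proof.
by move=> p0 /rintP[_]; under eq_integral do rewrite ger0_norm //.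
Qed.

Lemma rintD p q : rint p -> rint q -> rint (fun x => p x + q x).
Proof. by move=> ip iq; have := integrableD measurableT ip iq. Qed.

Lemma rintZ k p : rint p -> rint (fun x => k * p x).
Proof. by move=> ip; have := integrableZl measurableT k ip. Qed.

Lemma rintN p : rint p -> rint (fun x => - p x).
Proof. by move=> ip; have := integrableN ip. Qed.

Lemma rintB p q : rint p -> rint q -> rint (fun x => p x - q x).
Proof. by move=> ip iq; apply: rintD => //; exact: rintN. Qed.

Lemma rint_norm p : rint p -> rint (fun x => `|p x|).
Proof. by move=> ip; have := integrable_norm ip. Qed.

Lemma rint_measurable p : rint p -> measurable_fun setT p.
Proof. by case/rintP. Qed.

Lemma RintEFin p : rint p -> ((\int[mu]_x p x)%R)%:E = (\int[mu]_x (p x)%:E)%E.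
Proof. by move=> ip; rewrite /Rintegral fineK //; exact: integrable_fin_num. Qed.

Lemma L1P f : L1 f <-> cmeasurable f /\ rint (fun x => cabs (f x)).
Proof.
split=> [[mf fp]|[mf ip]]; split => //.
  by apply: rint_ge0 => [|x|//]; [exact: measurable_cabs | exact: cabs_ge0].
by apply: rint_lty => // x; exact: cabs_ge0.
Qed.

Lemma L1_Re f : L1 f -> rint (fun x => complex.Re (f x)).
Proof. by case/L1P=> -[rf jf]; apply: rint_le => // x; exact: cabs_Re. Qed.

Lemma L1_Im f : L1 f -> rint (fun x => complex.Im (f x)).
Proof. by case/L1P=> -[rf jf]; apply: rint_le => // x; exact: cabs_Im. Qed.

Lemma L1_le f q : cmeasurable f -> (forall x, cabs (f x) <= q x) -> rint q -> L1 f.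
Proof.
move=> mf fq iq; apply/L1P; split => //; apply: rint_le iq.
  exact: measurable_cabs.
by move=> x; rewrite ger0_norm ?cabs_ge0.
Qed.

Lemma L1_ReIm f : rint (fun x => complex.Re (f x)) ->
  rint (fun x => complex.Im (f x)) -> L1 f.
Proof.
move=> ir ij; apply: L1_le (rintD (rint_norm ir) (rint_norm ij)).
  by split; exact: rint_measurable.
by move=> x; exact: cabs_le_ReIm.
Qed.

Lemma L1D f g : L1 f -> L1 g -> L1 (fun x => f x + g x).
Proof.
move=> /L1P[mf fi] /L1P[mg ig]; apply: L1_le (rintD fi ig).
  exact: cmeasurableD.
by move=> x; exact: le_normcD.
Qed.

Lemma L1Z c f : L1 f -> L1 (fun x => c * f x).
Proof.
move=> /L1P[mf fi]; apply: L1_le (rintZ (cabs c) fi); first exact: cmeasurableZ.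
by move=> x; rewrite ComplexField.Normc.normcM.
Qed.

Lemma L1N f : L1 f -> L1 (fun x => - f x).
Proof.
move=> /(L1Z (-1)); congr L1; apply/funext => x; exact: mulN1r.
Qed.

Lemma L1B f g : L1 f -> L1 g -> L1 (fun x => f x - g x).
Proof. by move=> mf mg; apply: L1D => //; exact: L1N. Qed.

Lemma L1_0 : L1 (fun=> 0 : C).
Proof.
apply: (@L1_le _ (cst 0)) => [|x|]; [exact: cmeasurable_cst| |].
  by rewrite ComplexField.Normc.normc0.
exact: integrable0.
Qed.

Lemma L1_sum (I : Type) (r : seq I) (F : I -> R -> C) :
  (forall i, L1 (F i)) -> L1 (fun x => \sum_(i <- r) F i x).
Proof.
move=> mF; elim: r => [|i r IH].
  by under eq_fun do rewrite big_nil; exact: L1_0.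
by under eq_fun do rewrite big_cons; exact: L1D.
Qed.

Lemma Re_cintegral f : complex.Re (cintegral f) = \int[mu]_x complex.Re (f x).
Proof. by []. Qed.

Lemma Im_cintegral f : complex.Im (cintegral f) = \int[mu]_x complex.Im (f x).
Proof. by []. Qed.

Lemma cintegralD f g : L1 f -> L1 g ->
  cintegral (fun x => f x + g x) = cintegral f + cintegral g.
Proof.
move=> f1 g1; rewrite /cintegral.
under eq_Rintegral do rewrite ReD.
under [X in _ +i* X]eq_Rintegral do rewrite ImD.
rewrite !RintegralD //; by [exact: L1_Re|exact: L1_Im].
Qed.

Lemma cintegralZ c f : L1 f -> cintegral (fun x => c * f x) = c * cintegral f.
Proof.
move=> f1; have rf := L1_Re f1; have jf := L1_Im f1; rewrite /cintegral.
under eq_Rintegral do rewrite ReM.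
under [X in _ +i* X]eq_Rintegral do rewrite ImM.
rewrite RintegralB // ?RintegralD //; try exact: rintZ.
by rewrite !RintegralZl //; case: c.
Qed.

Lemma cintegralN f : L1 f -> cintegral (fun x => - f x) = - cintegral f.
Proof.
move=> f1; rewrite -mulN1r -cintegralZ //; congr cintegral.
by apply/funext => x; rewrite mulN1r.
Qed.

Lemma cintegralB f g : L1 f -> L1 g ->
  cintegral (fun x => f x - g x) = cintegral f - cintegral g.
Proof. by move=> f1 g1; rewrite cintegralD ?cintegralN //; exact: L1N. Qed.

Lemma cintegralJ f : L1 f -> cintegral (fun x => conjc (f x)) = conjc (cintegral f).
Proof.
move=> f1; rewrite /cintegral /=.
under eq_Rintegral do rewrite ReJ.
under [X in _ +i* X]eq_Rintegral do rewrite ImJ -mulN1r.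
by rewrite RintegralZl // ?mulN1r //; exact: L1_Im.
Qed.

Lemma cintegral_sum (I : Type) (r : seq I) (F : I -> R -> C) :
  (forall i, L1 (F i)) ->
  cintegral (fun x => \sum_(i <- r) F i x) = \sum_(i <- r) cintegral (F i).
Proof.
move=> mF; elim: r => [|i r IH].
  rewrite big_nil; under eq_fun do rewrite big_nil.
  by rewrite /cintegral /= !Rintegral_cst // !mul0r.
rewrite big_cons; under eq_fun do rewrite big_cons.
by rewrite cintegralD ?IH //; exact: L1_sum.
Qed.

Lemma rint0 : rint (fun=> 0). Proof. exact: integrable0. Qed.

Lemma rint_sum (I : Type) (r : seq I) (F : I -> R -> R) :
  (forall i, rint (F i)) -> rint (fun x => \sum_(i <- r) F i x).
Proof.
move=> mF; elim: r => [|i r IH].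
  by under eq_fun do rewrite big_nil; exact: rint0.
by under eq_fun do rewrite big_cons; exact: rintD.
Qed.

Lemma Rintegral_sum (I : Type) (r : seq I) (F : I -> R -> R) :
  (forall i, rint (F i)) ->
  \int[mu]_x (\sum_(i <- r) F i x) = \sum_(i <- r) \int[mu]_x F i x.
Proof.
move=> mF; elim: r => [|i r IH].
  rewrite big_nil; under eq_Rintegral do rewrite big_nil.
  by rewrite Rintegral_cst // mul0r.
rewrite big_cons; under eq_Rintegral do rewrite big_cons.
by rewrite RintegralD ?IH //; [exact: mF|exact: rint_sum].
Qed.

Lemma cintegral_real p : cintegral (fun x => (p x)%:C) = (\int[mu]_x p x)%:C.
Proof. by rewrite /cintegral /= Rintegral_cst // mul0r. Qed.

Lemma L2P f : L2 f <-> cmeasurable f /\ rint (fun x => cabs (f x) ^+ 2).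
Proof.
split=> [[mf fp]|[mf ip]]; split => //.
  by apply: rint_ge0 => [|x|//]; [exact: measurable_cabs2 | exact: sqr_ge0].
by apply: rint_lty => // x; exact: sqr_ge0.
Qed.

Lemma L2_measurable f : L2 f -> cmeasurable f. Proof. by case. Qed.
Lemma L2_rint f : L2 f -> rint (fun x => cabs (f x) ^+ 2).
Proof. by case/L2P. Qed.

Lemma L2_le f q : cmeasurable f -> (forall x, cabs (f x) ^+ 2 <= q x) -> rint q ->
  L2 f.
Proof.
move=> mf fq iq; apply/L2P; split => //; apply: rint_le iq.
  exact: measurable_cabs2.
by move=> x; rewrite ger0_norm ?sqr_ge0.
Qed.

Lemma L2D f g : L2 f -> L2 g -> L2 (fun x => f x + g x).
Proof.
move=> /L2P[mf fi] /L2P[mg ig].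
apply: L2_le (rintD (rintZ 2 fi) (rintZ 2 ig)); first exact: cmeasurableD.
by move=> x; exact: cabs2D_le.
Qed.

Lemma L2M_bounded (M : R) f g : cmeasurable f -> (forall x, cabs (f x) <= M) ->
  L2 g -> L2 (fun x => f x * g x).
Proof.
move=> mf fM /L2P[mg ig]; apply: L2_le (rintZ (M ^+ 2) ig).
  exact: cmeasurableM.
move=> x; rewrite ComplexField.Normc.normcM exprMn ler_wpM2r ?sqr_ge0 //.
by rewrite ler_sqr ?nnegrE ?cabs_ge0 // (le_trans (cabs_ge0 (f x))).
Qed.

Lemma L2Z c f : L2 f -> L2 (fun x => c * f x).
Proof. by apply: (@L2M_bounded (cabs c)) => //; exact: cmeasurable_cst. Qed.

Lemma L2J f : L2 f -> L2 (fun x => conjc (f x)).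
Proof.
move=> /L2P[mf fi]; apply: L2_le fi; first exact: cmeasurableJ.
by move=> x; rewrite cabsJ.
Qed.

Lemma L2_0 : L2 (fun=> 0 : C).
Proof.
apply: (@L2_le _ (cst 0)) => [|x|]; [exact: cmeasurable_cst| |].
  by rewrite ComplexField.Normc.normc0 expr0n.
exact: integrable0.
Qed.

Lemma L2_sum (I : Type) (r : seq I) (F : I -> R -> C) :
  (forall i, L2 (F i)) -> L2 (fun x => \sum_(i <- r) F i x).
Proof.
move=> mF; elim: r => [|i r IH].
  by under eq_fun do rewrite big_nil; exact: L2_0.
by under eq_fun do rewrite big_cons; exact: L2D.
Qed.

Lemma L2N f : L2 f -> L2 (fun x => - f x).
Proof. by move=> /(L2Z (-1)); congr L2; apply/funext => x; exact: mulN1r. Qed.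

Lemma L2B f g : L2 f -> L2 g -> L2 (fun x => f x - g x).
Proof. by move=> mf mg; apply: L2D => //; exact: L2N. Qed.

Lemma L2M_L1 f g : L2 f -> L2 g -> L1 (fun x => f x * g x).
Proof.
move=> /L2P[mf fi] /L2P[mg ig]; apply: L1_le (rintD fi ig).
  exact: cmeasurableM.
move=> x; rewrite ComplexField.Normc.normcM.
have := sqr_ge0 (cabs (f x) - cabs (g x)).
have := cabs_ge0 (f x); have := cabs_ge0 (g x); nra.
Qed.

Lemma L2_ae f g : cmeasurable g -> {ae mu, forall x, f x = g x} -> L2 f -> L2 g.
Proof.
move=> mg fg [mf fi]; split=> //; apply: le_lt_trans fi.
rewrite /sqnormL2; apply: ae_ge0_le_integral => //.
- by move=> x _; rewrite lee_fin sqr_ge0.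
- exact: emeasurable_cabs2.
- by move=> x _; rewrite lee_fin sqr_ge0.
- exact: emeasurable_cabs2.
- by apply: (ae_imp fg) => x -> _.
Qed.

Lemma sqnormL2_ae f g : cmeasurable f -> cmeasurable g ->
  {ae mu, forall x, f x = g x} -> sqnormL2 f = sqnormL2 g.
Proof.
move=> mf mg fg; apply: ae_eq_integral => //.
- exact: emeasurable_cabs2.
- exact: emeasurable_cabs2.
- by apply: (ae_imp fg) => x -> _.
Qed.

Definition L2pred : {pred R -> C} := fun f => `[< L2 f >].

Lemma L2predP f : reflect (L2 f) (f \in L2pred).
Proof. exact: asboolP. Qed.

Lemma L2pred_submod_closed : submod_closed L2pred.
Proof.
split; first by apply/L2predP; exact: L2_0.
by move=> c f g /L2predP f2 /L2predP g2; apply/L2predP; apply: L2D => //; exact: L2Z.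
Qed.

HB.instance Definition _ := GRing.isSubmodClosed.Build C (R -> C) L2pred
  L2pred_submod_closed.

(** A submodule of the space of all functions, without quotient by null functions: elements keep
    their values, so vector identities are pointwise identities. *)
Record L2fun := MkL2fun { L2val : R -> C; L2valP : L2val \in L2pred }.
HB.instance Definition _ := [isSub for L2val].
HB.instance Definition _ := [Choice of L2fun by <:].
HB.instance Definition _ := [SubChoice_isSubLmodule of L2fun by <:].

End ComplexIntegration.

(** * L2 as a pre-Hilbert space *)

Section L2Space.
Context {R : realType}.
Local Notation C := R[i].
Local Notation mu := (@lebesgue_measure R).
Implicit Types (f g : R -> C) (u v : @L2fun R).

Definition toL2 f (H : L2 f) : L2fun := MkL2fun (introT (L2predP f) H).

Lemma L2val_L2 u : L2 (L2val u).
Proof. by apply/L2predP; exact: L2valP. Qed.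

Lemma L2valD u v : L2val (u + v) = (fun x => L2val u x + L2val v x).
Proof. by []. Qed.

Lemma L2valZ c u : L2val (c *: u) = (fun x => c * L2val u x).
Proof. by []. Qed.

Lemma L2valN u : L2val (- u) = (fun x => - L2val u x).
Proof. by []. Qed.

Lemma L2val_sum (I : Type) (r : seq I) (F : I -> @L2fun R) :
  L2val (\sum_(i <- r) F i) = (fun x => \sum_(i <- r) L2val (F i) x).
Proof.
apply/funext => x; elim: r => [|i r IH]; first by rewrite !big_nil.
by rewrite !big_cons -IH.
Qed.

Lemma innerL2E f g : innerL2 f g = cintegral (fun x => f x * conjc (g x)).
Proof. by []. Qed.

Lemma L2M_conj f g : L2 f -> L2 g -> L1 (fun x => f x * conjc (g x)).
Proof. by move=> f2 g2; apply: L2M_L1 => //; exact: L2J. Qed.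

Lemma innerL2_sq f : innerL2 f f = (\int[mu]_x cabs (f x) ^+ 2)%:C.
Proof.
rewrite -cintegral_real innerL2E; congr cintegral; apply/funext => x.
by rewrite cabs2J.
Qed.

Fact ipL2_Dl u v w : innerL2 (L2val (u + v)) (L2val w) =
  innerL2 (L2val u) (L2val w) + innerL2 (L2val v) (L2val w).
Proof.
rewrite !innerL2E -cintegralD; try exact: L2M_conj (L2val_L2 _) (L2val_L2 _).
by congr cintegral; apply/funext => x; rewrite L2valD mulrDl.
Qed.

Fact ipL2_Zl c u v : innerL2 (L2val (c *: u)) (L2val v) =
  c * innerL2 (L2val u) (L2val v).
Proof.
rewrite !innerL2E -cintegralZ; last exact: L2M_conj (L2val_L2 _) (L2val_L2 _).
by congr cintegral; apply/funext => x; rewrite L2valZ mulrA.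
Qed.

Fact ipL2_J u v : conjc (innerL2 (L2val u) (L2val v)) = innerL2 (L2val v) (L2val u).
Proof.
rewrite !innerL2E -cintegralJ; last exact: L2M_conj (L2val_L2 _) (L2val_L2 _).
by congr cintegral; apply/funext => x; rewrite conjcM conjcK mulrC.
Qed.

Fact ipL2_ge0 u : 0 <= complex.Re (innerL2 (L2val u) (L2val u)).
Proof. by rewrite innerL2_sq /=; apply: Rintegral_ge0 => x _; exact: sqr_ge0. Qed.

Definition ipL2 : @inner_product R (@L2fun R) :=
  @InnerProduct R (@L2fun R) (fun u v => innerL2 (L2val u) (L2val v))
    ipL2_Dl ipL2_Zl ipL2_J ipL2_ge0.

Lemma nsqL2E u : (nsq ipL2 u)%:E = sqnormL2 (L2val u).
Proof.
have -> : nsq ipL2 u = \int[mu]_x cabs (L2val u x) ^+ 2.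
  by rewrite [LHS](congr1 (@complex.Re R) (innerL2_sq (L2val u))).
rewrite RintEFin //; by have /L2P[] := L2val_L2 u.
Qed.

Lemma nsqL2_ae u v : {ae mu, forall x, L2val u x = L2val v x} ->
  nsq ipL2 (u - v) = 0.
Proof.
move=> uv; apply: EFin_inj; rewrite nsqL2E.
rewrite (@sqnormL2_ae _ _ (fun=> 0)).
- rewrite /sqnormL2; under eq_integral do rewrite ComplexField.Normc.normc0 expr0n.
  exact: integral0.
- by case: (L2val_L2 (u - v)).
- exact: cmeasurable_cst.
- by apply: (ae_imp uv) => x uvx; rewrite L2valD L2valN uvx subrr.
Qed.

Lemma nsqL2_eq0 u : nsq ipL2 u = 0 -> {ae mu, forall x, L2val u x = 0}.
Proof.
move=> u0; have := nsqL2E u; rewrite u0 => /esym h.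
have mu2 : measurable_fun setT (fun x => (cabs (L2val u x) ^+ 2)%:E).
  by apply: emeasurable_cabs2; case: (L2val_L2 u).
have hh := (ae_eq_integral_abs mu measurableT mu2).1.
have : ae_eq mu setT (fun x => (cabs (L2val u x) ^+ 2)%:E) (cst 0%E).
  apply: hh; rewrite -[RHS]h; apply: eq_integral => x _.
  by rewrite gee0_abs // lee_fin sqr_ge0.
move=> ae0; apply: (ae_imp ae0) => x /(_ I) [] /eqP; rewrite sqrf_eq0 => /eqP.
exact: ComplexField.Normc.eq0_normc.
Qed.

(** Fatou's lemma for a pointwise limit. A bound from some rank [N] on suffices, because a lower
    limit ignores the first terms. *)
Lemma fatou_bound (h : nat -> R -> R) (p : R -> R) (M : R) (N : nat) :
  (forall n, measurable_fun setT (h n)) -> (forall n x, 0 <= h n x) ->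
  (forall x, h ^~ x @ \oo --> p x) ->
  (forall n, (N <= n)%N -> (\int[mu]_x (h n x)%:E <= M%:E)%E) ->
  (\int[mu]_x (p x)%:E <= M%:E)%E.
Proof.
move=> mh h0 hp hM.
have -> : (\int[mu]_x (p x)%:E = \int[mu]_x limn_einf (fun n => (h n x)%:E))%E.
  apply: eq_integral => x _; apply/esym.
  have /cvg_limn_einf_sup[-> //] : (fun n => (h n x)%:E) @ \oo --> (p x)%:E.
  by apply/fine_cvgP; split; [exact: nearW | exact: hp].
apply: le_trans (fatou _ _ _ _) _ => //.
- by move=> n; exact: measurable_EFinR.
- by move=> n x _; rewrite lee_fin.
rewrite limn_einf_lim; apply: lime_le; first exact: is_cvg_einfs.
exists N => // n /= Nn; apply: le_trans (hM n Nn).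
by apply: ereal_inf_lbound; exists n => //=.
Qed.

Lemma sum_half (n : nat) : \sum_(0 <= k < n) (2^-1 : R) ^+ k <= 2.
Proof.
suff -> : \sum_(0 <= k < n) (2^-1 : R) ^+ k = 2 - 2 * 2^-1 ^+ n.
  by rewrite lerBlDr lerDl mulr_ge0 // exprn_ge0 // invr_ge0.
elim: n => [|n IH]; first by rewrite big_nil expr0; lra.
by rewrite big_nat_recr //= IH exprS; lra.
Qed.

(** With d_k the modulus of the k-th increment, the sum of 2^k d_k^2 has integral at most 2, hence
    is finite almost everywhere. Since d_k <= 2^-k + 2^k d_k^2, the increments are then summable.
    Staying with squares avoids comparing L1 and L2 norms on the whole line. *)
Lemma fast_cauchy_ae_cvg (w : nat -> R -> C) : (forall n, L2 (w n)) ->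
  (forall n, (sqnormL2 (fun x => (w n.+1 x - w n x)%R) <= ((4^-1) ^+ n)%:E)%E) ->
  {ae mu, forall x, cvgn (fun n => complex.Re (w n x)) /\
                    cvgn (fun n => complex.Im (w n x))}.
Proof.
move=> w2 dw.
pose d k x := cabs (w k.+1 x - w k x).
have md k : measurable_fun setT (fun x => 2 ^+ k * d k x ^+ 2).
  apply: measurable_funM => //; apply: measurable_cabs2; apply: cmeasurableB.
    by case: (w2 k.+1).
  by case: (w2 k).
have d0 k x : 0 <= 2 ^+ k * d k x ^+ 2 by rewrite mulr_ge0 ?sqr_ge0 // exprn_ge0.
pose S x := (\sum_(k <oo) (2 ^+ k * d k x ^+ 2)%:E)%E.
have S0 x : (0 <= S x)%E.
  by apply: nneseries_ge0 => k _ _; rewrite lee_fin.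
have mS : measurable_fun setT S.
  by apply: ge0_emeasurable_sum => [k x _ _|k _]; [rewrite lee_fin|exact: measurable_EFinR].
have intS : (\int[mu]_x S x <= 2%:E)%E.
  rewrite /S integral_nneseries //=; last 2 first.
  - by move=> k; exact: measurable_EFinR.
  - by move=> k x _; rewrite lee_fin.
  apply: lime_le; first by apply: is_cvg_nneseries => k _ _; apply: integral_ge0 => x _; rewrite lee_fin.
  apply: nearW => n; rewrite /=.
  apply: (@le_trans _ _ (\sum_(0 <= k < n) ((2^-1 : R) ^+ k)%:E)%E).
    apply: lee_sum => k _.
    under eq_integral do rewrite EFinM.
    rewrite ge0_integralZl //=.
    - apply: (@le_trans _ _ ((2 ^+ k)%:E * ((4^-1) ^+ k)%:E)%E).
        by rewrite lee_pmul2l ?lte_fin ?exprn_gt0 //; exact: dw.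
      rewrite -EFinM lee_fin -exprMn (_ : 2 * 4^-1 = 2^-1 :> R) //; lra.
    - apply: emeasurable_cabs2; apply: cmeasurableB.
        by case: (w2 k.+1).
      by case: (w2 k).
    - by move=> x _; rewrite lee_fin sqr_ge0.
  by rewrite sumEFin lee_fin sum_half.
have iS : mu.-integrable setT S.
  apply/integrableP; split => //.
  under eq_integral do rewrite gee0_abs //.
  by apply: le_lt_trans intS _; rewrite ltry.
have := integrable_ae measurableT iS.
move=> aeS; apply: (ae_imp aeS) => x /(_ I) Sx.
have bnd n : \sum_(0 <= k < n) (2 ^+ k * d k x ^+ 2) <= fine (S x).
  rewrite -lee_fin fineK // -sumEFin.
  by apply: nneseries_lim_ge => k _ _; rewrite lee_fin.
have key (q : nat -> R) : (forall k, `|q k.+1 - q k| <= d k x) -> cvgn q.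
  move=> qd.
  have : cvgn [normed series (telescope q)].
    apply: nondecreasing_is_cvgn.
      by apply: nondecreasing_series => k _ _; exact: normr_ge0.
    exists (2 + fine (S x)) => _ [n _ <-].
    change (\sum_(0 <= k < n) `|telescope q k| <= 2 + fine (S x)).
    apply: le_trans (lerD (sum_half n) (bnd n)).
    rewrite -big_split /=; apply: ler_sum => k _.
    apply: le_trans (qd k) _.
    have h2 : 0 < (2 : R) ^+ k by rewrite exprn_gt0.
    rewrite exprVn.
    have dk : 0 <= d k x by exact: cabs_ge0.
    move: (d k x) ((2 : R) ^+ k) dk h2 => t s t0 s0.
    rewrite -subr_ge0.
    (* Completing the square proves t <= 1/s + s t^2 with s = 2^k. *)
    have -> : s^-1 + s * t ^+ 2 - t = s^-1 * ((s * t - 2^-1) ^+ 2 + 3 / 4).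
      by field; rewrite gt_eqF.
    by rewrite mulr_ge0 ?invr_ge0 ?(ltW s0) // addr_ge0 ?sqr_ge0.
  move/normed_cvg => cs.
  have -> : q = (fun n => q 0%N + series (telescope q) n).
    by apply/funext => n; exact: eq_sum_telescope.
  by apply: is_cvgD => //; exact: is_cvg_cst.
split; apply: key => k; rewrite /d.
  by have := cabs_Re (w k.+1 x - w k x); rewrite ReD ReN.
by have := cabs_Im (w k.+1 x - w k x); rewrite ImD ImN.
Qed.

End L2Space.

(** * Completeness of L2 *)

Section RieszFischer.
Context {R : realType}.
Local Notation C := R[i].
Local Notation mu := (@lebesgue_measure R).

Lemma cmeasurable_indic (A : set R) : measurable A ->
  cmeasurable (fun x => (\1_A x)%:C : C).
Proof. by move=> mA; apply: cmeasurable_real; exact: measurable_indic. Qed.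

Lemma cabs_indic_le1 (A : set R) x : cabs ((\1_A x)%:C : C) <= 1.
Proof.
rewrite indicE; case: (x \in A); rewrite ?ComplexField.Normc.normc1 //.
by rewrite ComplexField.Normc.normc0.
Qed.

Lemma L2_indic (A : set R) (f : R -> C) : measurable A -> L2 f ->
  L2 (fun x => (\1_A x)%:C * f x).
Proof.
move=> mA; apply: (@L2M_bounded _ 1); first exact: cmeasurable_indic.
by move=> x; exact: cabs_indic_le1.
Qed.

Lemma Re_realM (a : R) (z : C) : complex.Re (a%:C * z) = a * complex.Re z.
Proof. by case: z => x y /=; rewrite mul0r subr0. Qed.

Lemma Im_realM (a : R) (z : C) : complex.Im (a%:C * z) = a * complex.Im z.
Proof. by case: z => x y /=; rewrite mul0r addr0. Qed.

(** A rapidly Cauchy subsequence converges almost everywhere, which gives the candidate limit; Fatou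
    along the subsequence then shows that the whole sequence converges to it in norm. *)
Theorem L2_complete : sq_complete (@ipL2 R).
Proof.
move=> u cu.
have [N HN] : {N : nat -> nat & forall k m n, (N k <= m)%N -> (N k <= n)%N ->
    nsq ipL2 (u m - u n) < 4^-1 ^+ k}.
  apply: (choice (P := fun k N => forall m n, (N <= m)%N -> (N <= n)%N ->
    nsq ipL2 (u m - u n) < 4^-1 ^+ k)) => k.
  by apply: cu; rewrite exprn_gt0 // invr_gt0.
(* Summing the [(N i).+1] makes [s k] at least [N k] and at least [k] at the same time. *)
pose s k := (\sum_(i < k.+1) (N i).+1)%N.
have sS k : s k.+1 = (s k + (N k.+1).+1)%N by rewrite /s big_ord_recr.
have sk k : (k <= s k)%N.
  by elim: k => // k IH; rewrite sS addnS ltnS (leq_trans IH) // leq_addr.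
have sN k : (N k <= s k)%N.
  by rewrite /s big_ord_recr /=; exact: leq_trans (leqnSn _) (leq_addl _ _).
have smono k : (N k <= s k.+1)%N by rewrite (leq_trans (sN k)) // sS leq_addr.
pose w k := L2val (u (s k)).
have w2 k : L2 (w k) by exact: L2val_L2.
have dw k : (sqnormL2 (fun x => (w k.+1 x - w k x)%R) <= ((4^-1) ^+ k)%:E)%E.
  have := HN k _ _ (smono k) (sN k); rewrite -lte_fin nsqL2E => h.
  exact: ltW.
have [A [mA A0 cvgw]] := fast_cauchy_ae_cvg w2 dw.
pose G := ~` A; have mG : measurable G by exact: measurableC.
have wG x : G x -> cvgn (fun n => complex.Re (w n x)) /\
                   cvgn (fun n => complex.Im (w n x)).
  by move=> Gx; apply: contrapT => h; apply: Gx; exact: cvgw.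
have aeG : {ae mu, forall x, \1_G x = 1 :> R}.
  exists A; split => // x /= h; apply: contrapT => Ax; apply: h.
  by rewrite indicE mem_set.
(* Multiplying by the indicator of the convergence set makes the limit exist at every point, so that
   [f] is measurable as a limit. *)
pose g k x := (\1_G x)%:C * w k x.
have g2 k : L2 (g k) by exact: L2_indic.
pose f x := limn (fun n => complex.Re (g n x)) +i* limn (fun n => complex.Im (g n x)).
have gf x : (fun n => complex.Re (g n x)) @ \oo --> complex.Re (f x) /\
            (fun n => complex.Im (g n x)) @ \oo --> complex.Im (f x).
  have cg : cvgn (fun n => complex.Re (g n x)) /\
            cvgn (fun n => complex.Im (g n x)).
    under eq_fun do rewrite Re_realM.
    under [X in _ /\ cvgn X]eq_fun do rewrite Im_realM.
    have [Gx|Gx] := boolP (x \in G).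
      have [h1 h2] := wG x (set_mem Gx).
      by split; apply: is_cvgM => //; exact: is_cvg_cst.
    rewrite indicE (negbTE Gx).
    under eq_fun do rewrite mul0r; under [X in _ /\ cvgn X]eq_fun do rewrite mul0r.
    by split; exact: is_cvg_cst.
  by case: cg.
have mf : cmeasurable f.
  split.
    apply: (@measurable_fun_cvg _ _ _ _ (fun n x => complex.Re (g n x))).
      by move=> n; case: (g2 n) => -[].
    by move=> x _; case: (gf x).
  apply: (@measurable_fun_cvg _ _ _ _ (fun n x => complex.Im (g n x))).
    by move=> n; case: (g2 n) => -[].
  by move=> x _; case: (gf x).
pose v n x := (\1_G x)%:C * L2val (u n) x.
have v2 n : L2 (v n) by apply: L2_indic => //; exact: L2val_L2.
(* For fixed n, [v n - f] is the pointwise limit of [v n - g k] as k grows, and the Cauchy condition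
   bounds each of these norms by [e]. *)
have key e : 0 < e -> exists M, forall n, (M <= n)%N ->
    (sqnormL2 (fun x => (v n x - f x)%R) <= e%:E)%E.
  move=> e0; have [M HM] := cu e e0; exists M => n Mn.
  apply: (@fatou_bound _ (fun k x => cabs (v n x - g k x) ^+ 2) _ _ M).
  - move=> k; apply: measurable_cabs2; apply: cmeasurableB.
      exact: L2_measurable (v2 n).
    exact: L2_measurable (g2 k).
  - by move=> k x; exact: sqr_ge0.
  - move=> x; rewrite cabs2E ReD ImD ReN ImN.
    under eq_fun do rewrite cabs2E ReD ImD ReN ImN.
    have [h1 h2] := gf x.
    have cB (a l : R) (q : nat -> R) : q @ \oo --> l ->
        (fun k => (a - q k) ^+ 2) @ \oo --> (a - l) ^+ 2.
      move=> ql; rewrite expr2; under eq_fun do rewrite expr2.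
      by apply: cvgM; (apply: cvgB => //; exact: cvg_cst).
    by apply: cvgD; exact: cB.
  - move=> k Mk; have := HM n (s k) Mn (leq_trans Mk (sk k)).
    rewrite -lte_fin nsqL2E => /ltW; apply: le_trans.
    apply: ge0_le_integral => //.
    + by move=> x _; rewrite lee_fin sqr_ge0.
    + apply: emeasurable_cabs2; apply: cmeasurableB.
        exact: L2_measurable (v2 n).
      exact: L2_measurable (g2 k).
    + by apply: emeasurable_cabs2; exact: L2_measurable (L2val_L2 _).
    + move=> x _; rewrite lee_fin /v /g -mulrBr ComplexField.Normc.normcM exprMn.
      rewrite ler_piMl ?sqr_ge0 // exprn_ile1 ?cabs_ge0 //; exact: cabs_indic_le1.
have f2 : L2 f.
  have [M HM] := key 1 ltr01.
  have d2 : L2 (fun x => v M x - f x).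
    split; first by apply: cmeasurableB => //; exact: L2_measurable (v2 M).
    by apply: le_lt_trans (HM M (leqnn M)) _; rewrite ltry.
  by have := L2B (v2 M) d2; congr L2; apply/funext => x; rewrite opprB addrCA subrr addr0.
exists (toL2 f2) => e e0; have e2 : 0 < e / 2 by lra.
have [M HM] := key _ e2; exists M => n /HM h.
rewrite -lte_fin nsqL2E.
rewrite (@sqnormL2_ae _ _ (fun x => v n x - f x)).
- by apply: le_lt_trans h _; rewrite lte_fin; lra.
- exact: L2_measurable (L2val_L2 _).
- by apply: cmeasurableB => //; exact: L2_measurable (v2 n).
- by apply: (ae_imp aeG) => x h1; rewrite /v h1 mul1r.
Qed.

End RieszFischer.

(** * Translations and reflections of the line *)

Section LineIsometries.
Context {R : realType}.
Local Notation C := R[i].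
Local Notation mu := (@lebesgue_measure R).

Definition affine (s a : R) (x : R) : R := s * x + a.

Lemma measurable_affine (s a : R) : measurable_fun setT (affine s a).
Proof.
by apply: measurable_funD; [exact: mulrl_measurable | exact: measurable_cst].
Qed.

Lemma preimage_affine (s a u v : R) : s = 1 \/ s = -1 ->
  mu (affine s a @^-1` `]u, v]%classic) = mu `]u, v]%classic.
Proof.
case=> ->.
  have -> : affine 1 a @^-1` `]u, v]%classic = `]u - a, v - a]%classic.
    apply/seteqP; split=> x /=; rewrite /affine !in_itv /= => /andP[h1 h2];
      apply/andP; split; lra.
  rewrite !lebesgue_measure_itv /= !lte_fin ltrD2r; case: ifP => // _.
  by rewrite -!EFinB; congr EFin; ring.
have -> : affine (-1) a @^-1` `]u, v]%classic = `[a - v, a - u[%classic.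
  apply/seteqP; split=> x /=; rewrite /affine !in_itv /= => /andP[h1 h2];
    apply/andP; split; lra.
rewrite !lebesgue_measure_itv /= !lte_fin ltrD2l ltrN2; case: ifP => // _.
by rewrite -!EFinB; congr EFin; ring.
Qed.

(** The pushforward of Lebesgue measure agrees with it on half-open intervals, which determine the
    measure. *)
Lemma lebesgue_affine (s a : R) (A : set (measurableTypeR R)) :
  s = 1 \/ s = -1 -> measurable A -> mu (affine s a @^-1` A) = mu A.
Proof.
move=> s1 mA.
have mphi : measurable_fun [set: measurableTypeR R]
  (affine s a : measurableTypeR R -> measurableTypeR R) := measurable_affine s a.
have := @lebesgue_measure_unique R
  (measure_function_pushforward__canonical__measure_function_Measure mu mphi).
move=> h; rewrite [RHS](h _ A mA) // => X /ocitvP[->|[[u v] /= uv ->]].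
  by rewrite !measure0.
by rewrite /= /pushforward preimage_affine.
Qed.

Lemma integral_affine (s a : R) (f : R -> \bar R) : s = 1 \/ s = -1 ->
  measurable_fun setT f ->
  (\int[mu]_x f (affine s a x) = \int[mu]_x f x)%E.
Proof.
move=> s1 mf.
have mphi : measurable_fun [set: measurableTypeR R]
  (affine s a : measurableTypeR R -> measurableTypeR R) := measurable_affine s a.
have key (g : R -> \bar R) : measurable_fun setT g -> (forall x, (0 <= g x)%E) ->
    (\int[mu]_x g (affine s a x) = \int[mu]_x g x)%E.
  move=> mg g0.
  have := @ge0_integral_pushforward _ _ _ _ R _ mphi mu setT g measurableT mg.
  move=> /(_ (fun y _ => g0 y)); rewrite preimage_setT => <-.
  apply: eq_measure_integral => /= A mA _.
  by rewrite /pushforward lebesgue_affine.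
rewrite integralE [RHS]integralE; congr (_ - _)%E.
  rewrite -(key _ (measurable_funepos mf)) => [|x]; last exact: funepos_ge0.
  by apply: eq_integral => x _; rewrite (_ : (fun _ => _) = f \o affine s a) // funepos_comp.
rewrite -(key _ (measurable_funeneg mf)) => [|x]; last exact: funeneg_ge0.
by apply: eq_integral => x _; rewrite (_ : (fun _ => _) = f \o affine s a) // funeneg_comp.
Qed.

Lemma ae_affine (s a : R) (P : R -> Prop) : s = 1 \/ s = -1 ->
  {ae mu, forall x, P x} -> {ae mu, forall x, P (affine s a x)}.
Proof.
move=> s1 [A [mA A0 PA]]; exists (affine s a @^-1` A); split.
- by rewrite -[X in measurable X]setTI; exact: measurable_affine.
- by rewrite lebesgue_affine.
- by move=> x /= h; apply: PA.
Qed.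

Lemma Rintegral_affine (s a : R) (p : R -> R) : s = 1 \/ s = -1 ->
  measurable_fun setT p ->
  \int[mu]_x p (affine s a x) = \int[mu]_x p x.
Proof.
by move=> s1 mp; rewrite /Rintegral -(@integral_affine s a (EFin \o p)) //;
  exact: measurable_EFinR.
Qed.

Lemma rint_affine (s a : R) (p : R -> R) : s = 1 \/ s = -1 ->
  rint p -> rint (fun x => p (affine s a x)).
Proof.
move=> s1 /rintP[mp ip]; apply/rintP; split.
  exact: measurableT_comp mp (measurable_affine s a).
rewrite (@integral_affine s a (fun x => `|p x|%:E)) //.
by apply: measurable_EFinR; exact: measurableT_comp.
Qed.

Lemma cmeasurable_affine (s a : R) (f : R -> C) : cmeasurable f ->
  cmeasurable (fun x => f (affine s a x)).
Proof. by move=> mf; apply: cmeasurable_comp mf; exact: measurable_affine. Qed.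

Lemma cintegral_affine (s a : R) (f : R -> C) : s = 1 \/ s = -1 ->
  cmeasurable f -> cintegral (fun x => f (affine s a x)) = cintegral f.
Proof.
move=> s1 [rf jf]; congr (_ +i* _).
  exact: (Rintegral_affine a s1 rf).
exact: (Rintegral_affine a s1 jf).
Qed.

Lemma L1_affine (s a : R) (f : R -> C) : s = 1 \/ s = -1 ->
  L1 f -> L1 (fun x => f (affine s a x)).
Proof.
move=> s1 /L1P[mf fi]; apply/L1P; split; first exact: cmeasurable_affine.
exact: rint_affine fi.
Qed.

Lemma sqnormL2_affine (s a : R) (f : R -> C) : s = 1 \/ s = -1 ->
  cmeasurable f -> sqnormL2 (fun x => f (affine s a x)) = sqnormL2 f.
Proof.
move=> s1 mf.
by apply: (@integral_affine s a (fun x => (cabs (f x) ^+ 2)%:E)) => //;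
  exact: emeasurable_cabs2.
Qed.

Lemma L2_affine (s a : R) (f : R -> C) : s = 1 \/ s = -1 ->
  L2 f -> L2 (fun x => f (affine s a x)).
Proof.
move=> s1 [mf fi]; split; first exact: cmeasurable_affine.
by rewrite sqnormL2_affine.
Qed.

Lemma translate_affine {T : Type} (a : R) (f : R -> T) :
  translate a f = fun x => f (affine 1 a x).
Proof. by apply/funext => x; rewrite /translate /affine mul1r. Qed.

Lemma ae_translate (a : R) (P : R -> Prop) :
  {ae mu, forall x, P x} -> {ae mu, forall x, P (x + a)}.
Proof.
move=> /(ae_affine a (or_introl erefl)) h; apply: (ae_imp h) => x.
by rewrite /affine mul1r.
Qed.

Lemma L1_translate (a : R) (f : R -> C) : L1 f -> L1 (translate a f).
Proof. by move=> f1; rewrite translate_affine; apply: L1_affine => //; left. Qed.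

Lemma L2_translate (a : R) (f : R -> C) : L2 f -> L2 (translate a f).
Proof. by move=> f1; rewrite translate_affine; apply: L2_affine => //; left. Qed.

Lemma sqnormL2_translate (a : R) (f : R -> C) : cmeasurable f ->
  sqnormL2 (translate a f) = sqnormL2 f.
Proof. by move=> mf; rewrite translate_affine sqnormL2_affine //; left. Qed.

Lemma cintegral_translate (a : R) (f : R -> C) : cmeasurable f ->
  cintegral (translate a f) = cintegral f.
Proof. by move=> mf; rewrite translate_affine cintegral_affine //; left. Qed.

End LineIsometries.

(** * The integral of sinc^2 *)

Section HalfLineIntegrals.
Context {R : realType}.
Local Notation mu := (@lebesgue_measure R).
Implicit Types (f g F : R -> R).

Lemma is_derive_ext f g (x d d' : R) : is_derive x 1 f d ->
  (forall y, f y = g y) -> d = d' -> is_derive x 1 g d'.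
Proof. by move=> fd fg <-; rewrite -(_ : f = g) //; exact/funext. Qed.

Lemma dlin (c x : R) : is_derive x 1 (fun t => c * t) c.
Proof.
apply: (is_derive_ext (is_deriveZ c (is_derive_id x 1))) => //.
by rewrite /GRing.scale /= mulr1.
Qed.

Lemma dopp f (x df : R) : is_derive x 1 f df -> is_derive x 1 (fun t => - f t) (- df).
Proof. exact: is_deriveN. Qed.

Lemma dexpR f (x df : R) : is_derive x 1 f df ->
  is_derive x 1 (fun t => expR (f t)) (df * expR (f x)).
Proof.
move=> fd; apply: (is_derive_ext (is_derive1_comp (is_derive_expR (f x)) fd)) => //.
exact: mulrC.
Qed.

Lemma dsin f (x df : R) : is_derive x 1 f df ->
  is_derive x 1 (fun t => sin (f t)) (df * cos (f x)).
Proof.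
move=> fd; apply: (is_derive_ext (is_derive1_comp (is_derive_sin (f x)) fd)) => //.
exact: mulrC.
Qed.

Lemma dcos f (x df : R) : is_derive x 1 f df ->
  is_derive x 1 (fun t => cos (f t)) (df * - sin (f x)).
Proof.
move=> fd; apply: (is_derive_ext (is_derive1_comp (is_derive_cos (f x)) fd)) => //.
exact: mulrC.
Qed.

Lemma is_derive_continuous F f : (forall x : R, is_derive x 1 F (f x)) -> continuous F.
Proof.
move=> dF x; have dx : derivable F x 1 by case: (dF x).
exact/differentiable_continuous/derivable1_diffP.
Qed.

Lemma ge0_FTC_half_line f F (l : R) :
  (forall x, 0 <= x -> 0 <= f x) -> continuous f ->
  (forall x : R, is_derive x 1 F (f x)) -> F x @[x --> +oo] --> l ->
  (\int[mu]_(x in `]0%R, +oo[) (f x)%:E = (l - F 0)%:E)%E.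
Proof.
move=> f0 cf dF Fl.
have cF := is_derive_continuous dF.
rewrite integral_itv_obnd_cbnd; last first.
  apply/measurable_EFinP; apply: measurable_funTS; exact: continuous_measurable_fun.
rewrite (@ge0_continuous_FTC2y _ f F 0 l) ?EFinB //.
- exact: continuous_subspaceT.
- by apply: cvg_at_right_filter; exact: cF.
- by move=> x _; rewrite derive1E derive_val.
Qed.

Lemma FTC_segment f F (a b : R) : a <= b -> continuous f ->
  (forall x : R, is_derive x 1 F (f x)) ->
  \int[mu]_(x in `[a, b]) f x = F b - F a.
Proof.
rewrite le_eqVlt => /predU1P[<- _ _|ab cf dF].
  by rewrite set_itv1 Rintegral_set1 subrr.
have cF := is_derive_continuous dF.
rewrite /Rintegral (@continuous_FTC2 _ f F) //.
- exact: continuous_subspaceT.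
- split => //.
  + by apply: cvg_at_right_filter; exact: cF.
  + by apply: cvg_at_left_filter; exact: cF.
- by move=> x _; rewrite derive1E derive_val.
Qed.

Lemma exp_decay g (y K : R) : 0 < y -> (forall t, 0 <= t -> `|g t| <= K) ->
  (expR (- (y * t)) * g t) @[t --> +oo] --> (0 : R).
Proof.
move=> y0 gK.
have e0 : (expR (- (y * t)) * K) @[t --> +oo] --> (0 : R).
  rewrite -[X in _ --> X](mul0r K); apply: cvgMl.
  have h : (y * t) @[t --> +oo] --> +oo.
    by apply: gt0_cvgMry => //; exact: cvg_id.
  exact: (cvg_comp _ _ h (@cvgr_expR R)).
apply: (@squeeze_cvgr _ _ _ _ (fun t => - (expR (- (y * t)) * K)) (fun t => expR (- (y * t)) * K)) => //.
  exists 0; split => // t t0; rewrite -ler_norml normrM ger0_norm ?expR_ge0 //.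
  by rewrite ler_wpM2l ?expR_ge0 // gK // ltW.
by rewrite -[X in _ --> X]oppr0; apply: cvgN.
Qed.

Lemma continuous_expRl (c : R) : continuous (fun t : R => expR (- (c * t))).
Proof.
by apply: (@is_derive_continuous _ _) => x; apply: dexpR; apply: dopp; exact: dlin.
Qed.

Lemma continuous_cosl (c : R) : continuous (fun t : R => cos (c * t)).
Proof. by apply: (@is_derive_continuous _ _) => x; apply: dcos; exact: dlin. Qed.

Lemma continuous_sinl (c : R) : continuous (fun t : R => sin (c * t)).
Proof. by apply: (@is_derive_continuous _ _) => x; apply: dsin; exact: dlin. Qed.

(** Writes 1/t^2 as a Laplace transform, so that the denominator of [sinc2] becomes an exponential
    which can be integrated against the cosine. *)
Lemma integral_y_exp (t : R) : 0 < t ->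
  (\int[mu]_(y in `]0%R, +oo[) (y * expR (- (t * y)))%:E = (t^-1 ^+ 2)%:E)%E.
Proof.
move=> t0; have tn0 : t != 0 by rewrite gt_eqF.
pose F y := - ((t^-1 * y + t^-1 ^+ 2) * expR (- (t * y))).
have dF (y : R) : is_derive y 1 F (y * expR (- (t * y))).
  rewrite /F ?/G; apply: (is_derive_ext _ (fun=> erefl)).
  by rewrite /GRing.scale /=; field.
have Fl : F y @[y --> +oo] --> (0 : R).
  (* Half of the exponent supplies the decay; the other half absorbs the linear factor, as t y + 1
     <= 3 (1 + t y / 2) <= 3 e^{t y / 2}. *)
  have t2 : 0 < t / 2 by rewrite divr_gt0.
  have -> : F = fun y => expR (- (t / 2 * y)) *
      - ((t^-1 * y + t^-1 ^+ 2) * expR (- (t / 2 * y))).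
    apply/funext => y.
    by rewrite /F mulrN mulrCA -expRD; congr (- (_ * expR _)); field.
  apply: (@exp_decay _ (t / 2) (3 * t^-1 ^+ 2)) => // y y0.
    rewrite normrN normrM ger0_norm ?addr_ge0 ?mulr_ge0 ?invr_ge0 ?sqr_ge0 ?(ltW t0) //.
    rewrite ger0_norm ?expR_ge0 // expRN ler_pdivrMr ?expR_gt0 //.
    have := expR_ge1Dx (t / 2 * y).
    set E := expR _ => hE.
    have -> : t^-1 * y + t^-1 ^+ 2 = (t^-1 ^+ 2) * (t * y + 1) by field.
    rewrite [3 * _]mulrC -[leRHS]mulrA ler_wpM2l ?sqr_ge0 //.
    have : 0 <= t * y by rewrite mulr_ge0 // ltW.
    lra.
rewrite (ge0_FTC_half_line _ _ dF Fl).
- by congr EFin; rewrite /F !mulr0 oppr0 expR0 sub0r opprK add0r mulr1.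
- by move=> y y0; rewrite mulr_ge0 // expR_ge0.
- by move=> y; apply: cvgM; [exact: cvg_id|exact: continuous_expRl].
Qed.

Lemma integral_exp_cos (y a : R) : 0 < y ->
  (\int[mu]_(t in `]0%R, +oo[) (y * (expR (- (y * t)) * (1 - cos (a * t))))%:E =
   (a ^+ 2 / (y ^+ 2 + a ^+ 2))%:E)%E.
Proof.
move=> y0; have q0 : 0 < y ^+ 2 + a ^+ 2 by rewrite ltr_wpDr ?sqr_ge0 // exprn_gt0.
have qn : y ^+ 2 + a ^+ 2 != 0 by rewrite gt_eqF.
(* The -1 comes from the primitive -e^{-yt} of y e^{-yt}, the remaining terms from the primitive of
   -y e^{-yt} cos(at). *)
pose G t := -1 + y / (y ^+ 2 + a ^+ 2) * (y * cos (a * t) + - a * sin (a * t)).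
pose F t := expR (- (y * t)) * G t.
have dF (t : R) : is_derive t 1 F (y * (expR (- (y * t)) * (1 - cos (a * t)))).
  rewrite /F ?/G; apply: (is_derive_ext _ (fun=> erefl)).
  by rewrite /GRing.scale /=; field.
have Fl : F t @[t --> +oo] --> (0 : R).
  apply: (@exp_decay _ _ (1 + y / (y ^+ 2 + a ^+ 2) * (y + `|a|))) => // t t0.
  rewrite /G; apply: le_trans (ler_normD _ _) _; rewrite normrN normr1 lerD2l.
  have c0 : 0 <= y / (y ^+ 2 + a ^+ 2) by rewrite divr_ge0 // ltW.
  rewrite normrM ger0_norm // ler_wpM2l //.
  apply: le_trans (ler_normD _ _) _; rewrite !normrM normrN (ger0_norm (ltW y0)).
  apply: lerD; first by rewrite ler_piMr ?(ltW y0) // ler_norml cos_geN1 cos_le1.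
  by rewrite ler_piMr // ler_norml sin_geN1 sin_le1.
rewrite (ge0_FTC_half_line _ _ dF Fl).
- congr EFin; rewrite /F /G !mulr0 oppr0 expR0 cos0 sin0; field.
  by [].
- by move=> t t0; rewrite mulr_ge0 ?(ltW y0) // mulr_ge0 ?expR_ge0 // subr_ge0 cos_le1.
- move=> t; apply: cvgM; first exact: cvg_cst.
  apply: cvgM; first exact: continuous_expRl.
  by apply: cvgB; [exact: cvg_cst|exact: continuous_cosl].
Qed.

Lemma integral_rational (a : R) : 0 < a ->
  (\int[mu]_(y in `]0%R, +oo[) (a ^+ 2 / (y ^+ 2 + a ^+ 2))%:E =
   (a * (pi / 2))%:E)%E.
Proof.
move=> a0; have an : a != 0 by rewrite gt_eqF.
have q0 (y : R) : 0 < y ^+ 2 + a ^+ 2 by rewrite ltr_wpDl ?sqr_ge0 // exprn_gt0.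
have qn (y : R) : y ^+ 2 + a ^+ 2 != 0 by rewrite gt_eqF.
pose F y := a * atan (a^-1 * y).
have dF (y : R) : is_derive y 1 F (a ^+ 2 / (y ^+ 2 + a ^+ 2)).
  rewrite /F ?/G; apply: (is_derive_ext _ (fun=> erefl)).
  rewrite /GRing.scale /=.
  have -> : 1 + (a^-1 * y) ^+ 2 = (y ^+ 2 + a ^+ 2) / a ^+ 2 by field.
  by field; rewrite an qn.
have Fl : F y @[y --> +oo] --> a * (pi / 2).
  apply: cvgMr.
  have h : (a^-1 * y) @[y --> +oo] --> +oo.
    by apply: gt0_cvgMry; [rewrite invr_gt0|exact: cvg_id].
  exact: (cvg_comp _ _ h (@cvgy_atan R)).
rewrite (ge0_FTC_half_line _ _ dF Fl).
- by rewrite /F mulr0 atan0 mulr0 subr0.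
- by move=> y _; rewrite divr_ge0 ?sqr_ge0 // ltW.
- move=> y; apply: cvgM; first exact: cvg_cst.
  apply: cvgV => //; apply: cvgD; last exact: cvg_cst.
  exact: exprn_continuous.
Qed.

End HalfLineIntegrals.

(** * Evaluation by Tonelli's theorem *)

Section SincSquare.
Context {R : realType}.
Local Notation mu := (@lebesgue_measure R).
Local Notation TR := (measurableTypeR R).

Lemma integral_indicM (D : set R) (p : R -> R) :
  (\int[mu]_x (\1_D x * p x)%:E = \int[mu]_(x in D) (p x)%:E)%E.
Proof.
rewrite [RHS]integral_mkcond; apply: eq_integral => x _.
by rewrite patchE indicE; case: (x \in D); rewrite ?mul1r ?mul0r.
Qed.

Lemma Rintegral_indicM (D : set R) (p : R -> R) :
  \int[mu]_x (\1_D x * p x) = \int[mu]_(x in D) p x.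
Proof. by rewrite /Rintegral integral_indicM. Qed.

Lemma measurable_fst_comp (p : R -> R) : measurable_fun setT p ->
  measurable_fun [set: TR * TR] (fun z => p z.1).
Proof. by move=> mp; apply: (measurableT_comp (f := p)). Qed.

Lemma measurable_snd_comp (p : R -> R) : measurable_fun setT p ->
  measurable_fun [set: TR * TR] (fun z => p z.2).
Proof. by move=> mp; apply: (measurableT_comp (f := p)). Qed.

Lemma measurable_prod_comp (p : R -> R) : measurable_fun setT p ->
  measurable_fun [set: TR * TR] (fun z => p (z.1 * z.2)).
Proof.
move=> mp; apply: (measurableT_comp (f := p)) => //.
by apply: measurable_funM; [exact: (measurable_fst_comp (p := id))|
  exact: (measurable_snd_comp (p := id))].
Qed.

Lemma measurable_cosl (a : R) : measurable_fun setT (fun t : R => cos (a * t)).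
Proof. by apply: continuous_measurable_fun; exact: continuous_cosl. Qed.

Lemma measurable_sinl (a : R) : measurable_fun setT (fun t : R => sin (a * t)).
Proof. by apply: continuous_measurable_fun; exact: continuous_sinl. Qed.

Lemma measurable_invr : measurable_fun setT (@GRing.inv R).
Proof.
rewrite -(setUv [set 0 : R]); apply/measurable_funU => //.
  exact: measurableC.
split; first exact: measurable_fun_set1.
apply: open_continuous_measurable_fun.
  by rewrite openC; exact: closed_eq.
by move=> x; rewrite inE /= => /eqP x0; exact: inv_continuous.
Qed.

(** As 1 - cos(at) = 2 sin^2(at/2), this is a rescaled square of sinc. At t = 0 the convention
    [0^-1 = 0] gives the value 0, which changes a null set only. *)
Definition sinc2 (a t : R) : R := (1 - cos (a * t)) * t^-1 ^+ 2.

Lemma measurable_sinc2 a : measurable_fun setT (sinc2 a).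
Proof.
apply: measurable_funM.
  by apply: measurable_funB; [exact: measurable_cst|exact: measurable_cosl].
apply: measurable_funX; exact: measurable_invr.
Qed.

Lemma sinc2_ge0 a t : 0 <= sinc2 a t.
Proof. by rewrite mulr_ge0 ?sqr_ge0 // subr_ge0 cos_le1. Qed.

(** Tonelli for the nonnegative function y e^{-ty} (1 - cos(at)) on the quadrant: integrating first
    in y gives [sinc2], first in t a rational function whose primitive is an arctangent. *)
Lemma integral_sinc2_half (a : R) : 0 < a ->
  (\int[mu]_(t in `]0%R, +oo[) (sinc2 a t)%:E = (a * (pi / 2))%:E)%E.
Proof.
move=> a0; pose D := `]0%R, +oo[%classic : set R.
have mD : measurable D by exact: measurable_itv.
have D0 x : D x = (0 < x) by rewrite /D /= in_itv /= andbT.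
pose H (z : TR * TR) := \1_D z.1 * (\1_D z.2 * (z.2 * (expR (- (z.1 * z.2)) *
   (1 - cos (a * z.1))))).
have H0 z : 0 <= H z.
  rewrite /H mulr_ge0 //.
  rewrite indicE.
  have [zD|] := boolP (z.2 \in D); rewrite ?mul0r // mul1r.
  have : D z.2 by exact: set_mem.
  rewrite D0 => z0; apply: mulr_ge0; first exact: ltW.
  by rewrite mulr_ge0 ?expR_ge0 // subr_ge0 cos_le1.
have mH : measurable_fun setT (EFin \o H).
  apply/measurable_EFinP; apply: measurable_funM.
    by apply: measurable_fst_comp; exact: measurable_indic mD.
  apply: measurable_funM.
    by apply: measurable_snd_comp; exact: measurable_indic mD.
  apply: measurable_funM; first exact: (measurable_snd_comp (p := id)).
  apply: measurable_funM.
    apply: (measurable_prod_comp (p := fun u => expR (- u))).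
    by apply: measurableT_comp => //; exact: measurable_expR.
  apply: (measurable_fst_comp (p := fun u => 1 - cos (a * u))).
  by apply: measurable_funB; [exact: measurable_cst|exact: measurable_cosl].
have inner1 t : (\int[mu]_y (H (t, y))%:E = (\1_D t * sinc2 a t)%:E)%E.
  rewrite /H /= [\1_D t]indicE; have [tD|tD] := boolP (t \in D); last first.
    rewrite mul0r -[RHS](integral0 mu setT); apply: eq_integral => y _.
    by rewrite mul0r.
  have t0 : 0 < t by have : D t := set_mem tD; rewrite D0.
  rewrite mul1r.
  transitivity (\int[mu]_y (\1_D y * (y * (expR (- (t * y)) * (1 - cos (a * t)))))%:E)%E.
    by apply: eq_integral => y _; rewrite mul1r.
  rewrite integral_indicM.
  transitivity (\int[mu]_(y in D) ((1 - cos (a * t))%:E * (y * expR (- (t * y)))%:E))%E.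
    by apply: eq_integral => y _; rewrite -EFinM; congr EFin; ring.
  rewrite ge0_integralZl //.
  - by rewrite (integral_y_exp t0).
  - apply: measurable_funTS; apply: measurable_EFinR; apply: measurable_funM => //.
    by apply: continuous_measurable_fun; exact: continuous_expRl.
  - by move=> y Dy; rewrite lee_fin mulr_ge0 ?expR_ge0 //; move: Dy; rewrite D0 => /ltW.

have inner2 y : (\int[mu]_t (H (t, y))%:E =
    (\1_D y * (a ^+ 2 / (y ^+ 2 + a ^+ 2)))%:E)%E.
  have -> : (fun t => (H (t, y))%:E) = (fun t => (\1_D t * (\1_D y *
      (y * (expR (- (y * t)) * (1 - cos (a * t))))))%:E).
    by apply/funext => t; rewrite /H /= [t * y]mulrC.
  rewrite integral_indicM [\1_D y]indicE; have [yD|yD] := boolP (y \in D); last first.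
    rewrite mul0r -[RHS](integral0 mu D); apply: eq_integral => t _.
    by rewrite mul0r.
  have y0 : 0 < y by have : D y := set_mem yD; rewrite D0.
  rewrite mul1r -integral_exp_cos //.
  by apply: eq_integral => t _; rewrite mul1r.
have := @fubini_tonelli _ _ TR TR R mu mu (EFin \o H) mH (fun z => H0 z).
move=> FT.
have L : (\int[mu]_t \int[mu]_y (H (t, y))%:E = \int[mu]_t (\1_D t * sinc2 a t)%:E)%E.
  by apply: eq_integral => t _; exact: inner1.
have M : (\int[mu]_y \int[mu]_t (H (t, y))%:E =
    \int[mu]_y (\1_D y * (a ^+ 2 / (y ^+ 2 + a ^+ 2)))%:E)%E.
  by apply: eq_integral => y _; exact: inner2.
rewrite -integral_indicM -L; apply: (etrans FT); apply: (etrans M).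
by rewrite integral_indicM integral_rational.
Qed.

Lemma sinc2N a t : sinc2 a (- t) = sinc2 a t.
Proof. by rewrite /sinc2 mulrN cosN invrN sqrrN. Qed.

Lemma sinc2_norm a t : sinc2 `|a| t = sinc2 a t.
Proof.
rewrite /sinc2; case: (ger0P a) => // _.
by rewrite mulNr cosN.
Qed.

Lemma integral_sinc2 (a : R) : (\int[mu]_t (sinc2 a t)%:E = (pi * `|a|)%:E)%E.
Proof.
transitivity (\int[mu]_t (sinc2 `|a| t)%:E)%E.
  by apply: eq_integral => t _; rewrite sinc2_norm.
have [->|an] := eqVneq a 0.
  rewrite normr0 mulr0 -[RHS](integral0 mu setT); apply: eq_integral => t _.
  by rewrite /sinc2 mul0r cos0 subrr mul0r.
have a0 : 0 < `|a| by rewrite normr_gt0.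
pose D := `]0%R, +oo[%classic : set R.
have mD : measurable D by exact: measurable_itv.
have D0 x : (x \in D) = (0 < x) by apply/idP/idP; rewrite inE /D /= in_itv /= andbT.
have mP : measurable_fun setT (fun t => (\1_D t * sinc2 `|a| t)%:E).
  apply: measurable_EFinR; apply: measurable_funM; last exact: measurable_sinc2.
  exact: measurable_indic mD.
(* The function is even: split it into its restriction to t > 0 and the reflection of that
   restriction. Both miss t = 0, where [sinc2] is 0. *)
have -> : (fun t => (sinc2 `|a| t)%:E) = (fun t =>
   ((\1_D t * sinc2 `|a| t)%:E + (\1_D (affine (-1) 0 t) * sinc2 `|a| (affine (-1) 0 t))%:E)%E).
  apply/funext => t; rewrite -EFinD; congr EFin.
  have -> : affine (-1) 0 t = - t by rewrite /affine mulN1r addr0.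
  rewrite sinc2N !indicE !D0 oppr_gt0; case: (ltrgtP t 0) => [||->] /=.
  - by rewrite mul0r mul1r add0r.
  - by rewrite mul0r mul1r addr0.
  - by rewrite /sinc2 mulr0 cos0 subrr mul0r mulr0 addr0.
have P0 t : (0 <= (\1_D t * sinc2 `|a| t)%:E)%E.
  by rewrite lee_fin mulr_ge0 ?sinc2_ge0 // indicE ler0n.
rewrite ge0_integralD //; last exact: (measurableT_comp mP (measurable_affine _ _)).
rewrite (@integral_affine _ (-1) 0 (fun t => (\1_D t * sinc2 `|a| t)%:E)) //; last by right.
rewrite integral_indicM integral_sinc2_half // -EFinD; congr EFin; lra.
Qed.

End SincSquare.

(** * Step functions *)

Section Steps.
Context {R : realType}.
Local Notation C := R[i].
Local Notation mu := (@lebesgue_measure R).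

(* Signed indicator of the oriented interval from [0] to [a]. *)
Definition step (a x : R) : R := \1_`[0, a[ x - \1_`[a, 0[ x.

Lemma indic_itvco (a b x : R) : \1_`[a, b[ x = (a <= x < b)%R%:R :> R.
Proof. by rewrite indicE mem_setE in_itv. Qed.

Lemma stepE (a x : R) : step a x = (0 <= x < a)%R%:R - (a <= x < 0)%R%:R.
Proof. by rewrite /step !indic_itvco. Qed.

(** The sign convention makes this hold whatever the signs of [a] and [b], so that differences of
    steps produce the indicators of all half-open intervals. *)
Lemma step_sub (a b x : R) : a <= b -> step b x - step a x = \1_`[a, b[ x.
Proof.
move=> ab; rewrite !stepE indic_itvco.
case: (lerP 0 x) => x0; case: (lerP a x) => ax; case: (ltrP x b) => xb //=;
  case: (ltrP x a) => xa; case: (lerP b x) => bx //=; try lra.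
Qed.

Lemma step0 x : step 0 x = 0.
Proof. by rewrite stepE; case: lerP => //=; rewrite subrr. Qed.

Lemma measurable_step a : measurable_fun setT (step a).
Proof. by apply: measurable_funB; exact: measurable_indic. Qed.

Lemma step_sub_sq (a b x : R) :
  (step a x - step b x) ^+ 2 = \1_`[Num.min a b, Num.max a b[ x.
Proof.
case: (lerP a b) => ab.
  by rewrite -sqrrN opprB step_sub // indicE; case: (_ \in _); rewrite ?expr1n ?expr0n.
by rewrite step_sub ?ltW // indicE; case: (_ \in _); rewrite ?expr1n ?expr0n.
Qed.

(** These squared distances, together with [step 0 = 0], determine the Gram matrix of the steps by
    polarisation. *)
Lemma sqnormL2_step_sub (a b : R) :
  sqnormL2 (fun x => (step a x)%:C - (step b x)%:C : C) = (`|a - b|)%:E.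
Proof.
rewrite /sqnormL2.
transitivity (\int[mu]_x (\1_`[Num.min a b, Num.max a b[ x)%:E)%E.
  apply: eq_integral => x _; rewrite -step_sub_sq -rmorphB cabs2E /=.
  by rewrite [0 ^+ 2]expr0n addr0.
rewrite integral_indic // setIT [LHS]lebesgue_measure_itv /= lte_fin.
case: (ltrgtP a b) => [ab|ab|->] /=.
- by rewrite ab.
- by rewrite ab.
- by rewrite ltxx.
Qed.

Lemma L2_step a : L2 (fun x => (step a x)%:C : C).
Proof.
split; first by apply: cmeasurable_real; exact: measurable_step.
have := sqnormL2_step_sub a 0; rewrite subr0 => h.
rewrite -(_ : (fun x => (step a x)%:C - (step 0 x)%:C) = (fun x => (step a x)%:C)).
  by rewrite h ltry.
by apply/funext => x; rewrite step0 subr0.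
Qed.

Lemma Rintegral_itvco (a b : R) (p : R -> R) : measurable_fun setT p ->
  \int[mu]_(x in `[a, b[) p x = \int[mu]_(x in `[a, b]) p x.
Proof.
move=> mp; rewrite /Rintegral integral_itv_bndo_bndc //.
exact/measurable_EFinP/measurable_funTS.
Qed.

Lemma rint_indicM (D : set R) (p : R -> R) : measurable D ->
  mu.-integrable D (EFin \o p) <-> rint (fun x => \1_D x * p x).
Proof.
move=> mD; rewrite /rint integrable_mkcond //.
suff -> : (EFin \o p) \_ D = EFin \o (fun x => \1_D x * p x) by [].
apply/funext => x /=; rewrite patchE indicE.
by case: (x \in D); rewrite ?mul1r ?mul0r.
Qed.

Lemma rint_itvco (a b : R) (p : R -> R) : continuous p ->
  rint (fun x => \1_`[a, b[ x * p x).
Proof.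
move=> cp; apply: (rint_indicM p (measurable_itv _)).1.
have h : mu.-integrable `[a, b] (EFin \o p).
  apply: continuous_compact_integrable; first exact: segment_compact.
  exact: continuous_subspaceT.
apply: (integrableS _ _ _ h) => //; exact: subset_itv_co_cc.
Qed.

Lemma rint_step (a : R) (p : R -> R) : continuous p ->
  rint (fun x => step a x * p x).
Proof.
move=> cp; rewrite (_ : (fun _ => _) = (fun x => \1_`[0, a[ x * p x - \1_`[a, 0[ x * p x)).
  by apply: rintB; exact: rint_itvco.
by apply/funext => x; rewrite -mulrBl.
Qed.

(** For negative [a] the sign in [step] is the usual orientation of the integral from 0 to [a], so
    one formula covers both cases. *)
Lemma Rintegral_step (a : R) (p P : R -> R) : continuous p ->
  (forall x : R, is_derive x 1 P (p x)) ->
  \int[mu]_x (step a x * p x) = P a - P 0.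
Proof.
move=> cp dP; have mp : measurable_fun setT p by exact: continuous_measurable_fun.
case: (lerP 0 a) => a0.
  rewrite -(FTC_segment a0 cp dP) -Rintegral_itvco // -[RHS]Rintegral_indicM.
  apply: eq_Rintegral => x _.
  by rewrite -(step_sub x a0) step0 subr0.
rewrite -[RHS]opprB -(FTC_segment (ltW a0) cp dP) -Rintegral_itvco //.
rewrite -[RHS]mulN1r -[X in _ = _ * X]Rintegral_indicM -[RHS]RintegralZl //; last first.
  exact: rint_itvco.
apply: eq_Rintegral => x _.
by rewrite -(step_sub x (ltW a0)) step0; ring.
Qed.

Lemma locally_rint_step (a b : R) (p : R -> R) :
  (forall a, rint (fun x => step a x * p x)) ->
  rint (fun x => \1_`[a, b[ x * p x).
Proof.
move=> hp; case: (lerP a b) => ab.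
  rewrite (_ : (fun _ => _) = (fun x => step b x * p x - step a x * p x)).
    exact: rintB.
  by apply/funext => x; rewrite -mulrBl step_sub.
rewrite (_ : (fun _ => _) = cst 0); first exact: integrable0.
apply/funext => x /=; rewrite indic_itvco (_ : (_ <= _ < _) = false) ?mul0r //.
by apply/negbTE/negP => /andP[ax xb]; lra.
Qed.

(** All integrals of [p] over bounded intervals vanish, and by Lebesgue differentiation [p] is
    almost everywhere the derivative of such an integral. *)
Lemma step_total (p : R -> R) : measurable_fun setT p ->
  (forall a, rint (fun x => step a x * p x)) ->
  (forall a, \int[mu]_x (step a x * p x) = 0) ->
  {ae mu, forall x, p x = 0}.
Proof.
move=> mp ip p0.
have int_co (a b : R) : mu.-integrable `[a, b[ (EFin \o p).
  by apply: (rint_indicM p (measurable_itv _)).2; exact: locally_rint_step.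
have int_cc (a b : R) : mu.-integrable `[a, b] (EFin \o p).
  apply: (integrableS _ _ _ (int_co a (b + 1))) => //.
  by apply: subset_itvl; rewrite bnd_simp; lra.
have Fco (a b : R) : \int[mu]_(x in `[a, b]) p x = 0.
  rewrite -Rintegral_itvco // -Rintegral_indicM.
  case: (lerP a b) => ab.
    rewrite (_ : (fun _ => _) = (fun x => step b x * p x - step a x * p x)).
      by rewrite RintegralB // ?p0 ?subrr //; exact: ip.
    by apply/funext => x; rewrite -mulrBl step_sub.
  rewrite -[RHS](Rintegral_set0 mu p) Rintegral_indicM set_itv_ge //.
  by rewrite bnd_simp -leNgt ltW.
have locp : locally_integrable setT p.
  split => //; first exact: openT.
  move=> K _ cK.
  have [M hM] : exists M : R, K `<=` `[- M, M].
    have [M [_ /(_ (M + 1))]] := compact_bounded cK.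
    rewrite ltrDl ltr01 => /(_ isT) h; exists (M + 1) => x Kx /=.
    by rewrite in_itv /= -ler_norml; exact: h.
  have mK : measurable K by exact: compact_measurable.
  have : mu.-integrable K (EFin \o p).
    by apply: (integrableS _ _ _ (int_cc (- M) M)).
  by move=> /integrableP[].
(* The differentiation theorem is applied to the integral with the fixed left endpoint -n; countably
   many of them cover the line. *)
have aen (n : nat) : {ae mu, forall x, - n%:R < x -> p x = 0}.
  have := @FTC1 R p (BLeft (- n%:R)) (fun y => int_cc _ y) locp.
  move=> h; apply: (ae_imp h) => x hx nx.
  have [|_ <-] := hx; first by rewrite lte_fin.
  have -> : (fun y => \int[mu]_(t in `[1 *- n, y]) p t) = cst 0.
    by apply/funext => y; exact: Fco.
  by rewrite derive1_cst.
have /(ae_foralln) h := aen.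
apply: (ae_imp h) => x hx; have := hx (Num.bound `|x|); apply.
rewrite ltrNl; apply: le_lt_trans (archi_boundP (normr_ge0 x)).
by rewrite -normrN ler_norm.
Qed.

End Steps.

(** * Fourier transforms of step functions *)

Section StepTransform.
Context {R : realType}.
Local Notation C := R[i].
Local Notation mu := (@lebesgue_measure R).

Definition cis (x : R) : C := cos x +i* sin x.

Lemma cisD x y : cis (x + y) = cis x * cis y.
Proof. by rewrite /cis cosD sinD; simpc; rewrite [sin x * _ + _]addrC. Qed.

Lemma cis0 : cis 0 = 1.
Proof. by rewrite /cis cos0 sin0. Qed.

Lemma conjc_cis x : conjc (cis x) = cis (- x).
Proof. by rewrite /cis cosN sinN. Qed.

Lemma cabs_cis x : cabs (cis x) = 1.
Proof. by rewrite /= cos2Dsin2 sqrtr1. Qed.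

Lemma cmeasurable_cis (a : R) : cmeasurable (fun x => cis (a * x)).
Proof. by split; [exact: measurable_cosl|exact: measurable_sinl]. Qed.

Definition fourier_cst : R := (Num.sqrt (2 * pi))^-1.

Lemma fourier_cst_sq : fourier_cst ^+ 2 = (2 * pi)^-1.
Proof. by rewrite exprVn sqr_sqrtr // mulr_ge0 // pi_ge0. Qed.

Lemma fourierL1E (f : R -> C) xi :
  fourierL1 f xi = fourier_cst%:C * cintegral (fun t => f t * cis (- xi * t)).
Proof.
rewrite /fourierL1; congr (_ * cintegral _); apply/funext => t.
by rewrite /cis mulNr cosN sinN [xi * t]mulrC.
Qed.

Definition stepf (a : R) : R -> C := fun x => (step a x)%:C.
Definition stephat (a : R) : R -> C := fourierL1 (stepf a).

Lemma stephatE (a xi : R) : xi != 0 ->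
  stephat a xi = fourier_cst%:C * (sin (xi * a) / xi +i* ((cos (xi * a) - 1) / xi)).
Proof.
move=> xi0; rewrite /stephat fourierL1E; congr (_ * _).
rewrite /cintegral /stepf /cis; congr (_ +i* _).
  rewrite (_ : (fun _ => _) = fun x => step a x * cos (xi * x)); last first.
    by apply/funext => x /=; rewrite mul0r subr0 mulNr cosN.
  have dP (x : R) : is_derive x 1 (fun x => sin (xi * x) / xi) (cos (xi * x)).
    by apply: is_derive_eq; rewrite /GRing.scale /=; field.
  rewrite (Rintegral_step a _ dP); last exact: continuous_cosl.
  by rewrite mulr0 sin0 mul0r subr0.
rewrite (_ : (fun _ => _) = fun x => step a x * - sin (xi * x)); last first.
  by apply/funext => x /=; rewrite mul0r addr0 mulNr sinN.
have dP (x : R) : is_derive x 1 (fun x => cos (xi * x) / xi) (- sin (xi * x)).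
  by apply: is_derive_eq; rewrite /GRing.scale /=; field.
rewrite (Rintegral_step a _ dP); last by move=> x; apply: cvgN; exact: continuous_sinl.
by rewrite mulr0 cos0 -mulrBl.
Qed.

Lemma ae_neq (x : R) : {ae mu, forall y, y != x}.
Proof.
exists [set x]; split => //; first exact: lebesgue_measure_set1.
by move=> y /= /negP; rewrite negbK => /eqP.
Qed.

Lemma cmeasurable_stephat a : cmeasurable (stephat a).
Proof.
(* At 0 the closed form evaluates to 0 because [0^-1 = 0]; the true value is added on the
   singleton. *)
have -> : stephat a = fun xi => fourier_cst%:C *
    (sin (xi * a) / xi +i* ((cos (xi * a) - 1) / xi)) +
    ((xi == 0)%R%:R : R)%:C * stephat a 0.
  apply/funext => xi; have [->|xi0] := eqVneq xi 0.
    by rewrite mul1r mul0r sin0 invr0 !mulr0 add0r.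
  by rewrite mul0r addr0 stephatE.
apply: cmeasurableD.
  have mc : measurable_fun setT (fun t : R => cos (t * a)).
    rewrite (_ : (fun _ => _) = fun t => cos (a * t)); first exact: measurable_cosl.
    by apply/funext => t; rewrite mulrC.
  have ms : measurable_fun setT (fun t : R => sin (t * a)).
    rewrite (_ : (fun _ => _) = fun t => sin (a * t)); first exact: measurable_sinl.
    by apply/funext => t; rewrite mulrC.
  apply: cmeasurableZ; split => /=.
    by apply: measurable_funM => //; exact: measurable_invr.
  apply: measurable_funM; last exact: measurable_invr.
  by apply: measurable_funB => //; exact: measurable_cst.
apply: cmeasurableM; last exact: cmeasurable_cst.
apply: cmeasurable_real; rewrite (_ : (fun _ => _) = \1_[set 0 : R]).
  exact: measurable_indic.
apply/funext => x; rewrite indicE; congr (_%:R); congr nat_of_bool.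
by apply/idP/idP => [/eqP ->|/set_mem /= ->]; [exact: mem_set|exact: eqxx].
Qed.

(** The numerator is |e^{-ia xi} - e^{-ib xi}|^2 = 2 - 2 cos((a - b) xi), divided by 2 pi xi^2. Its
    integral |a - b| is therefore the sinc-squared integral. *)
Lemma stephat_sub_sq (a b xi : R) : xi != 0 ->
  cabs (stephat a xi - stephat b xi) ^+ 2 = pi^-1 * sinc2 (a - b) xi.
Proof.
move=> xi0; rewrite !stephatE // -mulrBr ComplexField.Normc.normcM exprMn.
rewrite !cabs2E /= [0 ^+ 2]expr0n addr0 fourier_cst_sq.
rewrite /sinc2 [(a - b) * xi]mulrBl cosB [a * xi]mulrC [b * xi]mulrC.
have pi0 : (pi : R) != 0 by rewrite gt_eqF // pi_gt0.
have := cos2Dsin2 (xi * a); have := cos2Dsin2 (xi * b).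
set c := cos (xi * a); set s := sin (xi * a).
set d := cos (xi * b); set r := sin (xi * b) => h1 h2.
have -> : s / xi - r / xi = (s - r) / xi by field.
have -> : (c - 1) / xi - (d - 1) / xi = (c - d) / xi by field.
have -> : ((s - r) / xi) ^+ 2 + ((c - d) / xi) ^+ 2 =
   ((c ^+ 2 + s ^+ 2) + (d ^+ 2 + r ^+ 2) - 2 * (c * d + s * r)) / xi ^+ 2 by field.
rewrite h1 h2; move: (pi : R) pi0 => q q0.
by field; rewrite xi0.
Qed.

Lemma sqnormL2_stephat_sub (a b : R) :
  sqnormL2 (fun xi => stephat a xi - stephat b xi) = (`|a - b|)%:E.
Proof.
have pi0 : (pi : R) != 0 by rewrite gt_eqF // pi_gt0.
have ms := measurable_sinc2 (a - b).
rewrite /sqnormL2; transitivity (\int[mu]_xi (pi^-1 * sinc2 (a - b) xi)%:E)%E.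
  apply: ae_eq_integral => //.
  - apply: emeasurable_cabs2; apply: cmeasurableB; exact: cmeasurable_stephat.
  - by apply: measurable_EFinR; apply: measurable_funM.
  - apply: (ae_imp (ae_neq 0)) => xi xi0 _; congr EFin.
    exact: stephat_sub_sq.
under eq_integral do rewrite EFinM.
rewrite ge0_integralZl //=.
- by rewrite integral_sinc2 -EFinM mulrA mulVf // mul1r.
- exact: measurable_EFinR.
- by move=> xi _; rewrite lee_fin sinc2_ge0.
- by rewrite lee_fin invr_ge0 pi_ge0.
Qed.

Lemma stepf0 : stepf 0 = fun=> 0.
Proof. by apply/funext => x; rewrite /stepf step0. Qed.

Lemma stephat0 xi : stephat 0 xi = 0.
Proof.
rewrite /stephat fourierL1E stepf0 (_ : (fun _ => _) = fun=> (0 : R)%:C).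
  by rewrite cintegral_real Rintegral_cst // mul0r mulr0.
by apply/funext => x; rewrite mul0r.
Qed.

Lemma L2_stephat a : L2 (stephat a).
Proof.
split; first exact: cmeasurable_stephat.
have := sqnormL2_stephat_sub a 0; rewrite subr0 => h.
rewrite -(_ : (fun x => stephat a x - stephat 0 x) = stephat a).
  by rewrite h ltry.
by apply/funext => x; rewrite stephat0 subr0.
Qed.

Definition step2 (a : R) : @L2fun R := toL2 (L2_step a).
Definition stephat2 (a : R) : @L2fun R := toL2 (L2_stephat a).

Lemma stephatN a xi : stephat a (- xi) = conjc (stephat a xi).
Proof.
have [->|xi0] := eqVneq xi 0.
  rewrite oppr0 /stephat fourierL1E.
  rewrite (_ : (fun _ => _) = fun x => (step a x)%:C).
    by rewrite cintegral_real -rmorphM conjc_real.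
  by apply/funext => x; rewrite mulNr mul0r oppr0 cis0 mulr1.
rewrite !stephatE ?oppr_eq0 // conjcM conjc_real; congr (_ * _) => /=.
by congr Complex; rewrite mulNr ?sinN ?cosN invrN ?mulrNN ?mulrN.
Qed.

Lemma nsq_step2_sub a b : nsq ipL2 (step2 a - step2 b) = `|a - b|.
Proof. by apply: EFin_inj; rewrite nsqL2E; exact: sqnormL2_step_sub. Qed.

Lemma nsq_stephat2_sub a b : nsq ipL2 (stephat2 a - stephat2 b) = `|a - b|.
Proof. by apply: EFin_inj; rewrite nsqL2E; exact: sqnormL2_stephat_sub. Qed.

Lemma nsq_step2 a : nsq ipL2 (step2 a) = `|a|.
Proof.
rewrite -[in RHS](subr0 a) -nsq_step2_sub; congr nsq.
have -> : step2 0 = 0 by apply: val_inj; exact: stepf0.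
by rewrite subr0.
Qed.

Lemma nsq_stephat2 a : nsq ipL2 (stephat2 a) = `|a|.
Proof.
rewrite -[in RHS](subr0 a) -nsq_stephat2_sub; congr nsq.
have -> : stephat2 0 = 0 by apply: val_inj; apply/funext => x; exact: stephat0.
by rewrite subr0.
Qed.

(** Real parts agree by polarisation from equal distances. Both imaginary parts vanish: the steps
    are real, and their transforms satisfy the symmetry [stephatN]. *)
Lemma step_gram a b : ipL2 (step2 a) (step2 b) = ipL2 (stephat2 a) (stephat2 b).
Proof.
have ImE (u v : @L2fun R) : conjc (ipL2 u v) = ipL2 u v -> complex.Im (ipL2 u v) = 0.
  by case: (ipL2 u v) => x y [] /= h; lra.
have h1 : complex.Im (ipL2 (step2 a) (step2 b)) = 0.
  apply: ImE; rewrite -[ipL2 _ _]/(innerL2 (stepf a) (stepf b)) innerL2E -cintegralJ; last exact: L2M_conj (L2_step a) (L2_step b).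
  congr cintegral; apply/funext => x.
  by rewrite /stepf !conjcM !conjc_real.
have h2 : complex.Im (ipL2 (stephat2 a) (stephat2 b)) = 0.
  apply: ImE; rewrite -[ipL2 _ _]/(innerL2 (stephat a) (stephat b)) innerL2E; set F := fun x => _ * _.
  have F1 : L1 F by exact: L2M_conj (L2_stephat a) (L2_stephat b).
  have mF : cmeasurable F by case: F1.
  (* The substitution x -> -x turns the integrand into its conjugate, so the integral is real. *)
  rewrite -cintegralJ // -[RHS](@cintegral_affine _ (-1) 0) //; last by right.
  congr cintegral; apply/funext => x.
  by rewrite /F /affine mulN1r addr0 !stephatN conjcM.
apply/eqP; rewrite eq_complex h1 h2 eqxx andbT.
by rewrite !polar_Re !nsq_step2 !nsq_stephat2 nsq_step2_sub nsq_stephat2_sub.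
Qed.

End StepTransform.

(** * The Fourier transform on L2 *)

Section FourierL1.
Context {R : realType}.
Local Notation C := R[i].
Local Notation mu := (@lebesgue_measure R).
Local Notation TR := (measurableTypeR R).

Lemma rfubini (G : TR * TR -> R) (p q : R -> R) :
  measurable_fun setT G -> rint p -> rint q ->
  (forall t y, `|G (t, y)| <= p t * q y) ->
  \int[mu]_t \int[mu]_y G (t, y) = \int[mu]_y \int[mu]_t G (t, y).
Proof.
move=> mG ip iq Gpq.
have mGE : measurable_fun setT (EFin \o G) by exact/measurable_EFinP.
have i1 t : rint (fun y => G (t, y)).
  apply: rint_le (rintZ (p t) iq) => //.
  exact: measurableT_comp mG (measurable_pair1 t).
have i2 y : rint (fun t => G (t, y)).
  apply: rint_le (rintZ (q y) ip) => [|t]; last by rewrite mulrC.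
  exact: measurableT_comp mG (measurable_pair2 y).
have iG : (mu \x mu)%E.-integrable setT (EFin \o G).
  apply: (@integrable12ltyP _ _ TR TR R mu mu _ mGE).2.
  have b0 : (0 <= \int[mu]_y `|q y|%:E)%E.
    by apply: integral_ge0 => y _; rewrite lee_fin.
  have bfin : (\int[mu]_y `|q y|%:E < +oo)%E by case/rintP: iq.
  have afin : (\int[mu]_t `|p t|%:E < +oo)%E by case/rintP: ip.
  apply: (@le_lt_trans _ _ (\int[mu]_t (`|p t|%:E * \int[mu]_y `|q y|%:E))%E).
    apply: ge0_le_integral => //.
    - by move=> t _; apply: integral_ge0.
    - have mGn : measurable_fun setT (abse \o (EFin \o G)) by exact: measurableT_comp.
      exact: (@measurable_fun_fubini_tonelli_F _ _ TR TR R mu _ mGn (fun=> abse_ge0 _)).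
    - apply: emeasurable_funM; last exact: measurable_cst.
      by apply: measurable_EFinR; apply: measurableT_comp => //; exact: rint_measurable.
    - move=> t _; rewrite -ge0_integralZl //.
      + apply: ge0_le_integral => //.
        * by apply: measurable_EFinR; apply: measurableT_comp => //; exact: rint_measurable (i1 t).
        * apply: emeasurable_funM; first exact: measurable_cst.
          by apply: measurable_EFinR; apply: measurableT_comp => //; exact: rint_measurable iq.
        * move=> y _; rewrite lee_fin -normrM (le_trans (Gpq t y)) // ler_norm //.
      + by apply: measurable_EFinR; apply: measurableT_comp => //; exact: rint_measurable iq.
  rewrite ge0_integralZr //.
    by rewrite lte_mul_pinfty // ?ge0_fin_numE // integral_ge0.
  by apply: measurable_EFinR; apply: measurableT_comp => //; exact: rint_measurable.
have FT := Fubini iG.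
apply: EFin_inj.
have e1 : (\int[mu]_t \int[mu]_y (G (t, y))%:E =
           \int[mu]_t (\int[mu]_y G (t, y))%R%:E)%E.
  by apply: eq_integral => t _; rewrite RintEFin.
have e2 : (\int[mu]_y \int[mu]_t (G (t, y))%:E =
           \int[mu]_y (\int[mu]_t G (t, y))%R%:E)%E.
  by apply: eq_integral => t _; rewrite RintEFin.
congr (fine _)%:E; rewrite -e1 -e2; exact: FT.
Qed.

Lemma cfubini (F : TR * TR -> C) (p q : R -> R) :
  measurable_fun setT (fun z => complex.Re (F z)) ->
  measurable_fun setT (fun z => complex.Im (F z)) ->
  rint p -> rint q -> (forall t y, cabs (F (t, y)) <= p t * q y) ->
  cintegral (fun t => cintegral (fun y => F (t, y))) =
  cintegral (fun y => cintegral (fun t => F (t, y))).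
Proof.
move=> mr mi ip iq Fpq.
have er := rfubini mr ip iq (fun t y => le_trans (cabs_Re _) (Fpq t y)).
have ei := rfubini mi ip iq (fun t y => le_trans (cabs_Im _) (Fpq t y)).
exact: (f_equal2 (@Complex R) er ei).
Qed.

Lemma cmeasurable_cisM (f : R -> C) xi : cmeasurable f ->
  cmeasurable (fun t => f t * cis (xi * t)).
Proof. by move=> mf; apply: cmeasurableM => //; exact: cmeasurable_cis. Qed.

Lemma L1_cisM (f : R -> C) xi : L1 f -> L1 (fun t => f t * cis (xi * t)).
Proof.
move=> /L1P[mf fi]; apply: L1_le fi; first exact: cmeasurable_cisM.
by move=> x; rewrite ComplexField.Normc.normcM cabs_cis mulr1.
Qed.

(** Dominated convergence. The continuity serves to obtain the measurability of [fourierL1 f]. *)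
Lemma continuous_fourier_integral (p q : R -> R) : rint p -> rint q ->
  continuous (fun xi : R => \int[mu]_t (p t * cos (xi * t) + q t * sin (xi * t))).
Proof.
move=> ip iq xi.
have mp := rint_measurable ip; have mq := rint_measurable iq.
have bnd x t : `|p t * cos (x * t) + q t * sin (x * t)| <= `|p t| + `|q t|.
  apply: le_trans (ler_normD _ _) _; rewrite !normrM; apply: lerD.
    by rewrite ler_piMr // cos_max.
  by rewrite ler_piMr // ler_norml sin_geN1 sin_le1.
have ipq : rint (fun t => `|p t| + `|q t|) by apply: rintD; exact: rint_norm.
apply: (@continuity_under_integral R _ TR mu
  (fun x t => p t * cos (x * t) + q t * sin (x * t)) setT measurableT
  (xi - 1) (xi + 1) _ _ (fun t => `|p t| + `|q t|) ipq) => //.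
- move=> x _; apply: rint_le ipq => //.
  by apply: measurable_funD; apply: measurable_funM => //;
     [exact: measurable_cosl|exact: measurable_sinl].
- apply: aeW => t _ x _.
  have hc : continuous (fun x : R => cos (x * t)).
    rewrite (_ : (fun _ => _) = fun x => cos (t * x)); first exact: continuous_cosl.
    by apply/funext => y; rewrite mulrC.
  have hs : continuous (fun x : R => sin (x * t)).
    rewrite (_ : (fun _ => _) = fun x => sin (t * x)); first exact: continuous_sinl.
    by apply/funext => y; rewrite mulrC.
  by apply: cvgD; apply: cvgM; [exact: cvg_cst|exact: hc|exact: cvg_cst|exact: hs].
- by move=> x _; apply: aeW => t _; exact: bnd.
- by rewrite inE /= in_itv /=; apply/andP; split; lra.
Qed.

Lemma cmeasurable_fourierL1 (f : R -> C) : L1 f -> cmeasurable (fourierL1 f).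
Proof.
move=> f1; have ir := L1_Re f1; have ii := L1_Im f1.
have -> : fourierL1 f = fun xi => fourier_cst%:C *
   ((\int[mu]_t (complex.Re (f t) * cos (xi * t) + complex.Im (f t) * sin (xi * t))) +i*
    (\int[mu]_t (complex.Im (f t) * cos (xi * t) + - complex.Re (f t) * sin (xi * t)))).
  apply/funext => xi; rewrite fourierL1E; congr (_ * (_ +i* _)).
    by apply: eq_Rintegral => t _; rewrite ReM /= mulNr cosN sinN; ring.
  by apply: eq_Rintegral => t _; rewrite ImM /= mulNr cosN sinN; ring.
apply: cmeasurableZ; split => /=; apply: continuous_measurable_fun.
  exact: continuous_fourier_integral.
by apply: continuous_fourier_integral => //; exact: rintN.
Qed.

(** The factor 2 comes from bounding the real and imaginary parts separately; for the boundedness of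
    the transform any constant will do. *)
Lemma cabs_cintegral_le (f : R -> C) : L1 f ->
  cabs (cintegral f) <= 2 * \int[mu]_x cabs (f x).
Proof.
move=> f1; have /L1P[mf fi] := f1.
apply: le_trans (cabs_le_ReIm _) _; rewrite /= mulr_natl mulr2n; apply: lerD.
  apply: le_trans (le_normr_Rintegral measurableT (L1_Re f1)) _.
  apply: le_Rintegral => //; first exact: rint_norm (L1_Re f1).
  by move=> x _; exact: cabs_Re.
apply: le_trans (le_normr_Rintegral measurableT (L1_Im f1)) _.
apply: le_Rintegral => //; first exact: rint_norm (L1_Im f1).
by move=> x _; exact: cabs_Im.
Qed.

Lemma fourierL1_bounded (f : R -> C) : L1 f ->
  exists M, forall xi, cabs (fourierL1 f xi) <= M.
Proof.
move=> f1; exists (fourier_cst * (2 * \int[mu]_x cabs (f x))) => xi.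
rewrite fourierL1E ComplexField.Normc.normcM.
have c0 : 0 <= fourier_cst :> R by rewrite invr_ge0 sqrtr_ge0.
have -> : cabs (fourier_cst%:C : C) = fourier_cst.
  by rewrite /= expr0n addr0 sqrtr_sqr ger0_norm.
rewrite ler_wpM2l //; apply: le_trans (cabs_cintegral_le (L1_cisM _ f1)) _.
have -> // : \int[mu]_x cabs (f x * cis (- xi * x)) = \int[mu]_x cabs (f x).
apply: eq_Rintegral => x _.
by rewrite ComplexField.Normc.normcM cabs_cis mulr1.
Qed.

Lemma L1M_bounded (M : R) (f g : R -> C) : cmeasurable f ->
  (forall x, cabs (f x) <= M) -> L1 g -> L1 (fun x => f x * g x).
Proof.
move=> mf fM /L1P[mg ig]; apply: L1_le (rintZ M ig).
  exact: cmeasurableM.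
by move=> x; rewrite ComplexField.Normc.normcM ler_wpM2r ?cabs_ge0.
Qed.

Lemma L1_fourierL1M (f g : R -> C) : L1 f -> L1 g ->
  L1 (fun x => fourierL1 f x * g x).
Proof.
move=> f1 g1; have [M fM] := fourierL1_bounded f1.
by apply: L1M_bounded fM g1; exact: cmeasurable_fourierL1.
Qed.

(** The multiplication formula: both sides are the double integral of f(t) g(y) e^{-ity}, in the two
    orders of integration. *)
Lemma fourierL1_mult (f g : R -> C) : L1 f -> L1 g ->
  cintegral (fun x => fourierL1 f x * g x) =
  cintegral (fun x => f x * fourierL1 g x).
Proof.
move=> f0 g1; pose f1 t := fourier_cst%:C * f t.
have Lf1 : L1 f1 by exact: L1Z.
have /L1P[mf fi] := Lf1; have /L1P[mg gi] := g1.
pose F (z : TR * TR) : C := f1 z.1 * g z.2 * cis (- (z.1 * z.2)).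
have FF : cintegral (fun t => cintegral (fun y => F (t, y))) =
          cintegral (fun y => cintegral (fun t => F (t, y))).
  have mfr := measurable_fst_comp mf.1; have mfi := measurable_fst_comp mf.2.
  have mgr := measurable_snd_comp mg.1; have mgi := measurable_snd_comp mg.2.
  have mc : measurable_fun setT (fun z : TR * TR => cos (- (z.1 * z.2))).
    apply: (measurable_prod_comp (p := fun u => cos (- u))).
    rewrite (_ : (fun _ => _) = fun u => cos (-1 * u)); first exact: measurable_cosl.
    by apply/funext => u; rewrite mulN1r.
  have ms : measurable_fun setT (fun z : TR * TR => sin (- (z.1 * z.2))).
    apply: (measurable_prod_comp (p := fun u => sin (- u))).
    rewrite (_ : (fun _ => _) = fun u => sin (-1 * u)); first exact: measurable_sinl.
    by apply/funext => u; rewrite mulN1r.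
  have m1 : measurable_fun setT (fun z : TR * TR => complex.Re (f1 z.1 * g z.2)).
    by under eq_fun do rewrite ReM; apply: measurable_funB; exact: measurable_funM.
  have m2 : measurable_fun setT (fun z : TR * TR => complex.Im (f1 z.1 * g z.2)).
    by under eq_fun do rewrite ImM; apply: measurable_funD; exact: measurable_funM.
  apply: (cfubini _ _ fi gi).
  - by under eq_fun do rewrite ReM; apply: measurable_funB; exact: measurable_funM.
  - by under eq_fun do rewrite ImM; apply: measurable_funD; exact: measurable_funM.
  - by move=> t y; rewrite !ComplexField.Normc.normcM cabs_cis mulr1.
have inner_y t : cintegral (fun y => F (t, y)) =
    f1 t * cintegral (fun y => g y * cis (- t * y)).
  rewrite -cintegralZ; last exact: L1_cisM.
  by congr cintegral; apply/funext => y; rewrite /F /= mulrA mulNr.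
have inner_t y : cintegral (fun t => F (t, y)) =
    g y * cintegral (fun t => f1 t * cis (- y * t)).
  rewrite -cintegralZ; last exact: L1_cisM.
  by congr cintegral; apply/funext => t; rewrite /F /= mulrA [f1 t * _]mulrC mulNr [t * y]mulrC.
have E1 : cintegral (fun x => fourierL1 f x * g x) =
    cintegral (fun y => cintegral (fun t => F (t, y))).
  congr cintegral; apply/funext => y; rewrite inner_t fourierL1E mulrC.
  rewrite -cintegralZ; last exact: L1_cisM.
  by congr (_ * cintegral _); apply/funext => t; rewrite mulrA.
rewrite E1 -FF; congr cintegral; apply/funext => t.
by rewrite inner_y fourierL1E mulrCA mulrA.
Qed.

End FourierL1.

(** * Existence, uniqueness, Parseval, surjectivity *)

Section FourierL2.
Context {R : realType}.
Local Notation C := R[i].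
Local Notation mu := (@lebesgue_measure R).
Implicit Types (f g : R -> C).

Lemma L1_stepf a : L1 (stepf a : R -> C).
Proof.
apply: L1_ReIm => /=; last exact: integrable0.
rewrite (_ : (fun _ => _) = fun x => step a x * 1); last first.
  by apply/funext => x; rewrite mulr1.
by apply: rint_step; exact: cst_continuous.
Qed.

Lemma stepf_total f : cmeasurable f -> (forall a, L1 (fun x => f x * stepf a x)) ->
  (forall a, cintegral (fun x => f x * stepf a x) = 0) ->
  {ae mu, forall x, f x = 0}.
Proof.
move=> [mr mi] f1 f0.
have RE a x : complex.Re (f x * stepf a x) = step a x * complex.Re (f x).
  by rewrite mulrC Re_realM.
have IE a x : complex.Im (f x * stepf a x) = step a x * complex.Im (f x).
  by rewrite mulrC Im_realM.
have r0 : {ae mu, forall x, complex.Re (f x) = 0}.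
  apply: step_total => // a.
    by have := L1_Re (f1 a); under eq_fun do rewrite RE.
  have := congr1 (@complex.Re R) (f0 a); rewrite Re_cintegral.
  by under eq_Rintegral do rewrite RE.
have i0 : {ae mu, forall x, complex.Im (f x) = 0}.
  apply: step_total => // a.
    by have := L1_Im (f1 a); under eq_fun do rewrite IE.
  have := congr1 (@complex.Im R) (f0 a); rewrite Im_cintegral.
  by under eq_Rintegral do rewrite IE.
apply: (ae_imp (ae_and r0 i0)) => x [h1 h2].
by apply/eqP; rewrite eq_complex h1 h2 !eqxx.
Qed.

Lemma fourierL1D f g : L1 f -> L1 g ->
  fourierL1 (fun x => f x + g x) = fun xi => fourierL1 f xi + fourierL1 g xi.
Proof.
move=> f1 g1; apply/funext => xi; rewrite !fourierL1E.
rewrite (_ : (fun t => (f t + g t) * _) =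
    fun t => f t * cis (- xi * t) + g t * cis (- xi * t)).
  rewrite cintegralD; [|exact: L1_cisM|exact: L1_cisM].
  by rewrite mulrDr.
by apply/funext => t; rewrite mulrDl.
Qed.

Lemma fourierL1Z c f : L1 f ->
  fourierL1 (fun x => c * f x) = fun xi => c * fourierL1 f xi.
Proof.
move=> f1; apply/funext => xi; rewrite !fourierL1E.
rewrite (_ : (fun t => c * f t * _) = fun t => c * (f t * cis (- xi * t))).
  rewrite cintegralZ; last exact: L1_cisM.
  by move: (cintegral _) => I; rewrite mulrCA.
by apply/funext => t; rewrite mulrA.
Qed.

Lemma fourierL1_0 : fourierL1 (fun=> 0 : C) = fun=> 0.
Proof.
apply/funext => xi; rewrite fourierL1E (_ : (fun _ => _) = fun=> (0 : R)%:C).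
  by rewrite cintegral_real Rintegral_cst // mul0r mulr0.
by apply/funext => x; rewrite mul0r.
Qed.

Lemma L1_lincomb_step l : L1 (L2val (lincomb (@step2 R) l)).
Proof.
rewrite /lincomb L2val_sum; apply: L1_sum => p; rewrite L2valZ.
by apply: L1Z; exact: L1_stepf.
Qed.

Lemma fourierL1_lincomb_step l :
  fourierL1 (L2val (lincomb (@step2 R) l)) = L2val (lincomb (@stephat2 R) l).
Proof.
elim: l => [|p l IH]; first by rewrite /lincomb !big_nil; exact: fourierL1_0.
have E (s : R -> @L2fun R) : lincomb s (p :: l) = p.1 *: s p.2 + lincomb s l.
  by rewrite /lincomb big_cons.
rewrite !E !L2valD !L2valZ fourierL1D.
- by rewrite IH fourierL1Z //; exact: L1_stepf.
- by apply: L1Z; exact: L1_stepf.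
- exact: L1_lincomb_step.
Qed.

Lemma cvgL2P (u : nat -> R -> C) f (Hu : forall n, L2 (u n)) (Hf : L2 f) :
  cvgL2 u f <-> sq_cvg ipL2 (fun n => toL2 (Hu n)) (toL2 Hf).
Proof.
have E n : sqnormL2 (fun x => u n x - f x) =
    (nsq ipL2 (toL2 (Hu n) - toL2 Hf))%:E by rewrite nsqL2E.
rewrite /cvgL2; under eq_cvg do rewrite E.
split=> [/fine_cvgP[_ /cvgrPdist_lt h] e e0|h].
  have [N _ HN] := h e e0; exists N => n Nn.
  by have := HN n Nn; rewrite /= sub0r normrN ger0_norm ?nsq_ge0.
apply/fine_cvgP; split; first exact: nearW.
apply/cvgrPdist_lt => e e0; have [N HN] := h e e0.
by exists N => // n /HN; rewrite /= sub0r normrN ger0_norm ?nsq_ge0.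
Qed.

Lemma step2_total (u : @L2fun R) : (forall a, ipL2 u (step2 a) = 0) -> nsq ipL2 u = 0.
Proof.
move=> u0; have u2 := L2val_L2 u.
have ae0 : {ae mu, forall x, L2val u x = 0}.
  have E a : (fun x => L2val u x * stepf a x) = (fun x => L2val u x * conjc (stepf a x)).
    by apply/funext => x; rewrite /stepf conjc_real.
  apply: stepf_total.
  - by case: u2.
  - by move=> a; rewrite E; apply: L2M_conj => //; exact: L2_step.
  - by move=> a; rewrite E -innerL2E; exact: u0.
by rewrite -[u]subr0; apply: nsqL2_ae.
Qed.

(** Extends the map [step2 a] to [stephat2 a]. The approximants are step functions, so they are in
    L1 and in L2, and their transforms are combinations of the [stephat a], again in L2. *)
Lemma is_fourier_exists f : L2 f -> exists2 g, is_fourier f g & sqnormL2 f = sqnormL2 g.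
Proof.
move=> f2.
have [l [y [lx ly xy]]] := isometry_extension (@L2_complete R) (@step_gram R)
  step2_total (toL2 f2).
exists (L2val y); last by rewrite -nsqL2E -xy nsqL2E.
split => //; split; first exact: L2val_L2.
exists (fun n => L2val (lincomb (@step2 R) (l n))).
have F n : fourierL1 (L2val (lincomb (@step2 R) (l n))) = L2val (lincomb (@stephat2 R) (l n)).
  exact: fourierL1_lincomb_step.
split.
- by move=> n; split; [exact: L1_lincomb_step|exact: L2val_L2].
- by move=> n; rewrite F; exact: L2val_L2.
- apply/(cvgL2P (fun n => L2val_L2 _) f2) => e /lx[N HN]; exists N => n /HN.
  by rewrite -!lte_fin !nsqL2E.
- rewrite (_ : (fun _ => _) = fun n => L2val (lincomb (@stephat2 R) (l n))); last first.
    by apply/funext => n; rewrite F.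
  apply/(cvgL2P (fun n => L2val_L2 _) (L2val_L2 y)) => e /ly[N HN]; exists N => n /HN.
  by rewrite -!lte_fin !nsqL2E.
Qed.

(* Testing against steps turns the defining limit into an identity that
   determines the transform almost everywhere. *)
Lemma is_fourier_mult f g a : is_fourier f g ->
  cintegral (fun x => g x * stepf a x) = cintegral (fun x => f x * stephat a x).
Proof.
move=> [f2 [g2 [u [u12 uh2 uf ug]]]].
have u2 n := (u12 n).2.
have cf := (cvgL2P u2 f2).1 uf; have cg := (cvgL2P uh2 g2).1 ug.
have s2 := L2J (L2_step a); have h2 := L2J (L2_stephat a).
have E p q : innerL2 p (fun x => conjc (q x)) = cintegral (fun x : R => p x * q x).
  by rewrite innerL2E; congr cintegral; apply/funext => x; rewrite conjcK.
rewrite -!E; change (ipL2 (toL2 g2) (toL2 s2) = ipL2 (toL2 f2) (toL2 h2)).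
apply: (sq_cvg_ip2 cg cf) => n.
change (innerL2 (fourierL1 (u n)) (fun x => conjc (stepf a x)) =
  innerL2 (u n) (fun x => conjc (stephat a x))).
by rewrite !E; apply: fourierL1_mult; [exact: (u12 n).1|exact: L1_stepf].
Qed.

(** Only integrability against steps is asked of [g] and [h], so that [fourierL1 f], which is
    bounded but not yet known to be in L2, can be compared in [is_fourier_L1]. *)
Lemma fourier_eq_ae f g h : cmeasurable g -> cmeasurable h ->
  (forall a, L1 (fun x => g x * stepf a x)) ->
  (forall a, L1 (fun x => h x * stepf a x)) ->
  (forall a, cintegral (fun x => g x * stepf a x) = cintegral (fun x => f x * stephat a x)) ->
  (forall a, cintegral (fun x => h x * stepf a x) = cintegral (fun x => f x * stephat a x)) ->
  {ae mu, forall x, g x = h x}.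
Proof.
move=> mg mh g1 h1 gE hE.
have E a : (fun x => (g x - h x) * stepf a x) =
    (fun x => g x * stepf a x - h x * stepf a x).
  by apply/funext => x; rewrite mulrBl.
have ae0 : {ae mu, forall x, g x - h x = 0}.
  apply: stepf_total; first exact: cmeasurableB.
    by move=> a; rewrite E; exact: L1B.
  by move=> a; rewrite E cintegralB // gE hE subrr.
by apply: (ae_imp ae0) => x /eqP; rewrite subr_eq0 => /eqP.
Qed.

Lemma L2_L1_stepf f a : L2 f -> L1 (fun x => f x * stepf a x).
Proof. by move=> f2; apply: L2M_L1 => //; exact: L2_step. Qed.

Lemma is_fourier_unique f g h : is_fourier f g -> is_fourier f h ->
  {ae mu, forall x, g x = h x}.
Proof.
move=> fg fh; have [_ [g2 _]] := fg; have [_ [h2 _]] := fh.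
apply: (@fourier_eq_ae f g h).
- by case: g2.
- by case: h2.
- by move=> a; exact: L2_L1_stepf.
- by move=> a; exact: L2_L1_stepf.
- by move=> a; exact: is_fourier_mult.
- by move=> a; exact: is_fourier_mult.
Qed.

Lemma cvgL2_ae (u : nat -> R -> C) f g : (forall n, cmeasurable (u n)) ->
  cmeasurable f -> cmeasurable g -> {ae mu, forall x, f x = g x} ->
  cvgL2 u f -> cvgL2 u g.
Proof.
move=> mu_ mf mg fg; rewrite /cvgL2.
suff -> : (fun n => sqnormL2 (fun x => u n x - f x)) =
    (fun n => sqnormL2 (fun x => u n x - g x)) by [].
apply/funext => n; apply: sqnormL2_ae; try exact: cmeasurableB.
by apply: (ae_imp fg) => x ->.
Qed.

Lemma is_fourier_ae f f' g g' : cmeasurable f' -> cmeasurable g' ->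
  {ae mu, forall x, f x = f' x} -> {ae mu, forall x, g x = g' x} ->
  is_fourier f g -> is_fourier f' g'.
Proof.
move=> mf mg ff gg [f2 [g2 [u [u12 uh2 uf ug]]]].
split; first exact: L2_ae f2.
split; first exact: L2_ae g2.
exists u; split => //.
  apply: cvgL2_ae uf => //; last by case: f2.
  by move=> n; case: (u12 n) => _ [].
apply: cvgL2_ae ug => //; last by case: g2.
by move=> n; case: (uh2 n).
Qed.

Lemma fourierP f : L2 f -> is_fourier f (fourier f).
Proof.
by move=> f2; have [g fg _] := is_fourier_exists f2; rewrite /fourier; apply: (xgetPex (fun=> 0)); exists g.
Qed.

Lemma fourier_ae f g : is_fourier f g -> {ae mu, forall x, fourier f x = g x}.
Proof. by move=> fg; have [f2 _] := fg; exact: is_fourier_unique (fourierP f2) fg. Qed.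

(** The constructed transform is isometric, and uniqueness carries this over to every other
    representative. *)
Lemma is_fourier_norm f g : is_fourier f g -> sqnormL2 f = sqnormL2 g.
Proof.
move=> fg; have [f2 [g2 _]] := fg; have [h fh ->] := is_fourier_exists f2.
have [_ [h2 _]] := fh.
by apply: sqnormL2_ae; [case: h2|case: g2|exact: is_fourier_unique fh fg].
Qed.

Lemma is_fourier_lin c f1 f2 g1 g2 : is_fourier f1 g1 -> is_fourier f2 g2 ->
  is_fourier (fun x => f1 x + c * f2 x) (fun x => g1 x + c * g2 x).
Proof.
move=> [F1 [G1 [u [u12 uh2 uf ug]]]] [F2 [G2 [v [v12 vh2 vf vg]]]].
split; first by apply: L2D => //; exact: L2Z.
split; first by apply: L2D => //; exact: L2Z.
have key (p q : nat -> R -> C) p0 q0 : (forall n, L2 (p n)) -> (forall n, L2 (q n)) ->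
    L2 p0 -> L2 q0 -> cvgL2 p p0 -> cvgL2 q q0 ->
    cvgL2 (fun n x => p n x + c * q n x) (fun x => p0 x + c * q0 x).
  move=> p2 q2 p02 q02 /(cvgL2P p2 p02) cp /(cvgL2P q2 q02) cq.
  have H n : L2 (fun x => p n x + c * q n x) by apply: L2D => //; exact: L2Z.
  have H0 : L2 (fun x => p0 x + c * q0 x) by apply: L2D => //; exact: L2Z.
  apply/(cvgL2P H H0) => e e0.
  have [N HN] := sq_cvgD cp (sq_cvgZ c cq) e0.
  by exists N => n /HN; rewrite -!lte_fin !nsqL2E.
exists (fun n x => u n x + c * v n x).
have F n : fourierL1 (fun x => u n x + c * v n x) =
    fun x => fourierL1 (u n) x + c * fourierL1 (v n) x.
  rewrite fourierL1D ?fourierL1Z //; [exact: (v12 n).1|exact: (u12 n).1|].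
  by apply: L1Z; exact: (v12 n).1.
split.
- move=> n; split.
    by apply: L1D; [exact: (u12 n).1|apply: L1Z; exact: (v12 n).1].
  by apply: L2D; [exact: (u12 n).2|apply: L2Z; exact: (v12 n).2].
- by move=> n; rewrite F; apply: L2D => //; exact: L2Z.
- by apply: key => // n; [exact: (u12 n).2|exact: (v12 n).2].
- rewrite (_ : (fun _ => _) = fun n x => fourierL1 (u n) x + c * fourierL1 (v n) x).
    exact: (key _ _ _ _ uh2 vh2 G1 G2 ug vg).
  by apply/funext => n; exact: F.
Qed.

Lemma is_fourierB f1 f2 g1 g2 : is_fourier f1 g1 -> is_fourier f2 g2 ->
  is_fourier (fun x => f1 x - f2 x) (fun x => g1 x - g2 x).
Proof.
move=> h1 h2; have := is_fourier_lin (-1) h1 h2.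
by congr is_fourier; apply/funext => x; rewrite mulN1r.
Qed.

Lemma is_fourierD f1 f2 g1 g2 : is_fourier f1 g1 -> is_fourier f2 g2 ->
  is_fourier (fun x => f1 x + f2 x) (fun x => g1 x + g2 x).
Proof.
move=> h1 h2; have := is_fourier_lin 1 h1 h2.
by congr is_fourier; apply/funext => x; rewrite mul1r.
Qed.

(** Polarisation of the isometry for f1 - c f2, with c = 1 for the real part and c = ['i] for the
    imaginary part. *)
Theorem parseval f1 f2 g1 g2 : is_fourier f1 g1 -> is_fourier f2 g2 ->
  innerL2 f1 f2 = innerL2 g1 g2.
Proof.
move=> h1 h2; have [F1 [G1 _]] := h1; have [F2 [G2 _]] := h2.
have N c : nsq ipL2 (toL2 F1 - c *: toL2 F2) = nsq ipL2 (toL2 G1 - c *: toL2 G2).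
  apply: EFin_inj; rewrite !nsqL2E !L2valD !L2valN !L2valZ /=.
  apply: is_fourier_norm; have := is_fourier_lin (- c) h1 h2.
  by congr is_fourier; apply/funext => x; rewrite mulNr.
have N1 : nsq ipL2 (toL2 F1) = nsq ipL2 (toL2 G1).
  by apply: EFin_inj; rewrite !nsqL2E; exact: is_fourier_norm.
have N2 : nsq ipL2 (toL2 F2) = nsq ipL2 (toL2 G2).
  by apply: EFin_inj; rewrite !nsqL2E; exact: is_fourier_norm.
change (ipL2 (toL2 F1) (toL2 F2) = ipL2 (toL2 G1) (toL2 G2)).
apply/eqP; rewrite eq_complex !polar_Re !polar_Im N1 N2 N.
by have := N 1; rewrite !scale1r => ->; rewrite !eqxx.
Qed.

Lemma is_fourier_stepf a : is_fourier (stepf a : R -> C) (stephat a).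
Proof.
split; first exact: L2_step.
split; first exact: L2_stephat.
have cc f : L2 f -> cvgL2 (fun=> f) f.
  move=> f2; apply/(cvgL2P (fun=> f2) f2) => e e0; exists 0%N => n _.
  by rewrite subrr nsq0.
exists (fun=> stepf a); split.
- by move=> _; split; [exact: L1_stepf|exact: L2_step].
- by move=> _; exact: L2_stephat.
- by apply: cc; exact: L2_step.
- by apply: cc; exact: L2_stephat.
Qed.

(** Inversion through conjugation: if p is the transform of the conjugate of g, then the conjugate
    of p has transform g. The two candidates are compared by testing against steps. *)
Theorem fourier_surjective g : L2 g -> exists f, is_fourier f g.
Proof.
move=> g2; have [p gp _] := is_fourier_exists (L2J g2).
have [_ [p2 _]] := gp; have f2 := L2J p2.
have [g' fg' _] := is_fourier_exists f2.
exists (fun x => conjc (p x)); have [_ [g'2 _]] := fg'.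
have aeg : {ae mu, forall x, g' x = g x}.
  apply: (@fourier_eq_ae (fun x => conjc (p x))).
  - by case: g'2.
  - by case: g2.
  - by move=> a; exact: L2_L1_stepf.
  - by move=> a; exact: L2_L1_stepf.
  - by move=> a; exact: is_fourier_mult.
  (* Parseval for a step and the conjugate of [g] reads: the integral of [g] times a step equals
     that of the conjugate of [p] times the transform of the step. *)
  - move=> a; have := parseval (is_fourier_stepf a) gp; rewrite !innerL2E.
    rewrite (_ : (fun x => _ * conjc (conjc _)) = fun x => g x * stepf a x).
      by move=> ->; congr cintegral; apply/funext => x; rewrite mulrC.
    by apply/funext => x; rewrite conjcK mulrC.
apply: is_fourier_ae aeg fg' => //; try exact: aeW.
- by case: f2.
- by case: g2.
Qed.

(** The approximants in [is_fourier] are required to have transforms in L2; this shows a posteriori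
    that every function in L1 and L2 satisfies this, with [fourierL1] as its transform. *)
Lemma is_fourier_L1 f : L1 f -> L2 f -> is_fourier f (fourierL1 f).
Proof.
move=> f1 f2; have [g fg _] := is_fourier_exists f2; have [_ [g2 _]] := fg.
have mf := cmeasurable_fourierL1 f1.
have aeg : {ae mu, forall x, g x = fourierL1 f x}.
  apply: (@fourier_eq_ae f) => //.
  - by case: g2.
  - by move=> a; exact: L2_L1_stepf.
  - by move=> a; apply: L1_fourierL1M => //; exact: L1_stepf.
  - by move=> a; exact: is_fourier_mult.
  - by move=> a; apply: fourierL1_mult => //; exact: L1_stepf.
by apply: is_fourier_ae aeg fg => //; [case: f2|exact: aeW].
Qed.

Lemma fourierL1_translate (a : R) f : L1 f ->
  fourierL1 (translate a f) = fun xi => cis (a * xi) * fourierL1 f xi.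
Proof.
move=> f1; apply/funext => xi; rewrite !fourierL1E mulrCA; congr (_ * _).
rewrite -cintegralZ; last exact: L1_cisM.
rewrite -[RHS](cintegral_translate a); last first.
  by apply: cmeasurableZ; apply: cmeasurable_cisM; case: f1.
congr cintegral; apply/funext => t; rewrite /translate mulrCA -cisD.
by congr (_ * cis _); ring.
Qed.

Lemma is_fourier_translate (a : R) f g : is_fourier f g ->
  is_fourier (translate a f) (fun xi => cis (a * xi) * g xi).
Proof.
move=> [f2 [g2 [u [u12 uh2 uf ug]]]].
have cisM2 q : L2 q -> L2 (fun xi => cis (a * xi) * q xi).
  apply: (@L2M_bounded _ 1); first exact: cmeasurable_cis.
  by move=> x; rewrite cabs_cis.
split; first exact: L2_translate.
split; first exact: cisM2.
exists (fun n => translate a (u n)).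
have F n : fourierL1 (translate a (u n)) = fun xi => cis (a * xi) * fourierL1 (u n) xi.
  by apply: fourierL1_translate; exact: (u12 n).1.
split.
- by move=> n; split; [apply: L1_translate; exact: (u12 n).1|
    apply: L2_translate; exact: (u12 n).2].
- by move=> n; rewrite F; exact: cisM2.
- move: uf; rewrite /cvgL2.
  suff -> : (fun n => sqnormL2 (fun x => u n x - f x)) =
    (fun n => sqnormL2 (fun x => translate a (u n) x - translate a f x)) by [].
  apply/funext => n; rewrite -(sqnormL2_translate a) //; apply: cmeasurableB; last by case: f2.
  by case: (u12 n) => _ [].
- move: ug; rewrite /cvgL2.
  suff -> : (fun n => sqnormL2 (fun x => fourierL1 (u n) x - g x)) =
    (fun n => sqnormL2 (fun x => fourierL1 (translate a (u n)) x - cis (a * x) * g x)) by [].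
  apply/funext => n; apply: eq_integral => x _; rewrite F -mulrBr ComplexField.Normc.normcM.
  by rewrite cabs_cis mul1r.
Qed.

End FourierL2.

(** * Fourier series *)

Section FourierSeries.
Context {R : realType}.
Local Notation C := R[i].
Local Notation mu := (@lebesgue_measure R).
Variables (h t0 : R).
Hypothesis h_gt0 : 0 < h.
Hypothesis t0_gt0 : 0 < t0.
Hypothesis ht0 : h * t0 = 2 * pi.

Lemma cis2pi : cis (2 * pi) = 1 :> C.
Proof. by rewrite /cis mulr_natl cos2pi sin2pi. Qed.

Lemma cis_nat (n : nat) : cis (n%:R * (2 * pi)) = 1 :> C.
Proof.
elim: n => [|n IH]; first by rewrite mul0r cis0.
by rewrite -addn1 natrD mulrDl cisD IH !mul1r cis2pi.
Qed.

Lemma cis_int (n : int) : cis (n%:~R * (2 * pi)) = 1 :> C.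
Proof.
case: n => n; first exact: cis_nat.
by rewrite NegzE mulrNz mulNr -conjc_cis cis_nat conjc1.
Qed.

Lemma stepK (a x : R) : 0 <= a -> step a x * step a x = step a x.
Proof.
move=> a0; have := step_sub x a0; rewrite step0 subr0 => ->.
by rewrite indicE; case: (_ \in _); rewrite ?mulr1 ?mulr0.
Qed.

Definition expo (n : int) (x : R) : C := cis (n%:~R * t0 * x).
Definition expoh (n : int) : R -> C := fun x => stepf h x * expo n x.

Lemma L2_cisM (a : R) (f : R -> C) : L2 f -> L2 (fun x => cis (a * x) * f x).
Proof.
apply: (@L2M_bounded _ 1); first exact: cmeasurable_cis.
by move=> x; rewrite cabs_cis.
Qed.

Lemma L2_expoh n : L2 (expoh n).
Proof.
have := L2_cisM (n%:~R * t0) (L2_step h); congr L2; apply/funext => x.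
by rewrite mulrC.
Qed.

Definition expo2 n : @L2fun R := toL2 (L2_expoh n).

Lemma cintegral_step_cis (c : R) : c != 0 ->
  cintegral (fun x => stepf h x * cis (c * x)) =
  (sin (c * h) / c) +i* ((1 - cos (c * h)) / c).
Proof.
move=> c0; rewrite /cintegral; congr (_ +i* _).
  rewrite (_ : (fun _ => _) = fun x => step h x * cos (c * x)); last first.
    by apply/funext => x; rewrite Re_realM.
  have dP (x : R) : is_derive x 1 (fun x => sin (c * x) / c) (cos (c * x)).
    by apply: is_derive_eq; rewrite /GRing.scale /=; field.
  rewrite (Rintegral_step h _ dP); last exact: continuous_cosl.
  by rewrite mulr0 sin0 mul0r subr0.
rewrite (_ : (fun _ => _) = fun x => step h x * sin (c * x)); last first.
  by apply/funext => x; rewrite Im_realM.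
have dP (x : R) : is_derive x 1 (fun x => - cos (c * x) / c) (sin (c * x)).
  by apply: is_derive_eq; rewrite /GRing.scale /=; field.
rewrite (Rintegral_step h _ dP); last exact: continuous_sinl.
by rewrite mulr0 cos0 -mulrBl opprK addrC.
Qed.

Lemma Rintegral_step_cst (a c : R) : \int[mu]_x (step a x * c) = c * a.
Proof.
have dP (x : R) : is_derive x 1 (fun x => c * x) c := dlin c x.
by rewrite (Rintegral_step a _ dP) ?mulr0 ?subr0 //; exact: cst_continuous.
Qed.

Lemma expo2_orth (i j : int) : ipL2 (expo2 i) (expo2 j) = (h * (i == j)%:R)%:C.
Proof.
rewrite -[ipL2 _ _]/(innerL2 (expoh i) (expoh j)) innerL2E.
rewrite (_ : (fun _ => _) = fun x => stepf h x * cis ((i - j)%:~R * t0 * x)); last first.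
  apply/funext => x; rewrite /expoh conjcM /stepf conjc_real /expo conjc_cis.
  rewrite mulrACA -cisD -rmorphM stepK ?ltW //; congr (_ * cis _).
  by rewrite intrD rmorphN /= !mulrDl !mulNr.
have [->|ij] := eqVneq i j.
  rewrite subrr (_ : (fun _ => _) = fun x => (step h x * 1)%:C); last first.
    by apply/funext => x; rewrite !mul0r cis0 mulr1 /= mulr1.
  by rewrite cintegral_real Rintegral_step_cst mulr1 mul1r.
have c0 : (i - j)%:~R * t0 != 0 :> R.
  by rewrite mulf_eq0 negb_or intr_eq0 subr_eq0 ij gt_eqF.
rewrite cintegral_step_cis // -mulrA [t0 * h]mulrC ht0.
have := cis_int (i - j); rewrite /cis => -[-> ->].
by rewrite subrr !mul0r mulr0.
Qed.

(** A linear bound is enough to make modulations by small frequencies close to the identity. *)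
Lemma cos_ge1B (x : R) : 0 <= x -> 1 - x <= cos x.
Proof.
move=> x0.
have dP (y : R) : is_derive y 1 (fun y => - cos (1 * y)) (sin (1 * y)).
  by apply: is_derive_eq; rewrite /GRing.scale /=; ring.
have := FTC_segment x0 (@continuous_sinl R 1) dP; rewrite mulr0 cos0 mul1r => E.
suff : \int[mu]_(y in `[0, x]) sin (1 * y) <= x by rewrite E; lra.
have x1 : \int[mu]_(y in `[0, x]) 1 = x.
  by rewrite Rintegral_cst //= lebesgue_measure_itv /= lte_fin; case: ltrgtP x0 => //= [_|<-] _; rewrite ?subr0 mul1r.
rewrite -[leRHS]x1; apply: le_Rintegral => //.
- apply: continuous_compact_integrable; first exact: segment_compact.
  exact/continuous_subspaceT/continuous_sinl.
- apply: continuous_compact_integrable; first exact: segment_compact.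
  by apply: continuous_subspaceT => y; exact: cvg_cst.
Qed.

Section Supported.
Variable f : R -> C.
Hypothesis f2 : L2 f.
Hypothesis fsupp : forall x, stepf h x * f x = f x.

Lemma supported_L1 : L1 f.
Proof.
have := L2M_L1 (L2_step h) f2; congr L1; apply/funext => x; exact: fsupp.
Qed.

Definition modul (s : R) : R -> C := fun x => cis (- s * x) * f x.

Lemma L2_modul s : L2 (modul s). Proof. exact: L2_cisM. Qed.

Lemma nsq_modul s : nsq ipL2 (toL2 (L2_modul s)) = nsq ipL2 (toL2 f2).
Proof.
apply: EFin_inj; rewrite !nsqL2E; apply: eq_integral => x _.
by rewrite /= /modul ComplexField.Normc.normcM cabs_cis mul1r.
Qed.

(** Varying [s] shifts the lattice on which the transform is sampled; for [s] in [0, t0) these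
    lattices cover the line exactly once, which links coefficients to Plancherel. *)
Lemma modul_coef s n : cabs (ipL2 (toL2 (L2_modul s)) (expo2 n)) ^+ 2 =
  2 * pi * cabs (fourierL1 f (s + n%:~R * t0)) ^+ 2.
Proof.
rewrite -[ipL2 _ _]/(innerL2 (modul s) (expoh n)) innerL2E fourierL1E.
rewrite ComplexField.Normc.normcM exprMn.
have -> : cabs (fourier_cst%:C : C) ^+ 2 = (2 * pi)^-1.
  by rewrite cabs2E /= expr0n addr0 fourier_cst_sq.
rewrite mulrA mulfV ?mul1r; last by rewrite mulf_neq0 // gt_eqF // pi_gt0.
congr (cabs (cintegral _) ^+ 2); apply/funext => x.
rewrite /modul /expoh conjcM /stepf conjc_real /expo conjc_cis.
transitivity (stepf h x * f x * (cis (- s * x) * cis (- (n%:~R * t0 * x)))).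
  by rewrite /stepf; ring.
by rewrite fsupp -cisD; congr (_ * cis _); ring.
Qed.

Local Notation F2 := (nsq ipL2 (toL2 f2)).
Let G (y : R) : R := cabs (fourierL1 f y) ^+ 2.

Let rint_G : rint G.
Proof.
by have [_ [g2 _]] := is_fourier_L1 supported_L1 f2; exact: L2_rint.
Qed.

Let G_ge0 y : 0 <= G y. Proof. exact: sqr_ge0. Qed.

Let integral_G : (\int[mu]_y (G y)%:E = F2%:E)%E.
Proof. by rewrite nsqL2E; apply/esym/is_fourier_norm; exact: is_fourier_L1 supported_L1 f2. Qed.

(** The integers from -M to M - 1. The asymmetry is wanted: the cells [n t0, (n+1) t0) then tile [-M
    t0, M t0). *)
Definition window (M : nat) : seq int := [seq k%:Z - M%:Z | k <- iota 0 M.*2].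

Lemma uniq_window M : uniq (window M).
Proof.
rewrite map_inj_uniq ?iota_uniq // => a b /(congr1 (+%R^~ M%:Z)).
by rewrite !subrK => -[].
Qed.

Let B (M : nat) (s : R) : R := \sum_(n <- window M) G (s + n%:~R * t0).

Let bessel_B M s : 2 * pi * B M s =
  \sum_(n <- window M) cabs (ipL2 (toL2 (L2_modul s)) (expo2 n)) ^+ 2.
Proof. by rewrite mulr_sumr; apply: eq_bigr => n _; rewrite modul_coef. Qed.

Let bessel_B_le M s : 2 * pi * B M s <= h * F2.
Proof.
rewrite bessel_B -(nsq_modul s).
exact: (bessel_le h_gt0 expo2_orth _ (uniq_window M)).
Qed.

Lemma step_shift (a b x : R) : 0 <= a -> step (b + a) x - step b x = step a (x - b).
Proof.
move=> a0; rewrite step_sub ?lerDl //.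
have := step_sub (x - b) a0; rewrite step0 subr0 => ->.
by rewrite !indic_itvco; congr ((_ && _)%:R); apply/idP/idP; lra.
Qed.

Lemma step_window (M : nat) (x : R) :
  step (M%:R * t0) x - step (- (M%:R * t0)) x =
  \sum_(n <- window M) step t0 (x - n%:~R * t0).
Proof.
have key K : step (- (M%:R * t0) + K%:R * t0) x - step (- (M%:R * t0)) x =
    \sum_(k <- iota 0 K) step t0 (x - (k%:Z - M%:Z)%:~R * t0).
  elim: K => [|K IH]; first by rewrite mul0r addr0 subrr big_nil.
  rewrite -addn1 iotaD big_cat -IH /= big_seq1 add0n.
  have -> : (K%:Z - M%:Z)%:~R * t0 = - (M%:R * t0) + K%:R * t0.
    by rewrite intrD rmorphN /= -!pmulrn; ring.
  rewrite -(step_shift _ _ (ltW t0_gt0)) [RHS]addrC addrA subrK.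
  by congr (step _ x - _); rewrite natrD; ring.
rewrite /window big_map -key; congr (step _ x - _).
by rewrite -addnn natrD; ring.
Qed.

Let step_norm (a x : R) : 0 <= a -> `|step a x| <= 1.
Proof.
move=> a0; have := step_sub x a0; rewrite step0 subr0 => ->.
by rewrite indicE; case: (_ \in _); rewrite ?normr1 ?normr0.
Qed.

Let rint_step_G c : rint (fun x => step t0 (x - c) * G x).
Proof.
apply: rint_le rint_G => [|x].
  apply: measurable_funM; last exact: rint_measurable.
  rewrite (_ : (fun _ => _) = fun x => step t0 (affine 1 (- c) x)).
    exact: (measurableT_comp (measurable_step t0) (measurable_affine _ _)).
  by apply/funext => x; rewrite /affine mul1r.
by rewrite normrM (ger0_norm (G_ge0 x)) ler_piMl // step_norm // ltW.
Qed.

Let rint_shift_G c : rint (fun x => step t0 x * G (x + c)).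
Proof.
have := rint_affine c (or_introl erefl) (rint_step_G c); congr rint.
by apply/funext => x; rewrite /affine mul1r addrK.
Qed.

(** Cutting the long interval into cells and translating each one to [0, t0) exchanges the energy of
    the transform with the averaged energy of its samples. *)
Let integral_window M :
  \int[mu]_x ((step (M%:R * t0) x - step (- (M%:R * t0)) x) * G x) =
  \int[mu]_s (step t0 s * B M s).
Proof.
have E1 : \int[mu]_x ((step (M%:R * t0) x - step (- (M%:R * t0)) x) * G x) =
    \int[mu]_x (\sum_(n <- window M) (step t0 (x - n%:~R * t0) * G x)).
  by apply: eq_Rintegral => x _; rewrite step_window mulr_suml.
have E2 : \int[mu]_s (step t0 s * B M s) =
    \int[mu]_s (\sum_(n <- window M) (step t0 s * G (s + n%:~R * t0))).
  by apply: eq_Rintegral => s _; rewrite mulr_sumr.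
rewrite E1 E2 (@Rintegral_sum _ _ _ _ (fun n => rint_step_G (n%:~R * t0))).
rewrite (@Rintegral_sum _ _ _ _ (fun n => rint_shift_G (n%:~R * t0))).
apply: eq_bigr => n _.
have := Rintegral_affine (n%:~R * t0) (or_introl erefl)
  (rint_measurable (rint_step_G (n%:~R * t0))).
move=> <-; apply: eq_Rintegral => s _.
by rewrite /affine mul1r addrK.
Qed.

(** Otherwise every [s] in [0, eta] would miss a fixed amount of energy for all windows; averaging
    over [s] and letting the windows grow would make the norm of the transform smaller than that of
    [f]. *)
Lemma fourier_series_modul (eta e : R) : 0 < eta -> eta <= t0 -> 0 < e ->
  exists s M, [/\ 0 <= s, s <= eta &
    nsq ipL2 (toL2 (L2_modul s) -
      fourier_sum ipL2 expo2 h (toL2 (L2_modul s)) (window M)) < e].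
Proof.
move=> eta0 etat e0; apply: contrapT => neg.
have pi0 : 0 < pi :> R := pi_gt0 R.
have low s M : 0 <= s -> s <= eta -> 2 * pi * B M s <= h * F2 - h * e.
  move=> s0 se; rewrite leNgt; apply/negP => lt; apply: neg; exists s, M; split => //.
  rewrite (bessel_eq h_gt0 expo2_orth _ (uniq_window M)) nsq_modul -bessel_B.
  rewrite ltrBlDr -ltrBlDl ltr_pdivlMl // mulrBr //.
(* [c1] is the Bessel bound on [B M s], and [t0 * c1 = F2] because [h * t0 = 2 * pi]; [c2] is the
   deficit assumed on [0, eta]. *)
pose c1 := h * F2 / (2 * pi); pose c2 := h * e / (2 * pi).
have bnd M s : step t0 s * B M s <= step t0 s * c1 - step eta s * c2.
  have B1 : B M s <= c1 by rewrite ler_pdivlMr ?mulr_gt0 // mulrC bessel_B_le.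
  have := step_sub s (ltW t0_gt0); have := step_sub s (ltW eta0).
  rewrite !step0 !subr0 !indic_itvco => -> ->.
  have [s0|s0] := lerP 0 s; last by rewrite !mul0r subrr.
  have [st|st] := ltrP s t0; last first.
    have -> : (s < eta) = false by apply/negbTE; rewrite -leNgt (le_trans etat).
    by rewrite !mul0r subrr.
  rewrite !mul1r; have [se|se] := ltrP s eta; last by rewrite mul0r subr0.
  rewrite mul1r -mulrBl ler_pdivlMr ?mulr_gt0 // mulrC; exact: low s0 (ltW se).
have intle M : (\int[mu]_x (((step (M%:R * t0) x - step (- (M%:R * t0)) x) * G x)%R)%:E
    <= (F2 - eta * c2)%:E)%E.
  have Mn : - (M%:R * t0) <= M%:R * t0.
    by rewrite -subr_ge0 opprK addr_ge0 // mulr_ge0 // ltW.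
  have iW : rint (fun x => (step (M%:R * t0) x - step (- (M%:R * t0)) x) * G x).
    apply: rint_le rint_G => [|x].
      apply: measurable_funM; last exact: rint_measurable.
      by apply: measurable_funB; exact: measurable_step.
    rewrite normrM (ger0_norm (G_ge0 x)) ler_piMl // step_sub // indicE.
    by case: (_ \in _); rewrite ?normr1 ?normr0.
  rewrite -RintEFin // lee_fin integral_window.
  have r1 (a c : R) : rint (fun x => step a x * c) by apply: rint_step; exact: cst_continuous.
  have -> : F2 - eta * c2 = \int[mu]_s (step t0 s * c1 - step eta s * c2).
    rewrite (RintegralB measurableT (r1 t0 c1) (r1 eta c2)).
    rewrite (Rintegral_step_cst t0 c1) (Rintegral_step_cst eta c2).
    rewrite [eta * _]mulrC; congr (_ - _).
    by rewrite /c1 -ht0; field; rewrite !gt_eqF.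
  apply: le_Rintegral => //.
  - have -> : (fun s => step t0 s * B M s) =
        fun s => \sum_(n <- window M) step t0 s * G (s + n%:~R * t0).
      by apply/funext => s; rewrite mulr_sumr.
    exact: rint_sum.
  - exact: rintB.
(* The truncations of [G] to [-M t0, M t0) are eventually equal to [G] at each point, so the bound
   with deficit passes to the full integral [F2]. *)
have := @fatou_bound R (fun M x => (step (M%:R * t0) x - step (- (M%:R * t0)) x) * G x)
  G (F2 - eta * c2) 0%N.
rewrite integral_G lee_fin => /(_ _ _ _ (fun M _ => intle M)) F.
have : F2 <= F2 - eta * c2.
  apply: F.
  - move=> M; apply: measurable_funM; last exact: rint_measurable rint_G.
    by apply: measurable_funB; exact: measurable_step.
  - move=> M x; rewrite mulr_ge0 // step_sub ?indicE ?ler0n //.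
    by rewrite -subr_ge0 opprK addr_ge0 // mulr_ge0 // ltW.
  - move=> x; apply: cvg_near_cst.
    exists (Num.bound (`|x| / t0)) => // M /= HM.
    have hM : `|x| < M%:R * t0.
      rewrite -ltr_pdivrMr //; apply: lt_le_trans (archi_boundP _) _.
        by rewrite divr_ge0 // ltW.
      by rewrite ler_nat.
    move: hM; rewrite ltr_norml => /andP[x1 x2].
    rewrite step_sub ?(ltW (lt_trans x1 x2)) // indic_itvco (ltW x1) x2 mul1r //.
suff : 0 < eta * c2 by lra.
by rewrite mulr_gt0 // divr_gt0 // mulr_gt0.
Qed.

(** On the support, |1 - e^{-isx}|^2 = 2 - 2 cos(sx) <= 2 s x <= 2 s h. *)
Lemma nsq_modul_sub (s : R) : 0 <= s ->
  nsq ipL2 (toL2 f2 - toL2 (L2_modul s)) <= 2 * s * h * F2.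
Proof.
move=> s0; have [mf fi] := f2.
have if2 := L2_rint f2.
have k0 : 0 <= 2 * s * h by rewrite !mulr_ge0 // ltW.
have Zl : (\int[mu]_x ((2 * s * h)%:E * (cabs (f x) ^+ 2)%:E) =
    (2 * s * h)%:E * \int[mu]_x (cabs (f x) ^+ 2)%:E)%E.
  apply: ge0_integralZl => //; first exact: emeasurable_cabs2.
  by move=> x _; rewrite lee_fin sqr_ge0.
rewrite -lee_fin nsqL2E EFinM nsqL2E [leRHS](esym Zl).
apply: ge0_le_integral => //.
- by move=> x _; rewrite lee_fin sqr_ge0.
- by apply: emeasurable_cabs2; exact: L2_measurable (L2val_L2 _).
- apply: emeasurable_funM; first exact: measurable_cst.
  exact: emeasurable_cabs2.
move=> x _; rewrite -EFinM lee_fin.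
have [/andP[x0 xh]|xn] := boolP (0 <= x < h); last first.
  have f0 : f x = 0.
    rewrite -fsupp /stepf; have := step_sub x (ltW h_gt0); rewrite step0 subr0 => ->.
    by rewrite indic_itvco (negbTE xn) mul0r.
  by rewrite L2valD L2valN /= /modul f0 mulr0 subrr cabs2E /= expr0n addr0 mulr0.
have -> : L2val (toL2 f2 - toL2 (L2_modul s)) x = (1 - cis (- s * x)) * f x.
  by rewrite L2valD L2valN /= /modul mulrBl mul1r.
rewrite ComplexField.Normc.normcM exprMn ler_wpM2r ?sqr_ge0 //.
rewrite cabs2E ReD ImD ReN ImN /= mulNr cosN sinN sub0r opprK.
have := cos2Dsin2 (s * x).
have sx0 : 0 <= s * x by rewrite mulr_ge0.
have := cos_ge1B sx0.
have : s * x <= s * h by rewrite ler_wpM2l // ltW.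
move: (cos (s * x)) (sin (s * x)) => c d; nra.
Qed.

(** The Fourier sum of a slightly modulated [f] is a trigonometric polynomial close to [f];
    [best_approx] replaces it by the Fourier sums of [f] itself over all larger index sets. *)
Lemma fourier_series (e : R) : 0 < e ->
  exists N0 : seq int, forall N, uniq N -> {subset N0 <= N} ->
    nsq ipL2 (toL2 f2 - fourier_sum ipL2 expo2 h (toL2 f2) N) < e.
Proof.
move=> e0; have F0 : 0 <= F2 by exact: nsq_ge0.
pose K := h * F2 + 1; have K0 : 0 < K by rewrite ltr_wpDl // mulr_ge0 // ltW.
(* With this choice the modulation contributes at most 2 (2 e/16) = e/4 and its Fourier error less
   than 2 (e/4), in total less than 3e/4. The 1 in [K] keeps the denominator positive. *)
pose eta := Num.min t0 (e / 16 / K).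
have eta0 : 0 < eta by rewrite lt_min t0_gt0 !divr_gt0.
have etat : eta <= t0 by rewrite ge_min lexx.
have e4 : 0 < e / 4 by lra.
have [s [M [s0 se hs]]] := fourier_series_modul eta0 etat e4.
exists (window M) => N uN sN.
set S := fourier_sum _ _ _ _ _ in hs.
apply: le_lt_trans (_ : nsq ipL2 (toL2 f2 - S) < e).
  exact: (best_approx h_gt0 expo2_orth _ _ uN sN).
apply: le_lt_trans (nsqB_le _ _ (toL2 (L2_modul s)) _) _.
have := nsq_modul_sub s0.
have : s * h * F2 <= e / 16.
  have : s * K <= e / 16.
    by rewrite -ler_pdivlMr // (le_trans se) // ge_min lexx orbT.
  by apply: le_trans; rewrite -mulrA ler_wpM2l // /K lerDl.
lra.
Qed.

(** Bessel bounds every finite sum from above; convergence of the Fourier sums, read through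
    [bessel_eq], gives the reverse inequality up to any [e]. *)
Lemma fourier_series_parseval :
  (\esum_(n in [set: int]) (cabs (ipL2 (toL2 f2) (expo2 n)) ^+ 2)%:E = (h * F2)%:E)%E.
Proof.
apply/eqP; rewrite eq_le; apply/andP; split.
  apply: ub_ereal_sup => _ [A [Afin _] <-].
  have bl := bessel_le h_gt0 expo2_orth (toL2 f2) (fset_uniq (fset_set A)).
  by rewrite fsbig_finite // sumEFin lee_fin.
apply/lee_addgt0Pr => e e0.
have eh : 0 < e / h by rewrite divr_gt0.
have [N0 HN] := fourier_series eh.
pose N := undup N0.
have uN : uniq N by exact: undup_uniq.
have sN : {subset N0 <= N} by move=> x; rewrite mem_undup.
have := HN N uN sN.
rewrite (bessel_eq h_gt0 expo2_orth _ uN) ltr_pdivlMr // mulrBl mulrAC mulVf ?gt_eqF // mul1r.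
move=> lt; apply: (@le_trans _ _ ((\sum_(n <- N) cabs (ipL2 (toL2 f2) (expo2 n)) ^+ 2)%:E + e%:E)%E).
  by rewrite -EFinD lee_fin; move: lt; rewrite [F2 * h]mulrC; lra.
rewrite leeD2r //; apply: esum_ge; exists [set` N].
  by split => //; exact: finite_seq.
by rewrite -fsbig_seq // sumEFin.
Qed.

End Supported.
End FourierSeries.

(** * The frame operator in the Fourier domain *)

Section FiniteSums.
Context {R : realType} {V : lmodType R[i]}.
Variable b : @inner_product R V.

Lemma nsq_sum_le (I : Type) (r : seq I) (F : I -> V) :
  nsq b (\sum_(i <- r) F i) <= 2 ^+ size r * \sum_(i <- r) nsq b (F i).
Proof.
elim: r => [|i r IH]; first by rewrite !big_nil nsq0 mulr0.
rewrite !big_cons /=; apply: le_trans (nsqD_le _ _ _) _.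
have e1 : 1 <= (2 : R) ^+ size r by rewrite exprn_ege1 // ler1n.
have := nsq_ge0 b (F i); rewrite exprS; nra.
Qed.

End FiniteSums.

Section FrameAnalysis.
Context {R : realType}.
Local Notation C := R[i].
Local Notation mu := (@lebesgue_measure R).
Variables (h t0 : R).
Hypothesis h_gt0 : 0 < h.
Hypothesis t0_gt0 : 0 < t0.
Hypothesis ht0 : h * t0 = 2 * pi.

(** Four cells of length [h], indexed by [window 2]. They contain the band, because 2/3 omega <= h
    gives omega <= 2h. *)
Definition supported (g : R -> C) := forall x, ~~ (- (2 * h) <= x < 2 * h) -> g x = 0.

Local Notation win := (window 2).

Lemma supportedE (g : R -> C) x : supported g ->
  g x = \sum_(k <- win) stepf h (x - k%:~R * h) * g x.
Proof.
move=> gs; rewrite -mulr_suml; have := step_window h_gt0 2 x.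
rewrite step_sub; last by have h0 := h_gt0; lra.
move=> /(congr1 (real_complex R)); rewrite rmorph_sum /= => <-.
rewrite indic_itvco; case: (boolP (_ <= x < _)) => [|/gs ->]; rewrite ?mul1r //.
by rewrite mulr0.
Qed.

(** One period of the periodisation, extended by zero instead of periodically so that it stays in
    L2. Four shifts suffice for a [supported] function. *)
Definition per (H : R -> C) (x : R) : C := \sum_(k <- win) stepf h x * H (x + k%:~R * h).

Lemma L2_stepM (f : R -> C) : L2 f -> L2 (fun x => stepf h x * f x).
Proof.
apply: (@L2M_bounded _ 1); first by case: (L2_step h).
move=> x; have := step_sub x (ltW h_gt0); rewrite step0 subr0 /stepf => ->.
exact: cabs_indic_le1.
Qed.

Lemma L1_stepM (f : R -> C) : L1 f -> L1 (fun x => stepf h x * f x).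
Proof.
apply: (@L1M_bounded _ 1); first by case: (L2_step h).
move=> x; have := step_sub x (ltW h_gt0); rewrite step0 subr0 /stepf => ->.
exact: cabs_indic_le1.
Qed.

Lemma L2_per H : L2 H -> L2 (per H).
Proof.
move=> H2; apply: L2_sum => k; apply: L2_stepM.
exact: (L2_translate (k%:~R * h) H2).
Qed.

Lemma stepf_per H x : stepf h x * per H x = per H x.
Proof.
rewrite mulr_sumr; apply: eq_bigr => k _.
by rewrite mulrA /stepf -rmorphM /= stepK // ltW.
Qed.

Lemma cintegral_per H : L1 H -> supported H -> cintegral H = cintegral (per H).
Proof.
move=> H1 Hs; have mS k : L1 (fun x => stepf h (x - k%:~R * h) * H x).
  have := L1_translate (- (k%:~R * h)) (L1_stepM (L1_translate (k%:~R * h) H1)).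
  by congr L1; apply/funext => x; rewrite /translate subrK.
rewrite {1}(_ : H = fun x => \sum_(k <- win) stepf h (x - k%:~R * h) * H x); last first.
  by apply/funext => x; exact: supportedE.
rewrite cintegral_sum // cintegral_sum; last first.
  by move=> k; apply: L1_stepM; exact: L1_translate.
apply: eq_bigr => k _; rewrite -(cintegral_translate (k%:~R * h)); last by case: (mS k).
by congr cintegral; apply/funext => x; rewrite /translate addrK.
Qed.

Lemma cis_period (n k : int) x :
  cis (n%:~R * t0 * (x + k%:~R * h)) = cis (n%:~R * t0 * x) :> C.
Proof.
rewrite mulrDr cisD -[RHS]mulr1; congr (_ * _).
rewrite -(cis_int (n * k)) -ht0 intrM; congr cis; ring.
Qed.

Section Coefficients.
Variables (f g p phi : R -> C) (M : R).
Hypothesis fg : is_fourier f g.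
Hypothesis phip : is_fourier phi p.
Hypothesis gs : supported g.
Hypothesis pM : forall x, cabs (p x) <= M.

Definition prodJ (x : R) : C := g x * conjc (p x).

Lemma prodJ_supported : supported prodJ.
Proof. by move=> x /gs gx; rewrite /prodJ gx mul0r. Qed.

Lemma L2_prodJ : L2 prodJ.
Proof.
have [_ [g2 _]] := fg; have [_ [p2 _]] := phip.
have : L2 (fun x => conjc (p x) * g x).
  apply: (@L2M_bounded _ M) g2; first by case: (L2J p2).
  by move=> x; rewrite cabsJ.
by congr L2; apply/funext => x; rewrite mulrC.
Qed.

Lemma L1_prodJ : L1 prodJ.
Proof.
have [_ [g2 _]] := fg; have [_ [p2 _]] := phip; exact: L2M_conj.
Qed.

Definition per2 : @L2fun R := toL2 (L2_per L2_prodJ).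

(** On the Fourier side a translation by n t0 is a character of period [h], which factors out when
    the integral is folded onto [0, h). *)
Lemma frame_coef (n : int) :
  innerL2 f (translate (n%:~R * t0) phi) = ipL2 per2 (expo2 h t0 n).
Proof.
rewrite (parseval fg (is_fourier_translate (n%:~R * t0) phip)).
rewrite -[ipL2 _ _]/(innerL2 (per prodJ) (expoh h t0 n)) !innerL2E.
rewrite (_ : (fun x => g x * _) = fun x => prodJ x * cis (- (n%:~R * t0) * x)); last first.
  apply/funext => x; rewrite conjcM conjc_cis /prodJ mulNr.
  by ring.
rewrite cintegral_per; first last.
- by move=> x /prodJ_supported ->; rewrite mul0r.
- by apply: L1_cisM; exact: L1_prodJ.
congr cintegral; apply/funext => x.
transitivity (per prodJ x * cis (- (n%:~R * t0 * x))).
  rewrite /per mulr_suml; apply: eq_bigr => k _; rewrite -mulrA; congr (_ * (_ * _)).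
  by have := cis_period (- n) k x; rewrite rmorphN /= !mulNr.
have -> : conjc (expoh h t0 n x) = stepf h x * cis (- (n%:~R * t0 * x)).
  by rewrite /expoh conjcM /stepf conjc_real /expo conjc_cis.
by rewrite -{1}(stepf_per prodJ x); ring.
Qed.

Lemma frame_coef_esum :
  (\esum_(n in [set: int]) (cabs (innerL2 f (translate (n%:~R * t0) phi)) ^+ 2)%:E =
   (h * nsq ipL2 per2)%:E)%E.
Proof.
rewrite -(fourier_series_parseval h_gt0 t0_gt0 ht0 (L2_per L2_prodJ) (stepf_per prodJ)).
by apply: eq_esum => n _; rewrite frame_coef.
Qed.

End Coefficients.

Lemma is_fourier0 : is_fourier (fun=> 0 : C) (fun=> 0).
Proof.
have [g gP _] := is_fourier_exists (@L2_0 R).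
have := is_fourierB gP gP; rewrite (_ : (fun _ => _) = fun=> 0); last first.
  by apply/funext => x; rewrite subrr.
by congr is_fourier; apply/funext => x; rewrite subrr.
Qed.

Lemma is_fourierZ c f g : is_fourier f g ->
  is_fourier (fun x => c * f x) (fun x => c * g x : C).
Proof.
move=> fg; have := is_fourier_lin c is_fourier0 fg.
by under eq_fun do rewrite add0r; under [X in is_fourier _ X]eq_fun do rewrite add0r.
Qed.

Lemma is_fourier_sum (I : Type) (r : seq I) (F G : I -> R -> C) :
  (forall i, is_fourier (F i) (G i)) ->
  is_fourier (fun x => \sum_(i <- r) F i x) (fun x => \sum_(i <- r) G i x).
Proof.
move=> FG; elim: r => [|i r IH].
  under eq_fun do rewrite big_nil; under [X in is_fourier _ X]eq_fun do rewrite big_nil.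
  exact: is_fourier0.
under eq_fun do rewrite big_cons; under [X in is_fourier _ X]eq_fun do rewrite big_cons.
exact: is_fourierD.
Qed.

Lemma frame_operator_unique (phi : 'I_3 -> R -> C) f q q' :
  (forall j, L2 (phi j)) -> frame_operator phi t0 f q -> frame_operator phi t0 f q' ->
  {ae mu, forall x, q x = q' x}.
Proof.
move=> phi2 [q2 hq] [q'2 hq'].
have at2 N : L2 (fun x => \sum_(j < 3) \sum_(n <- enum_fset N)
    innerL2 f (atom phi t0 j n) * atom phi t0 j n x).
  apply: L2_sum => j; apply: L2_sum => n; apply: L2Z; exact: L2_translate.
have : nsq ipL2 (toL2 q2 - toL2 q'2) = 0.
  apply/eqP; rewrite eq_le nsq_ge0 andbT; apply: le0_eps => e e0.
  have e4 : 0 < e / 4 by lra.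
  have [N0 H0] := hq _ e4; have [N1 H1] := hq' _ e4.
  have s0 : (N0 `<=` N0 `|` N1)%fset by exact: fsubsetUl.
  have s1 : (N1 `<=` N0 `|` N1)%fset by exact: fsubsetUr.
  have A : nsq ipL2 (toL2 q2 - toL2 (at2 (N0 `|` N1)%fset)) < e / 4.
    by rewrite -lte_fin nsqL2E; exact: H0.
  have B : nsq ipL2 (toL2 (at2 (N0 `|` N1)%fset) - toL2 q'2) < e / 4.
    by rewrite nsqBC -lte_fin nsqL2E; exact: H1.
  apply: le_trans (nsqB_le ipL2 (toL2 q2) (toL2 (at2 (N0 `|` N1)%fset)) (toL2 q'2)) _.
  by move: (nsq _ _) A (nsq _ _) B => a A b B; lra.
move=> /nsqL2_eq0 ae0; apply: (ae_imp ae0) => x.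
by rewrite L2valD L2valN /= => /eqP; rewrite subr_eq0 => /eqP.
Qed.

End FrameAnalysis.

(** * The frame operator as a multiplication on fibres *)

Section FrameOperator.
Context {R : realType}.
Local Notation C := R[i].
Local Notation mu := (@lebesgue_measure R).
Variables (h t0 : R).
Hypothesis h_gt0 : 0 < h.
Hypothesis t0_gt0 : 0 < t0.
Hypothesis ht0 : h * t0 = 2 * pi.
Variables (phi P : 'I_3 -> R -> C) (M : R).
Hypothesis phiP : forall l, is_fourier (phi l) (P l).
Hypothesis PM : forall l x, cabs (P l x) <= M.
Hypothesis Ps : forall l, supported h (P l).
Variables (f g : R -> C).
Hypothesis fg : is_fourier f g.
Hypothesis gs : supported h g.

Local Notation win := (window 2).

(** The transform of the frame operator applied to [f]. The factor [h] appears because the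
    exponentials on one period have squared norm [h]: summing coefficients times exponentials gives
    [h] times the function. *)
Definition frameFT (xi : R) : C := \sum_(l < 3) \sum_(m <- win)
  P l xi * (h%:C * per h (prodJ g (P l)) (xi - m%:~R * h)).

Let X l : @L2fun R := per2 h_gt0 fg (phiP l) (PM l).

Lemma P_L2 l : L2 (P l). Proof. by have [_ []] := phiP l. Qed.

Lemma sqnormL2M_le (p q : R -> C) : cmeasurable p -> cmeasurable q ->
  (forall x, cabs (p x) <= M) ->
  (sqnormL2 (fun x => (p x * q x)%R) <= (M ^+ 2)%:E * sqnormL2 q)%E.
Proof.
move=> mp mq pM.
have Zl : (\int[mu]_x ((M ^+ 2)%:E * (cabs (q x) ^+ 2)%:E) =
    (M ^+ 2)%:E * \int[mu]_x (cabs (q x) ^+ 2)%:E)%E.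
  apply: ge0_integralZl => //; first exact: emeasurable_cabs2.
    by move=> x _; rewrite lee_fin sqr_ge0.
  by rewrite lee_fin sqr_ge0.
rewrite /sqnormL2 -Zl; apply: ge0_le_integral => //.
- by move=> x _; rewrite lee_fin sqr_ge0.
- by apply: emeasurable_cabs2; exact: cmeasurableM.
- by apply: emeasurable_funM; [exact: measurable_cst|exact: emeasurable_cabs2].
move=> x _; rewrite -EFinM lee_fin ComplexField.Normc.normcM exprMn.
rewrite ler_wpM2r ?sqr_ge0 // ler_sqr ?nnegrE ?cabs_ge0 //.
exact: le_trans (cabs_ge0 (p x)) (pM x).
Qed.

Lemma L2_shift_prod l (q : R -> C) a : L2 q -> L2 (fun xi => P l xi * q (xi - a)).
Proof.
move=> q2; apply: (@L2M_bounded _ M) => //; first by case: (P_L2 l).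
exact: (L2_translate (- a) q2).
Qed.

Lemma L2_frameFT : L2 frameFT.
Proof.
apply: L2_sum => l; apply: L2_sum => m.
apply: (@L2_shift_prod l (fun x => h%:C * per h (prodJ g (P l)) x)).
by apply: L2Z; exact: (L2val_L2 (X l)).
Qed.

Lemma cis_shift (n m : int) x :
  expo t0 n (x - m%:~R * h) = expo t0 n x :> C.
Proof.
rewrite /expo; have := cis_period ht0 n (- m) x.
by rewrite rmorphN /= mulNr.
Qed.

(** The characters are h-periodic and [P l] is cut into cells, so the remainder of a partial sum of
    the frame operator consists of shifted remainders of ordinary Fourier series, multiplied by
    [P l]. *)
Lemma frameFT_partial (N : seq int) (xi : R) :
  frameFT xi - \sum_(l < 3) \sum_(n <- N)
    innerL2 f (atom phi t0 l n) * (cis (n%:~R * t0 * xi) * P l xi) =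
  \sum_(l < 3) \sum_(m <- win) P l xi *
    (h%:C * L2val (X l - fourier_sum ipL2 (expo2 h t0) h (X l) N) (xi - m%:~R * h)).
Proof.
rewrite /frameFT -sumrB; apply: eq_bigr => l _.
pose c n : C := ipL2 (X l) (expo2 h t0 n).
have cE n : innerL2 f (atom phi t0 l n) = c n by exact: frame_coef.
under [X in _ - X]eq_bigr do rewrite cE.
have TE y : h%:C * L2val (fourier_sum ipL2 (expo2 h t0) h (X l) N) y =
    stepf h y * \sum_(n <- N) c n * expo t0 n y.
  rewrite /fourier_sum L2val_sum !mulr_sumr; apply: eq_bigr => n _.
  rewrite L2valZ /= /expoh -/(c n) !mulrA -rmorphM /= mulfV ?gt_eqF // mul1r.
  by rewrite [stepf h y * _]mulrC.
have -> : \sum_(n <- N) c n * (cis (n%:~R * t0 * xi) * P l xi) =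
    \sum_(m <- win) P l xi * (stepf h (xi - m%:~R * h) *
      \sum_(n <- N) c n * expo t0 n (xi - m%:~R * h)).
  transitivity ((\sum_(n <- N) c n * expo t0 n xi) * P l xi).
    by rewrite mulr_suml; apply: eq_bigr => n _; rewrite mulrA.
  rewrite {1}(supportedE h_gt0 xi (Ps l)) mulr_sumr; apply: eq_bigr => m _.
  have -> : \sum_(n <- N) c n * expo t0 n (xi - m%:~R * h) =
      \sum_(n <- N) c n * expo t0 n xi by apply: eq_bigr => n _; rewrite cis_shift.
  by ring.
rewrite -sumrB; apply: eq_bigr => m _.
by rewrite -TE -mulrBr -mulrBr L2valD L2valN.
Qed.

Lemma frame_operator_fourier q : is_fourier q frameFT -> frame_operator phi t0 f q.
Proof.
move=> qF; have [q2 _] := qF; split=> // e e0.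
(* Each summand is [P l], bounded by [M], times [h], times a shifted remainder; squaring gives [c0].
   [W] then adds up the finitely many summands through [nsq_sum_le]. *)
pose c0 := M ^+ 2 * h ^+ 2.
have c00 : 0 <= c0 by rewrite mulr_ge0 ?sqr_ge0.
pose W : R := 2 ^+ size (index_enum 'I_3) * \sum_(l < 3) (2 ^+ size win * \sum_(m <- win) c0).
have W0 : 0 <= W.
  rewrite mulr_ge0 ?exprn_ge0 // sumr_ge0 // => l _.
  by rewrite mulr_ge0 ?exprn_ge0 // sumr_ge0.
pose d := e / (W + 1).
have W1 : 0 < W + 1 by lra.
have d0 : 0 < d by rewrite divr_gt0.
have [N0 HN0] : {N0 : 'I_3 -> seq int & forall l N, uniq N -> {subset N0 l <= N} ->
    nsq ipL2 (X l - fourier_sum ipL2 (expo2 h t0) h (X l) N) < d}.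
  apply: (choice (P := fun l N0 => forall N, uniq N -> {subset N0 <= N} ->
    nsq ipL2 (X l - fourier_sum ipL2 (expo2 h t0) h (X l) N) < d)) => l.
  exact: (fourier_series h_gt0 t0_gt0 ht0 (L2_per h_gt0 (L2_prodJ fg (phiP l) (PM l)))
    (stepf_per h_gt0 (prodJ g (P l))) d0).
(* The union over the three generators of the index sets beyond which the corresponding Fourier
   series is accurate. *)
exists [fset n in flatten [seq N0 l | l <- index_enum 'I_3]]%fset => N sN.
have sl l : {subset N0 l <= enum_fset N}.
  move=> n nl; apply: (fsubsetP sN); rewrite inE; apply/flatten_mapP.
  by exists l => //; rewrite mem_index_enum.
pose T l := X l - fourier_sum ipL2 (expo2 h t0) h (X l) (enum_fset N).
have Tl l : nsq ipL2 (T l) < d by apply: HN0 => //; exact: fset_uniq.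
have Z2 l (m : int) : L2 (fun xi => P l xi * (h%:C * L2val (T l) (xi - m%:~R * h))).
  apply: (@L2_shift_prod l (fun x => h%:C * L2val (T l) x)).
  by apply: L2Z; exact: L2val_L2.
have Zn l m : nsq ipL2 (toL2 (Z2 l m)) <= c0 * d.
  rewrite -lee_fin nsqL2E.
  have t2 : L2 (translate (- (m%:~R * h)) (L2val (T l))).
    by apply: L2_translate; exact: L2val_L2.
  apply: le_trans (sqnormL2M_le _ _ (PM l)) _.
  - by case: (P_L2 l).
  - by apply: cmeasurableZ; case: t2.
  have -> : sqnormL2 (fun x => h%:C * L2val (T l) (x - m%:~R * h)) =
      ((h ^+ 2) * nsq ipL2 (T l))%:E.
    have -> : h ^+ 2 * nsq ipL2 (T l) = nsq ipL2 (h%:C *: toL2 t2).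
      rewrite nsqZ cabs2E /= expr0n addr0; congr (_ * _); apply: EFin_inj.
      by rewrite !nsqL2E /= sqnormL2_translate //; case: (L2val_L2 (T l)).
    by rewrite nsqL2E.
  rewrite -EFinM lee_fin /c0 -mulrA ler_wpM2l ?sqr_ge0 // ler_wpM2l ?sqr_ge0 //.
  exact: ltW.
have at_F l n : is_fourier (fun x => innerL2 f (atom phi t0 l n) * atom phi t0 l n x)
    (fun xi => innerL2 f (atom phi t0 l n) * (cis (n%:~R * t0 * xi) * P l xi)).
  by apply: is_fourierZ; exact: is_fourier_translate.
have := is_fourierB qF (is_fourier_sum (index_enum 'I_3) (fun l =>
  is_fourier_sum (enum_fset N) (at_F l))).
move=> /is_fourier_norm ->.
have -> : sqnormL2 (fun x => frameFT x - \sum_(l < 3) \sum_(n <- enum_fset N)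
    innerL2 f (atom phi t0 l n) * (cis (n%:~R * t0 * x) * P l x)) =
   (nsq ipL2 (\sum_(l < 3) \sum_(m <- win) toL2 (Z2 l m)))%:E.
  rewrite nsqL2E; congr sqnormL2; apply/funext => xi.
  rewrite frameFT_partial L2val_sum; apply: eq_bigr => l _.
  by rewrite L2val_sum.
rewrite lte_fin; apply: le_lt_trans (nsq_sum_le _ _ _) _.
apply: (@le_lt_trans _ _ (W * d)); last first.
  by rewrite /d mulrA ltr_pdivrMr // mulrC ltr_pM2l // ltrDl.
rewrite /W -mulrA ler_wpM2l ?exprn_ge0 // mulr_suml; apply: ler_sum => l _.
apply: le_trans (nsq_sum_le _ _ _) _.
rewrite -mulrA ler_wpM2l ?exprn_ge0 // mulr_suml; apply: ler_sum => m _.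
exact: Zn.
Qed.

End FrameOperator.

(** * Cross products and dual vectors *)

Section DualAlgebra.
Context {R : realType}.
Local Notation C := R[i].
Local Notation vec := ('I_3 -> C).
Implicit Types (a b c u v w : 'I_3 -> R[i]).

Lemma sum3 (F : 'I_3 -> C) : \sum_(j < 3) F j = F 0 + F 1 + F 2%:R.
Proof.
rewrite !big_ord_recl big_ord0 addr0 addrA.
by congr (F _ + F _ + F _); apply: val_inj.
Qed.

Lemma ord3P (j : 'I_3) : [\/ j = 0, j = 1 | j = 2%:R].
Proof.
case: j => [[|[|[|//]]] hj]; [apply: Or31|apply: Or32|apply: Or33]; exact: val_inj.
Qed.

Definition dotc u v : C := \sum_(j < 3) u j * conjc (v j).
Definition crossc u v : vec := fun j => u (j + 1) * v (j + 2%:R) - u (j + 2%:R) * v (j + 1).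
Definition conjv u : vec := fun j => conjc (u j).
Definition det3 u v w : C := \sum_(j < 3) u j * crossc v w j.
Definition gram2 a b : C := dotc a a * dotc b b - dotc a b * dotc b a.

Lemma crossc0 u v : crossc u v 0 = u 1 * v 2%:R - u 2%:R * v 1.
Proof. by rewrite /crossc !add0r. Qed.
Lemma crossc1 u v : crossc u v 1 = u 2%:R * v 0 - u 0 * v 2%:R.
Proof.
rewrite /crossc; have -> : (1 + 1 : 'I_3) = 2%:R by exact: val_inj.
by have -> : (1 + 2%:R : 'I_3) = 0 by exact: val_inj.
Qed.
Lemma crossc2 u v : crossc u v 2%:R = u 0 * v 1 - u 1 * v 0.
Proof.
rewrite /crossc; have -> : (2%:R + 1 : 'I_3) = 0 by exact: val_inj.
by have -> : (2%:R + 2%:R : 'I_3) = 1 by exact: val_inj.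
Qed.

Definition croscE := (crossc0, crossc1, crossc2).

Lemma det3_cycle a b c : det3 b c a = det3 a b c.
Proof. by rewrite /det3 !sum3 !croscE; ring. Qed.

Lemma conjc_det3 a b c : conjc (det3 a b c) = det3 (conjv a) (conjv b) (conjv c).
Proof.
by rewrite /det3 !sum3 !croscE /conjv !(conjcD, conjcN, conjcM).
Qed.

Lemma gram2C a b : gram2 b a = gram2 a b.
Proof. by rewrite /gram2 mulrC [dotc b a * _]mulrC. Qed.

Variable h : R.
Hypothesis h_gt0 : 0 < h.

(** Up to the factor 1/h, the member of the dual basis attached to [a]: it pairs to 0 with the
    conjugates of [b] and [c]. The other two members arise by cyclic permutation. *)
Definition dual3 a b c : vec := fun j =>
  (h%:C * conjc (det3 a b c))^-1 * crossc (conjv b) (conjv c) j.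

(** The analogue in the plane spanned by [a] and [b]: the vector of this plane orthogonal to [b] and
    normalised against [a], that is, a column of the pseudo-inverse. *)
Definition dual2 a b : vec := fun j =>
  (h%:C * gram2 a b)^-1 * (dotc b b * a j - dotc a b * b j).

Lemma h_neq0 : h%:C != 0 :> C.
Proof. by rewrite eq_complex /= eqxx andbT gt_eqF. Qed.

Lemma dual3_left a b c (x y z : C) : det3 a b c != 0 ->
  h%:C * \sum_(l < 3) dual3 a b c l * (x * conjc (a l) + y * conjc (b l) + z * conjc (c l)) = x.
Proof.
move=> d0; have hn := h_neq0.
have e0 : conjc (det3 a b c) != 0 by rewrite conjc_eq0.
transitivity (h%:C * (h%:C * conjc (det3 a b c))^-1 * (x * conjc (det3 a b c))).
  rewrite -[RHS]mulrA; congr (_ * _); rewrite sum3 /dual3.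
  move: (_^-1) => k; rewrite conjc_det3 /det3 sum3 !croscE /conjv; ring.
by move: (conjc _) e0 => e e0; field; rewrite hn e0.
Qed.

(** For square matrices a left inverse is also a right inverse; here this is checked entry by entry
    as a polynomial identity after clearing the determinant. *)
Lemma dual3_right a b c (j l : 'I_3) : det3 a b c != 0 ->
  h%:C * (dual3 a b c j * conjc (a l) + dual3 b c a j * conjc (b l) +
    dual3 c a b j * conjc (c l)) = (j == l)%:R.
Proof.
move=> d0; have hn := h_neq0.
have e0 : conjc (det3 a b c) != 0 by rewrite conjc_eq0.
rewrite /dual3 (det3_cycle a b c) -(det3_cycle c a b).
have -> : h%:C * ((h%:C * conjc (det3 a b c))^-1 * crossc (conjv b) (conjv c) j * conjc (a l) +
    (h%:C * conjc (det3 a b c))^-1 * crossc (conjv c) (conjv a) j * conjc (b l) +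
    (h%:C * conjc (det3 a b c))^-1 * crossc (conjv a) (conjv b) j * conjc (c l)) =
  (conjc (det3 a b c))^-1 * (crossc (conjv b) (conjv c) j * conjc (a l) +
     crossc (conjv c) (conjv a) j * conjc (b l) + crossc (conjv a) (conjv b) j * conjc (c l)).
  move: (conjc (det3 a b c)) e0 => e e0.
  by field; rewrite hn e0.
apply: (mulfI e0); rewrite mulrA mulfV // mul1r conjc_det3 /det3 sum3.
by case: (ord3P j) => ->; case: (ord3P l) => ->; rewrite !croscE /conjv /=; ring.
Qed.

Lemma dual3_reproduce a b c u (j : 'I_3) : det3 a b c != 0 ->
  h%:C * \sum_(l < 3) u l * (dual3 a b c j * conjc (a l) + dual3 b c a j * conjc (b l) +
    dual3 c a b j * conjc (c l)) = u j.
Proof.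
move=> d0; rewrite mulr_sumr (bigD1 j) //= big1 ?addr0 => [|l /negbTE lj].
  by rewrite mulrCA dual3_right // eqxx mulr1.
by rewrite mulrCA dual3_right // eq_sym lj mulr0.
Qed.

Lemma dual2_left a b (x y : C) : gram2 a b != 0 ->
  h%:C * \sum_(l < 3) dual2 a b l * (x * conjc (a l) + y * conjc (b l)) = x.
Proof.
move=> g0; have hn := h_neq0.
transitivity (h%:C * (h%:C * gram2 a b)^-1 * (x * gram2 a b)).
  rewrite -[RHS]mulrA; congr (_ * _); rewrite sum3 /dual2.
  move: (_^-1) => k; rewrite /gram2 /dotc !sum3; ring.
by move: (gram2 a b) g0 => e e0; field; rewrite hn e0.
Qed.

(** Two vectors do not span the space, and the composite is the orthogonal projection onto their
    span. So, unlike [dual3_reproduce], this is stated for a vector of the span, and exchanging [a]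
    and [b] gives the other one. *)
Lemma dual2_reproduce a b (j : 'I_3) : gram2 a b != 0 ->
  h%:C * \sum_(l < 3) a l * (dual2 a b j * conjc (a l) + dual2 b a j * conjc (b l)) = a j.
Proof.
move=> g0; have hn := h_neq0.
transitivity (h%:C * (h%:C * gram2 a b)^-1 * (a j * gram2 a b)).
  rewrite -[RHS]mulrA; congr (_ * _); rewrite sum3 /dual2 (gram2C a b).
  move: (_^-1) => k; rewrite /gram2 /dotc !sum3; ring.
by move: (gram2 a b) g0 => e e0; field; rewrite hn e0.
Qed.

End DualAlgebra.

(** * The dual functions and their fibre identities *)

Section DualFunctions.
Context {R : realType}.
Local Notation C := R[i].
Variables (omega h kappa : R) (P : 'I_3 -> R -> C).
Hypothesis h_gt0 : 0 < h.
Hypothesis kappa_gt0 : 0 < kappa.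
Hypothesis h_ge : 2 / 3 * omega <= h.
Hypothesis h_lt : h < omega.
Hypothesis P0 : forall l (x : R), ~~ (- omega < x < omega) -> P l x = 0.

Local Notation win := (window 2).

Lemma window2 : win = [:: -2; -1; 0; 1].
Proof. by []. Qed.

Lemma sum_win (F : int -> C) : \sum_(k <- win) F k = F (-2) + F (-1) + F 0 + F 1.
Proof. by rewrite window2 !big_cons big_nil addr0 !addrA. Qed.

Lemma shiftm2 x : x + (-2)%:~R * h = x - 2 * h. Proof. by rewrite mulrNz mulNr. Qed.
Lemma shiftm1 x : x + (-1)%:~R * h = x - h. Proof. by rewrite mulrNz mulNr mul1r. Qed.
Lemma shift0 x : x + 0%:~R * h = x. Proof. by rewrite mul0r addr0. Qed.
Lemma shift1 x : x + 1%:~R * h = x + h. Proof. by rewrite mul1r. Qed.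
Definition shiftE := (shiftm2, shiftm1, shift0, shift1).

Definition itvC (a b x : R) : C := (\1_`]a, b[ x)%:C.

Lemma itvC_in (a b x : R) : a < x -> x < b -> itvC a b x = 1.
Proof. by move=> ax xb; rewrite /itvC indicE mem_setE in_itv /= ax xb. Qed.
Lemma itvC_le (a b x : R) : x <= a -> itvC a b x = 0.
Proof. by move=> xa; rewrite /itvC indicE mem_setE in_itv /= ltNge xa. Qed.
Lemma itvC_ge (a b x : R) : b <= x -> itvC a b x = 0.
Proof. by move=> bx; rewrite /itvC indicE mem_setE in_itv /= [x < b]ltNge bx andbF. Qed.

Definition pv (x : R) : 'I_3 -> C := fun l => P l x.

(** In each piece the first argument is the value at [x] itself. The order in the three-vector
    pieces is a cyclic permutation of the order by increasing argument, so all shifts of a point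
    share one determinant. Breakpoints receive the value 0. *)
Definition Psi (j : 'I_3) (x : R) : C :=
  itvC (- omega) (omega - 2 * h) x * dual3 h (pv x) (pv (x + h)) (pv (x + 2 * h)) j +
  itvC (omega - 2 * h) (h - omega) x * dual2 h (pv x) (pv (x + h)) j +
  itvC (h - omega) (omega - h) x * dual3 h (pv x) (pv (x + h)) (pv (x - h)) j +
  itvC (omega - h) (2 * h - omega) x * dual2 h (pv x) (pv (x - h)) j +
  itvC (2 * h - omega) omega x * dual3 h (pv x) (pv (x - 2 * h)) (pv (x - h)) j.

Lemma Psi1 j (x : R) : - omega < x -> x < omega - 2 * h ->
  Psi j x = dual3 h (pv x) (pv (x + h)) (pv (x + 2 * h)) j.
Proof.
move=> x1 x2; have hg := h_ge; have hl := h_lt.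
have y2 : x <= omega - 2 * h by lra.
have y3 : x <= h - omega by lra.
have y4 : x <= omega - h by lra.
have y5 : x <= 2 * h - omega by lra.
rewrite /Psi (itvC_in x1 x2) (itvC_le _ y2) (itvC_le _ y3) (itvC_le _ y4) (itvC_le _ y5).
by rewrite mul1r !mul0r !addr0.
Qed.

Lemma Psi2 j (x : R) : omega - 2 * h < x -> x < h - omega ->
  Psi j x = dual2 h (pv x) (pv (x + h)) j.
Proof.
move=> x1 x2; have hg := h_ge; have hl := h_lt.
have y3 : x <= h - omega by lra.
have y4 : x <= omega - h by lra.
have y5 : x <= 2 * h - omega by lra.
rewrite /Psi (itvC_ge _ (ltW x1)) (itvC_in x1 x2) (itvC_le _ y3) (itvC_le _ y4) (itvC_le _ y5).
by rewrite mul1r !mul0r !addr0 add0r.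
Qed.

Lemma Psi3 j (x : R) : h - omega < x -> x < omega - h ->
  Psi j x = dual3 h (pv x) (pv (x + h)) (pv (x - h)) j.
Proof.
move=> x1 x2; have hg := h_ge; have hl := h_lt.
have y1 : omega - 2 * h <= x by lra.
have y4 : x <= omega - h by lra.
have y5 : x <= 2 * h - omega by lra.
rewrite /Psi (itvC_ge _ y1) (itvC_ge _ (ltW x1)) (itvC_in x1 x2) (itvC_le _ y4) (itvC_le _ y5).
by rewrite mul1r !mul0r !addr0 !add0r.
Qed.

Lemma Psi4 j (x : R) : omega - h < x -> x < 2 * h - omega ->
  Psi j x = dual2 h (pv x) (pv (x - h)) j.
Proof.
move=> x1 x2; have hg := h_ge; have hl := h_lt.
have y1 : omega - 2 * h <= x by lra.
have y2 : h - omega <= x by lra.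
have y5 : x <= 2 * h - omega by lra.
rewrite /Psi (itvC_ge _ y1) (itvC_ge _ y2) (itvC_ge _ (ltW x1)) (itvC_in x1 x2) (itvC_le _ y5).
by rewrite mul1r !mul0r !addr0 !add0r.
Qed.

Lemma Psi5 j (x : R) : 2 * h - omega < x -> x < omega ->
  Psi j x = dual3 h (pv x) (pv (x - 2 * h)) (pv (x - h)) j.
Proof.
move=> x1 x2; have hg := h_ge; have hl := h_lt.
have y1 : omega - 2 * h <= x by lra.
have y2 : h - omega <= x by lra.
have y3 : omega - h <= x by lra.
rewrite /Psi (itvC_ge _ y1) (itvC_ge _ y2) (itvC_ge _ y3) (itvC_ge _ (ltW x1)) (itvC_in x1 x2).
by rewrite mul1r !mul0r !add0r.
Qed.

Lemma Psi_out j (x : R) : ~~ (- omega < x < omega) -> Psi j x = 0.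
Proof.
have hg := h_ge; have hl := h_lt; have h0 := h_gt0.
rewrite negb_and -!leNgt => /orP[xo|xo].
  have y2 : x <= omega - 2 * h by lra.
  have y3 : x <= h - omega by lra.
  have y4 : x <= omega - h by lra.
  have y5 : x <= 2 * h - omega by lra.
  rewrite /Psi (itvC_le _ xo) (itvC_le _ y2) (itvC_le _ y3) (itvC_le _ y4) (itvC_le _ y5).
  by rewrite !mul0r !addr0.
have y1 : omega - 2 * h <= x by lra.
have y2 : h - omega <= x by lra.
have y3 : omega - h <= x by lra.
have y4 : 2 * h - omega <= x by lra.
rewrite /Psi (itvC_ge _ y1) (itvC_ge _ y2) (itvC_ge _ y3) (itvC_ge _ y4) (itvC_ge _ xo).
by rewrite !mul0r !addr0.
Qed.

(** Nonvanishing determinants would be enough for the algebra; the uniform constant [kappa] is what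
    later bounds [Psi]. *)
Definition regular_point (x : R) : Prop :=
  [\/ [/\ 0 < x, x < omega - h & kappa <= cabs (det3 (pv (x - h)) (pv x) (pv (x + h)))],
      [/\ omega - h < x, x < 2 * h - omega & kappa <= cabs (gram2 (pv (x - h)) (pv x))] |
      [/\ 2 * h - omega < x, x < h &
          kappa <= cabs (det3 (pv (x - 2 * h)) (pv (x - h)) (pv x))]].

Lemma lower_neq0 (z : C) : kappa <= cabs z -> z != 0.
Proof.
by move=> kz; apply: contraTneq kz => ->; rewrite ComplexField.Normc.normc0 -ltNge.
Qed.

(** For [v] the fibre of a function g, this is the value at [x] of the periodisation of g times the
    conjugate of [P l]. *)
Definition analysis (v : int -> C) (x : R) (l : 'I_3) : C :=
  \sum_(k <- win) v k * conjc (P l (x + k%:~R * h)).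

Lemma out_lt (x : R) : x <= - omega -> ~~ (- omega < x < omega).
Proof. by move=> xo; rewrite negb_and -!leNgt xo. Qed.
Lemma out_gt (x : R) : omega <= x -> ~~ (- omega < x < omega).
Proof. by move=> xo; rewrite negb_and -!leNgt xo orbT. Qed.

Lemma analysisE v x l : analysis v x l =
  v (-2) * conjc (pv (x - 2 * h) l) + v (-1) * conjc (pv (x - h) l) +
  v 0 * conjc (pv x l) + v 1 * conjc (pv (x + h) l).
Proof. by rewrite /analysis sum_win !shiftE. Qed.

(* The values at x + k h of the five pieces of Psi, for the three kinds of x. *)
Lemma regular_pointP (x : R) : regular_point x ->
  [\/ [/\ ~~ (- omega < x - 2 * h < omega),
         kappa <= cabs (det3 (pv (x - h)) (pv x) (pv (x + h))),
         Psi^~ (x - h) =1 dual3 h (pv (x - h)) (pv x) (pv (x + h)),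
         Psi^~ x =1 dual3 h (pv x) (pv (x + h)) (pv (x - h)) &
         Psi^~ (x + h) =1 dual3 h (pv (x + h)) (pv (x - h)) (pv x)],
      [/\ ~~ (- omega < x - 2 * h < omega), ~~ (- omega < x + h < omega),
         kappa <= cabs (gram2 (pv (x - h)) (pv x)),
         Psi^~ (x - h) =1 dual2 h (pv (x - h)) (pv x) &
         Psi^~ x =1 dual2 h (pv x) (pv (x - h))] |
      [/\ ~~ (- omega < x + h < omega),
         kappa <= cabs (det3 (pv (x - 2 * h)) (pv (x - h)) (pv x)),
         Psi^~ (x - 2 * h) =1 dual3 h (pv (x - 2 * h)) (pv (x - h)) (pv x),
         Psi^~ (x - h) =1 dual3 h (pv (x - h)) (pv x) (pv (x - 2 * h)) &
         Psi^~ x =1 dual3 h (pv x) (pv (x - 2 * h)) (pv (x - h))]].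
Proof.
have hg := h_ge; have hl := h_lt; have h0 := h_gt0.
have e1 : x - h + h = x by ring.
have e2 : x - h + 2 * h = x + h by ring.
have e3 : x + h - 2 * h = x - h by ring.
have e4 : x + h - h = x by ring.
have e5 : x - 2 * h + h = x - h by ring.
have e6 : x - 2 * h + 2 * h = x by ring.
have e7 : x - h - h = x - 2 * h by ring.
move=> [[x1 x2 d0]|[x1 x2 d0]|[x1 x2 d0]]; [apply: Or31|apply: Or32|apply: Or33]; split => //.
- by apply: out_lt; lra.
- by move=> j; rewrite Psi1 ?e1 ?e2 //; lra.
- by move=> j; rewrite Psi3 //; lra.
- by move=> j; rewrite Psi5 ?e3 ?e4 //; lra.
- by apply: out_lt; lra.
- by apply: out_gt; lra.
- by move=> j; rewrite Psi2 ?e1 //; lra.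
- by move=> j; rewrite Psi4 //; lra.
- by apply: out_gt; lra.
- by move=> j; rewrite Psi1 ?e5 ?e6 //; lra.
- by move=> j; rewrite Psi3 ?e1 ?e7 //; lra.
- by move=> j; rewrite Psi5 //; lra.
Qed.

(** Entries of [v] outside the band vanish, which leaves three or two unknowns. Each is recovered by
    the dual vector whose first argument is its own row, after a cyclic reordering. *)
Lemma dual_analysis (v : int -> C) (x : R) (k : int) : regular_point x ->
  (forall k : int, ~~ (- omega < x + k%:~R * h < omega) -> v k = 0) -> k \in win ->
  h%:C * \sum_(l < 3) Psi l (x + k%:~R * h) * analysis v x l = v k.
Proof.
move=> reg v0 kw.
have vm2 : ~~ (- omega < x - 2 * h < omega) -> v (-2) = 0.
  by move=> h1; apply: v0; rewrite shiftm2.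
have v1 : ~~ (- omega < x + h < omega) -> v 1 = 0.
  by move=> h1; apply: v0; rewrite shift1.
have zero (k' : int) y : ~~ (- omega < y < omega) -> v k' = 0 ->
    h%:C * \sum_(l < 3) Psi l y * analysis v x l = v k'.
  move=> yo ->; rewrite big1 ?mulr0 // => l _.
  by rewrite Psi_out // mul0r.
move: kw; rewrite window2 !inE; case: (regular_pointP reg).
- move=> [n2 /lower_neq0 d0 p1 p2 p3].
  case/or4P => /eqP ->; rewrite ?shiftE; first exact: zero n2 (vm2 n2).
  + apply: etrans (dual3_left h_gt0 (v (-1)) (v 0) (v 1) d0).
    congr (_ * _); apply: eq_bigr => l _; rewrite p1 analysisE (vm2 n2).
    by congr (_ * _); ring.
  + have d1 : det3 (pv x) (pv (x + h)) (pv (x - h)) != 0 by rewrite det3_cycle.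
    apply: etrans (dual3_left h_gt0 (v 0) (v 1) (v (-1)) d1).
    congr (_ * _); apply: eq_bigr => l _; rewrite p2 analysisE (vm2 n2).
    by congr (_ * _); ring.
  + have d1 : det3 (pv (x + h)) (pv (x - h)) (pv x) != 0 by rewrite -det3_cycle.
    apply: etrans (dual3_left h_gt0 (v 1) (v (-1)) (v 0) d1).
    congr (_ * _); apply: eq_bigr => l _; rewrite p3 analysisE (vm2 n2).
    by congr (_ * _); ring.
- move=> [n2 n1 /lower_neq0 g0 p1 p2].
  case/or4P => /eqP ->; rewrite ?shiftE; [exact: zero n2 (vm2 n2)| | |exact: zero n1 (v1 n1)].
  + apply: etrans (dual2_left h_gt0 (v (-1)) (v 0) g0).
    congr (_ * _); apply: eq_bigr => l _; rewrite p1 analysisE (vm2 n2) (v1 n1).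
    by congr (_ * _); ring.
  + have g1 : gram2 (pv x) (pv (x - h)) != 0 by rewrite gram2C.
    apply: etrans (dual2_left h_gt0 (v 0) (v (-1)) g1).
    congr (_ * _); apply: eq_bigr => l _; rewrite p2 analysisE (vm2 n2) (v1 n1).
    by congr (_ * _); ring.
- move=> [n1 /lower_neq0 d0 p1 p2 p3].
  case/or4P => /eqP ->; rewrite ?shiftE; last exact: zero n1 (v1 n1).
  + apply: etrans (dual3_left h_gt0 (v (-2)) (v (-1)) (v 0) d0).
    congr (_ * _); apply: eq_bigr => l _; rewrite p1 analysisE (v1 n1).
    by congr (_ * _); ring.
  + have d1 : det3 (pv (x - h)) (pv x) (pv (x - 2 * h)) != 0 by rewrite det3_cycle.
    apply: etrans (dual3_left h_gt0 (v (-1)) (v 0) (v (-2)) d1).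
    congr (_ * _); apply: eq_bigr => l _; rewrite p2 analysisE (v1 n1).
    by congr (_ * _); ring.
  + have d1 : det3 (pv x) (pv (x - 2 * h)) (pv (x - h)) != 0 by rewrite -det3_cycle.
    apply: etrans (dual3_left h_gt0 (v 0) (v (-2)) (v (-1)) d1).
    congr (_ * _); apply: eq_bigr => l _; rewrite p3 analysisE (v1 n1).
    by congr (_ * _); ring.
Qed.

(** For three rows any vector is reproduced. For two rows only their span is, and the vectors met
    here, the values of [P] on the fibre, either are the rows or vanish. *)
Lemma dual_synthesis (x : R) (m : int) (j : 'I_3) : regular_point x -> m \in win ->
  h%:C * \sum_(l < 3) P l (x + m%:~R * h) *
    analysis (fun k => Psi j (x + k%:~R * h)) x l = P j (x + m%:~R * h).
Proof.
move=> reg mw.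
have zero y (F : 'I_3 -> C) : ~~ (- omega < y < omega) ->
    h%:C * \sum_(l < 3) P l y * F l = P j y.
  move=> yo; rewrite P0 // big1 ?mulr0 // => l _.
  by rewrite P0 // mul0r.
have AE l : analysis (fun k => Psi j (x + k%:~R * h)) x l =
  Psi j (x - 2 * h) * conjc (pv (x - 2 * h) l) + Psi j (x - h) * conjc (pv (x - h) l) +
  Psi j x * conjc (pv x l) + Psi j (x + h) * conjc (pv (x + h) l).
  by rewrite analysisE !shiftE.
move: mw; rewrite window2 !inE; case: (regular_pointP reg).
- move=> [n2 /lower_neq0 d0 p1 p2 p3].
  have E y : h%:C * \sum_(l < 3) P l y * analysis (fun k => Psi j (x + k%:~R * h)) x l = P j y.
    apply: etrans (dual3_reproduce h_gt0 (pv y) j d0).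
    congr (_ * _); apply: eq_bigr => l _; rewrite AE (Psi_out j n2) p1 p2 p3.
    by rewrite /pv; congr (_ * _); ring.
  by move=> _; exact: E.
- move=> [n2 n1 /lower_neq0 g0 p1 p2].
  case/or4P => /eqP ->; rewrite ?shiftE; [exact: zero| | |exact: zero].
  + apply: etrans (dual2_reproduce h_gt0 j g0).
    congr (_ * _); apply: eq_bigr => l _.
    rewrite AE (Psi_out j n2) (Psi_out j n1) p1 p2.
    by rewrite /pv; congr (_ * _); ring.
  + have g1 : gram2 (pv x) (pv (x - h)) != 0 by rewrite gram2C.
    apply: etrans (dual2_reproduce h_gt0 j g1).
    congr (_ * _); apply: eq_bigr => l _.
    rewrite AE (Psi_out j n2) (Psi_out j n1) p1 p2.
    by rewrite /pv; congr (_ * _); ring.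
- move=> [n1 /lower_neq0 d0 p1 p2 p3].
  have E y : h%:C * \sum_(l < 3) P l y * analysis (fun k => Psi j (x + k%:~R * h)) x l = P j y.
    apply: etrans (dual3_reproduce h_gt0 (pv y) j d0).
    congr (_ * _); apply: eq_bigr => l _; rewrite AE (Psi_out j n1) p1 p2 p3.
    by rewrite /pv; congr (_ * _); ring.
  by move=> _; exact: E.
Qed.

End DualFunctions.

(** * Entries and determinants of the pre-Gramian *)

Section PreGramianMatrices.
Context {R : realType}.
Local Notation C := R[i].
Implicit Types (a b c : 'I_3 -> R[i]).

Lemma det2E (A : 'M[C]_2) : \det A = A 0 0 * A 1 1 - A 0 1 * A 1 0.
Proof.
rewrite (expand_det_row _ 0) !big_ord_recl big_ord0 addr0 /cofactor /= !det_mx11 !mxE /=.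
rewrite !expr0 expr1 mul1r mulN1r mulrN.
by congr (A _ _ * A _ _ - A _ _ * A _ _); apply: val_inj.
Qed.

Lemma det_mx3E (A : 'M[C]_3) : \det A = det3 (A 0) (A 1) (A 2%:R).
Proof.
have l00 : lift (0 : 'I_3) (0 : 'I_2) = 1 by apply: val_inj.
have l01 : lift (0 : 'I_3) (1 : 'I_2) = 2%:R by apply: val_inj.
have l10 : lift (1 : 'I_3) (0 : 'I_2) = 0 by apply: val_inj.
have l11 : lift (1 : 'I_3) (1 : 'I_2) = 2%:R by apply: val_inj.
have l20 : lift (2%:R : 'I_3) (0 : 'I_2) = 0 by apply: val_inj.
have l21 : lift (2%:R : 'I_3) (1 : 'I_2) = 1 by apply: val_inj.
rewrite (expand_det_row _ 0) /det3; apply: eq_bigr => j _; congr (_ * _).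
rewrite /cofactor det2E !mxE !(l00, l01).
case: (ord3P j) => ->; rewrite !croscE ?(l00, l01, l10, l11, l20, l21).
- by rewrite expr0 mul1r.
- by rewrite expr1 mulN1r opprB.
- by rewrite exprS expr1 mulrNN mul1r mul1r.
Qed.

Definition rowv a : 'rV[C]_3 := \row_j a j.

Lemma det_rows3 a b c : \det (rows3 (rowv a) (rowv b) (rowv c)) = det3 a b c.
Proof. by rewrite det_mx3E /det3 !sum3 !croscE !mxE. Qed.

Lemma det_scale_rows3 (k : C) a b c :
  \det (k *: rows3 (rowv a) (rowv b) (rowv c)) = k ^+ 3 * det3 a b c.
Proof. by rewrite detZ det_rows3. Qed.

Lemma det_conj_trmx n (A : 'M[C]_n) : \det (conj_trmx A) = conjc (\det A).
Proof. by rewrite /conj_trmx det_tr /conj_mx det_map_mx. Qed.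

Lemma crossmul_rowv a b : crossmul (rowv a) (rowv b) = rowv (crossc a b).
Proof. by apply/rowP => k; rewrite !mxE. Qed.

Lemma conj_mx_rowv a : conj_mx (rowv a) = rowv (conjv a).
Proof. by apply/rowP => k; rewrite !mxE. Qed.

(** Lagrange's identity: the Gram determinant of two vectors is the sum of the squared moduli of
    their 2 x 2 minors. *)
Lemma gram2E a b : gram2 a b =
  (cabs (a 0 * b 1 - a 1 * b 0) ^+ 2 + cabs (a 0 * b 2%:R - a 2%:R * b 0) ^+ 2 +
   cabs (a 1 * b 2%:R - a 2%:R * b 1) ^+ 2)%:C.
Proof.
rewrite !rmorphD /= !cabs2J !(conjcD, conjcN, conjcM) /gram2 /dotc !sum3; ring.
Qed.

Lemma det_mulmx_conj_trmx (k : R) a b (m : 'rV[C]_3) :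
  let A := row' ord_max (k%:C *: rows3 (rowv a) (rowv b) m) in
  \det (A *m conj_trmx A) = (k ^+ 4)%:C * gram2 a b.
Proof.
move=> A.
have A0 l : A 0 l = k%:C * a l by rewrite !mxE.
have A1 l : A 1 l = k%:C * b l by rewrite !mxE.
have AE i j : (A *m conj_trmx A) i j = \sum_l A i l * conjc (A j l).
  rewrite mxE; apply: eq_bigr => l _.
  by rewrite [conj_trmx _ _ _]mxE [conj_mx _ _ _]mxE.
rewrite det2E !AE !sum3 !A0 !A1 !conjcM !conjc_real /gram2 /dotc !sum3 rmorphXn /=; ring.
Qed.

Lemma strictly_increasing2 p (f : {ffun 'I_2 -> 'I_p}) :
  strictly_increasing f = (f 0%R < f 1%R)%N.
Proof.
apply/forallP/idP => [/(_ (0 : 'I_2)%R)/forallP/(_ (1 : 'I_2)%R)//|f01 i]; apply/forallP => j; apply/implyP.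
case: i j => [[|[|//]] hi] [[|[|//]] hj] //= _.
by move: f01; congr (f _ < f _)%N; apply: val_inj.
Qed.

Lemma sum_strictly_increasing2 (G : 'I_3 -> 'I_3 -> R) :
  \sum_(f : {ffun 'I_2 -> 'I_3} | strictly_increasing f) G (f 0) (f 1) =
  G 0 1 + G 0 2%:R + G 1 2%:R.
Proof.
pose F (u : 'I_3 * 'I_3) : {ffun 'I_2 -> 'I_3} :=
  [ffun i : 'I_2 => if i == 0 then u.1 else u.2].
have F0 u : F u 0 = u.1 by rewrite ffunE.
have F1 u : F u 1 = u.2 by rewrite ffunE.
rewrite (reindex F) /=; last first.
  exists (fun f : {ffun 'I_2 -> 'I_3} => (f 0, f 1)) => [[x y] _|f _]; first by rewrite F0 F1.
  apply/ffunP => i; rewrite ffunE; case: eqP => [-> //|/= i0].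
  by congr (f _); apply: val_inj; case: i i0 => [[|[|//]] hi] // i0; case: i0; apply: val_inj.
under eq_bigl do rewrite strictly_increasing2 F0 F1.
under eq_bigr do rewrite F0 F1.
rewrite -(pair_big_dep xpredT (fun i j : 'I_3 => (i < j)%N) G) /=.
under eq_bigr do rewrite big_mkcond.
rewrite !big_ord_recl !big_ord0 /= !addr0 ?add0r ?addrA.
by congr (G _ _ + G _ _ + G _ _); apply: val_inj.
Qed.

(** Minors using the zero row vanish, and the others add up by [gram2E]. Each minor scales by k^2
    and is squared, whence k^4. *)
Lemma minors_sqsum_rows3 (k : R) a b :
  (minors_sqsum 2 (k%:C *: rows3 (rowv a) (rowv b) 0))%:C = (k ^+ 4)%:C * gram2 a b.
Proof.
set A := _ *: _.
have A0 l : A 0 l = k%:C * a l by rewrite !mxE.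
have A1 l : A 1 l = k%:C * b l by rewrite !mxE.
have A2 l : A 2%:R l = 0 by rewrite !mxE mulr0.
clearbody A.
pose G f0 f1 i j := cabs (A f0 i * A f1 j - A f0 j * A f1 i) ^+ 2.
have E (f g : {ffun 'I_2 -> 'I_3}) :
    cabs (\det (mxsub f g A)) ^+ 2 = G (f 0) (f 1) (g 0) (g 1).
  by rewrite det2E !mxE.
rewrite /minors_sqsum; under eq_bigr => f _ do
  rewrite (eq_bigr _ (fun g _ => E f g)) (sum_strictly_increasing2 (G (f 0) (f 1))).
rewrite (sum_strictly_increasing2 (fun f0 f1 : 'I_3 => G f0 f1 0 1 + G f0 f1 0 2%:R + G f0 f1 1 2%:R)).
have Z f0 i j : G f0 2%:R i j = 0.
  by rewrite /G !A2 !mulr0 subrr ComplexField.Normc.normc0 expr0n.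
rewrite !Z !addr0 /G !A0 !A1 gram2E -rmorphM /=; congr (_ %:C).
have H (x y z w : C) : cabs (k%:C * x * (k%:C * y) - k%:C * z * (k%:C * w)) ^+ 2 =
    k ^+ 4 * cabs (x * y - z * w) ^+ 2.
  apply: (@complexI R); rewrite [RHS]rmorphM /= !cabs2J rmorphXn /= !(conjcD, conjcN, conjcM) conjc_real.
  ring.
by rewrite !H -!mulrDr.
Qed.

End PreGramianMatrices.

(** * The pre-Gramian and the factors D and E on one period *)

Section PreGramianValues.
Context {R : realType}.
Local Notation C := R[i].
Variables (omega h t0 : R) (phi : 'I_3 -> R -> C).
Hypothesis h_def : h = 2 * pi / t0.
Hypothesis h_gt0 : 0 < h.
Hypothesis h_ge : 2 / 3 * omega <= h.
Hypothesis h_lt : h < omega.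

Local Notation J := (preGramian omega t0 phi).

Definition fv (x : R) : 'I_3 -> C := fun l => fourier (phi l) x.

Lemma preGramianD (n : int) x : J (x + n%:~R * h) = J x.
Proof.
rewrite /preGramian -h_def mulrDl mulfK ?gt_eqF // floorDrz ?intr_int // intrKfloor.
by congr preGramian0; rewrite intrD mulrDl; ring.
Qed.

Lemma preGramian_period x : 0 < x < h -> J x = preGramian0 omega t0 phi x.
Proof.
move=> /andP[x0 xh]; rewrite /preGramian -h_def (_ : Num.floor _ = 0) ?mul0r ?subr0 //.
by apply: floor_def; rewrite divr_ge0 ?ltW //= add0r ltr_pdivrMr // mul1r.
Qed.

Lemma preGramian_Km x : 0 < x -> x < omega - h ->
  J x = (Num.sqrt h)%:C *: rows3 (rowv (fv (x - h))) (rowv (fv x)) (rowv (fv (x + h))).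
Proof.
move=> x0 x1; have hg := h_ge; have hl := h_lt; have h0 := h_gt0.
rewrite preGramian_period; last by rewrite x0; lra.
by rewrite /preGramian0 -h_def in_itv /= x0 x1.
Qed.

Lemma preGramian_K x : omega - h < x -> x < 2 * h - omega ->
  J x = (Num.sqrt h)%:C *: rows3 (rowv (fv (x - h))) (rowv (fv x)) 0.
Proof.
move=> x0 x1; have hg := h_ge; have hl := h_lt; have h0 := h_gt0.
rewrite preGramian_period; last by apply/andP; split; lra.
by rewrite /preGramian0 -h_def !in_itv /= x0 x1 [x < omega - h]ltNge (ltW x0) andbF.
Qed.

Lemma preGramian_Kp x : 2 * h - omega < x -> x < h ->
  J x = (Num.sqrt h)%:C *:
    rows3 (rowv (fv (x - 2 * h))) (rowv (fv (x - h))) (rowv (fv x)).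
Proof.
move=> x0 x1; have hg := h_ge; have hl := h_lt; have h0 := h_gt0.
have x2 : omega - h <= x by lra.
rewrite preGramian_period; last by apply/andP; split; lra.
rewrite /preGramian0 -h_def !in_itv /= x0 x1 [x < omega - h]ltNge x2 andbF.
by rewrite [x < 2 * h - _]ltNge (ltW x0) andbF.
Qed.

Lemma sqrt_hE : (Num.sqrt h)%:C ^+ 2 = h%:C :> C.
Proof. by rewrite -rmorphXn /= sqr_sqrtr // ltW. Qed.

(** The determinant carries (sqrt h)^3 = h sqrt h, and the sqrt h in the definition of [dualD]
    cancels, leaving the normalisation of [dual3]. *)
Lemma dualD_scale a b c x : J x = (Num.sqrt h)%:C *: rows3 (rowv a) (rowv b) (rowv c) ->
  dualD omega t0 phi x = (h%:C * conjc (det3 a b c))^-1.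
Proof.
move=> Jx; rewrite /dualD -h_def det_conj_trmx Jx det_scale_rows3.
have s0 : (Num.sqrt h)%:C != 0 :> C.
  by rewrite eq_complex /= eqxx andbT gt_eqF // sqrtr_gt0.
have E : conjc ((Num.sqrt h)%:C ^+ 3 * det3 a b c) = (Num.sqrt h)%:C * (h%:C * conjc (det3 a b c)).
  have -> : (Num.sqrt h)%:C ^+ 3 = (Num.sqrt h)%:C * h%:C :> C by rewrite exprS sqrt_hE.
  by rewrite !conjcM !conjc_real mulrA.
by rewrite E invfM mulrA mulfV // mul1r.
Qed.

(** The determinant carries h^2, of which the numerator of [dualE] cancels one factor, leaving the
    normalisation of [dual2]. *)
Lemma dualE_K x : omega - h < x -> x < 2 * h - omega ->
  dualE omega t0 phi x = (h%:C * gram2 (fv (x - h)) (fv x))^-1.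
Proof.
move=> x0 x1; rewrite /dualE /preGramian2 -h_def (preGramian_K x0 x1) det_mulmx_conj_trmx.
have E : (Num.sqrt h ^+ 4)%:C = h%:C * h%:C :> C.
  by rewrite (exprM _ 2 2) sqr_sqrtr ?ltW // expr2 rmorphM.
by rewrite E -mulrA invfM mulrA mulfV ?h_neq0 // mul1r.
Qed.

Lemma dualD_translate (n : int) x :
  dualD omega t0 phi (x + n%:~R * h) = dualD omega t0 phi x.
Proof. by rewrite /dualD preGramianD. Qed.

Lemma dualE_translate (n : int) x :
  dualE omega t0 phi (x + n%:~R * h) = dualE omega t0 phi x.
Proof. by rewrite /dualE /preGramian2 preGramianD. Qed.

End PreGramianValues.

(** * Dual systems *)

Section WindowSynthesis.
Context {R : realType}.
Local Notation C := R[i].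
Local Notation mu := (@lebesgue_measure R).
Variable h : R.
Hypothesis h_gt0 : 0 < h.

Local Notation win := (window 2).

Lemma ae_forall_in (I : eqType) (r : seq I) (P : I -> R -> Prop) :
  (forall i, {ae mu, forall x, P i x}) -> {ae mu, forall x, forall i, i \in r -> P i x}.
Proof.
move=> aeP; elim: r => [|i r IH]; first exact: aeW.
apply: (ae_imp (ae_and (aeP i) IH)) => x [Pi Pr] j; rewrite inE => /orP[/eqP-> //|].
exact: Pr.
Qed.

Lemma ae_ord (n : nat) (P : 'I_n -> R -> Prop) :
  (forall i, {ae mu, forall x, P i x}) -> {ae mu, forall x, forall i, P i x}.
Proof.
move=> /(ae_forall_in (index_enum 'I_n)) aeP; apply: (ae_imp aeP) => x Px i.
by apply: Px; exact: mem_index_enum.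
Qed.

Lemma ex_window (x : R) : - (2 * h) <= x < 2 * h ->
  exists2 k : int, k \in win & 0 <= x - k%:~R * h < h.
Proof.
have h0 := h_gt0; move=> /andP[x1 x2]; rewrite window2.
have S k : x - k%:~R * h = x + (- k)%:~R * h by rewrite mulrNz mulNr.
case: (ltP x (- h)) => xh; last case: (ltP x 0) => x0; last case: (ltP x h) => xh'.
- by exists (-2); rewrite ?inE // S opprK; apply/andP; split; lra.
- by exists (-1); rewrite ?inE // S opprK; apply/andP; split; lra.
- by exists 0; rewrite ?inE // S oppr0; apply/andP; split; lra.
- by exists 1; rewrite ?inE // S; apply/andP; split; lra.
Qed.

Lemma ae_window (P : R -> Prop) :
  {ae mu, forall x, 0 <= x < h -> forall k : int, k \in win -> P (x + k%:~R * h)} ->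
  {ae mu, forall x, - (2 * h) <= x < 2 * h -> P x}.
Proof.
move=> aeP; have aeT (k : int) := ae_translate (- (k%:~R * h)) aeP.
apply: (ae_imp (ae_forall_in win aeT)) => x Px /ex_window[k kw xk].
by have := Px k kw xk k kw; rewrite subrK.
Qed.

Lemma stepf_in (x : R) : 0 <= x < h -> stepf h x = 1.
Proof.
move=> xh; have := step_sub x (ltW h_gt0); rewrite step0 subr0 /stepf => ->.
by rewrite indic_itvco xh.
Qed.

Lemma stepf_out (x : R) : ~~ (0 <= x < h) -> stepf h x = 0.
Proof.
move=> xh; have := step_sub x (ltW h_gt0); rewrite step0 subr0 /stepf => ->.
by rewrite indic_itvco (negbTE xh).
Qed.

Lemma per_out (H : R -> C) x : ~~ (0 <= x < h) -> per h H x = 0.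
Proof. by move=> xh; rewrite /per big1 // => k _; rewrite stepf_out // mul0r. Qed.

Lemma per_in (H : R -> C) x : 0 <= x < h -> per h H x = \sum_(k <- win) H (x + k%:~R * h).
Proof. by move=> xh; apply: eq_bigr => k _; rewrite stepf_in // mul1r. Qed.

(** [per] vanishes off [0, h), so a single shift contributes; the sum over the window undoes the
    extension by zero. *)
Lemma sum_per_window (H : R -> C) x (k : int) : 0 <= x < h -> k \in win ->
  \sum_(m <- win) per h H (x + k%:~R * h - m%:~R * h) = per h H x.
Proof.
move=> /andP[x0 xh] kw; rewrite (bigD1_seq k) //= addrK big1 ?addr0 // => m mk.
apply: per_out; have h0 := h_gt0.
rewrite -addrA -mulrBl -intrB negb_and -!ltNge -leNgt.
have [km|km|km] := ltgtP k m.
- apply/orP; left.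
  have : ((k - m)%:~R : R) <= -1.
    by rewrite -[-1]/((-1)%:~R) ler_int; lia.
  nra.
- apply/orP; right.
  have : 1 <= ((k - m)%:~R : R).
    by rewrite -[1]/(1%:~R) ler_int; lia.
  nra.
- by rewrite km eqxx in mk.
Qed.

Variables (P : 'I_3 -> R -> C).

Lemma per_analysis (g : R -> C) l x : 0 <= x < h ->
  per h (prodJ g (P l)) x = analysis h P (fun k => g (x + k%:~R * h)) x l.
Proof. by move=> xh; rewrite per_in. Qed.

(* For [Q = P] this is [frameFT]. *)
Definition synthesis (Q : 'I_3 -> R -> C) (g : R -> C) (xi : R) : C :=
  \sum_(l < 3) \sum_(m <- win) Q l xi * (h%:C * per h (prodJ g (P l)) (xi - m%:~R * h)).

Lemma synthesisE Q g x (k : int) : 0 <= x < h -> k \in win ->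
  synthesis Q g (x + k%:~R * h) =
  h%:C * \sum_(l < 3) Q l (x + k%:~R * h) * analysis h P (fun k => g (x + k%:~R * h)) x l.
Proof.
move=> xh kw; rewrite mulr_sumr; apply: eq_bigr => l _.
rewrite -mulr_sumr -mulr_sumr sum_per_window // per_analysis //; ring.
Qed.

End WindowSynthesis.

(** * Frame bounds, existence and uniqueness from a dual pair *)

Section DualPair.
Context {R : realType}.
Local Notation C := R[i].
Local Notation mu := (@lebesgue_measure R).

Lemma sqnormL2_sum_le (I : Type) (r : seq I) (F : I -> R -> C) (c : R) :
  (forall i, L2 (F i)) -> (forall i, (sqnormL2 (F i) <= c%:E)%E) ->
  (sqnormL2 (fun x => \sum_(i <- r) F i x)%R <= (2 ^+ size r * (c *+ size r))%:E)%E.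
Proof.
move=> F2 Fc.
rewrite (_ : sqnormL2 _ = (nsq ipL2 (\sum_(i <- r) toL2 (F2 i)))%:E); last first.
  by rewrite nsqL2E L2val_sum.
rewrite lee_fin; apply: le_trans (nsq_sum_le _ _ _) _.
rewrite ler_wpM2l ?exprn_ge0 //.
apply: (@le_trans _ _ (\sum_(i <- r) c)).
  by apply: ler_sum => i _; rewrite -lee_fin nsqL2E; exact: Fc.
by rewrite big_const_seq count_predT iter_addr_0.
Qed.

Variables (omega h t0 : R).
Hypothesis h_gt0 : 0 < h.
Hypothesis t0_gt0 : 0 < t0.
Hypothesis ht0 : h * t0 = 2 * pi.
Hypothesis omega_le : omega <= 2 * h.
Variables (phi P Q : 'I_3 -> R -> C) (M N : R).
Hypothesis phiP : forall l, is_fourier (phi l) (P l).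
Hypothesis PM : forall l x, cabs (P l x) <= M.
Hypothesis QN : forall l x, cabs (Q l x) <= N.

Definition in_band (g : R -> C) := forall x, ~~ (- omega < x < omega) -> g x = 0.

Hypothesis P0 : forall l, in_band (P l).
Hypothesis Q0 : forall l, in_band (Q l).
Hypothesis Q2 : forall l, L2 (Q l).
Hypothesis analysisK : forall g, in_band g ->
  {ae mu, forall xi, g xi = synthesis h P Q g xi}.
Hypothesis synthesisK : forall j, {ae mu, forall xi, synthesis h P P (Q j) xi = P j xi}.

Local Notation win := (window 2).

Lemma in_band_supported g : in_band g -> supported h g.
Proof.
move=> g0 x xh; apply: g0; apply: contra xh => /andP[x1 x2].
by have h0 := h_gt0; have hw := omega_le; apply/andP; split; lra.
Qed.

(** Multiplying the transform by the indicator of the open band changes it on a null set only,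
    endpoints included, and makes the support condition hold at every point. *)
Lemma bandlimitedP f : bandlimited omega f <->
  exists2 g, is_fourier f g & in_band g.
Proof.
split=> [[f2 f0]|[g fg g0]].
  exists (fun x => itvC (- omega) omega x * fourier f x).
    have F := fourierP f2; have [_ [F2 _]] := F.
    apply: is_fourier_ae F; [by case: f2| |exact: aeW|].
    - by apply: cmeasurableM; [exact: cmeasurable_indic|case: F2].
    - apply: (ae_imp (ae_and f0 (ae_and (ae_neq (- omega)) (ae_neq omega)))) => x [x0 [x1 x2]].
      case: (boolP (- omega < x < omega)) => [/andP[y1 y2]|]; first by rewrite itvC_in ?mul1r.
      rewrite negb_and -!leNgt => xo; rewrite x0 ?mulr0 //.
      by rewrite in_itv /= negb_and -!ltNge !lt_neqAle x1 (eq_sym omega) x2.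
  move=> x; rewrite negb_and -!leNgt => /orP[xo|xo]; first by rewrite itvC_le ?mul0r.
  by rewrite itvC_ge ?mul0r.
have [f2 _] := fg; split => //; apply: (ae_imp (fourier_ae fg)) => x -> xo.
apply: g0; apply: contra xo => /andP[x1 x2].
by rewrite in_itv /= !ltW.
Qed.

Lemma sqnormL2_per_le g l (G : R) : L2 g -> sqnormL2 g = G%:E ->
  (sqnormL2 (per h (prodJ g (P l))) <=
    (2 ^+ size win * ((M ^+ 2 * G) *+ size win))%:E)%E.
Proof.
move=> g2 gG; have mg : cmeasurable g by case: g2.
have mJ : cmeasurable (fun x => conjc (P l x)) by apply: cmeasurableJ; case: (P_L2 phiP l).
have pJ : prodJ g (P l) = fun x => conjc (P l x) * g x.
  by apply/funext => x; rewrite /prodJ mulrC.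
have H2 : L2 (prodJ g (P l)).
  by rewrite pJ; apply: (@L2M_bounded _ M) => // x; rewrite cabsJ.
have HG : (sqnormL2 (prodJ g (P l)) <= (M ^+ 2 * G)%:E)%E.
  rewrite pJ; apply: le_trans (sqnormL2M_le mJ mg _) _ => [x|]; first by rewrite cabsJ.
  by rewrite gG.
have T2 (k : int) := L2_translate (k%:~R * h) H2.
apply: sqnormL2_sum_le => k.
  exact: (L2_stepM h_gt0 (T2 k)).
have ms : cmeasurable (stepf h : R -> C) by case: (@L2_step R h).
have s1 x : cabs (stepf h x : C) <= 1.
  have := step_sub x (ltW h_gt0); rewrite step0 subr0 /stepf => ->.
  exact: cabs_indic_le1.
have mT : cmeasurable (translate (k%:~R * h) (prodJ g (P l))) by case: (T2 k).
apply: le_trans (sqnormL2M_le ms mT s1) _.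
by rewrite expr1n mul1e sqnormL2_translate //; case: H2.
Qed.

Lemma sqnormL2_synthesis_le g (S : R) : L2 g ->
  (forall l, L2 (per h (prodJ g (P l)))) ->
  (forall l, (sqnormL2 (per h (prodJ g (P l))) <= S%:E)%E) ->
  (sqnormL2 (synthesis h P Q g) <= (2 ^+ size (index_enum 'I_3) *
    ((2 ^+ size win * ((N ^+ 2 * (h ^+ 2 * S)) *+ size win)) *+ size (index_enum 'I_3)))%:E)%E.
Proof.
move=> g2 H2 HS.
have mQ l : cmeasurable (Q l) by case: (Q2 l).
have T2 l (m : int) : L2 (fun x => h%:C * per h (prodJ g (P l)) (x - m%:~R * h)).
  by apply: L2Z; exact: (L2_translate (- (m%:~R * h)) (H2 l)).
have Z2 l (m : int) : L2 (fun x => Q l x * (h%:C * per h (prodJ g (P l)) (x - m%:~R * h))).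
  exact: (L2M_bounded (mQ l) (QN l) (T2 l m)).
apply: sqnormL2_sum_le => l; first by apply: L2_sum => m; exact: Z2.
apply: sqnormL2_sum_le => m; first exact: Z2.
have mT : cmeasurable (fun x => h%:C * per h (prodJ g (P l)) (x - m%:~R * h)) by case: (T2 l m).
apply: le_trans (sqnormL2M_le (mQ l) mT (QN l)) _.
rewrite [X in (_ <= X)%E]EFinM; apply: lee_wpmul2l; first by rewrite lee_fin sqr_ge0.
have mH : cmeasurable (per h (prodJ g (P l))) by case: (H2 l).
have mTr : cmeasurable (translate (- (m%:~R * h)) (per h (prodJ g (P l)))).
  by case: (L2_translate (- (m%:~R * h)) (H2 l)).
have hh (x : R) : cabs (h%:C : C) <= h by rewrite /= expr0n addr0 sqrtr_sqr ger0_norm // ltW.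
apply: le_trans (sqnormL2M_le (cmeasurable_cst h%:C) mTr hh) _.
rewrite [X in (_ <= X)%E]EFinM; apply: lee_wpmul2l; first by rewrite lee_fin sqr_ge0.
by rewrite sqnormL2_translate.
Qed.

(** The sum of squared coefficients is [h] times the energies of the three periodised products.
    Boundedness of [P] bounds these by the norm of [f]; recovering the transform of [f] from them
    with the bounded [Q] gives the converse. *)
Lemma dual_pair_frame : is_frame omega t0 phi.
Proof.
pose K : R := 2 ^+ size (index_enum 'I_3) *
    ((2 ^+ size win * ((N ^+ 2 * h ^+ 2) *+ size win)) *+ size (index_enum 'I_3)).
pose L : R := 2 ^+ size win * (M ^+ 2 *+ size win).
have K0 : 0 <= K by rewrite mulr_ge0 ?exprn_ge0 // mulrn_wge0 // mulr_ge0 ?exprn_ge0 //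
   mulrn_wge0 // mulr_ge0 // sqr_ge0.
have L0 : 0 <= L by rewrite mulr_ge0 ?exprn_ge0 // mulrn_wge0 // sqr_ge0.
have h0 := h_gt0.
(* The 1 avoids division by zero, and adding the lower constant to the upper one makes A <= B
   immediate. The 3 counts the generators. *)
exists (h / (K + 1)), (h / (K + 1) + 3 * (h * L)); split.
- by rewrite divr_gt0 //; lra.
- by rewrite lerDl mulr_ge0 // mulr_ge0 // ltW.
move=> f /bandlimitedP[g fg g0]; have [f2 [g2 _]] := fg.
have gs := in_band_supported g0.
have gG := nsqL2E (toL2 g2); set G := nsq _ _ in gG.
have G0 : 0 <= G by exact: nsq_ge0.
pose a l : R := nsq ipL2 (per2 h_gt0 fg (phiP l) (PM l)).
have a0 l : 0 <= a l by exact: nsq_ge0.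
have aE l : sqnormL2 (per h (prodJ g (P l))) = (a l)%:E by rewrite nsqL2E.
have E : (\sum_(j < 3) \esum_(n in [set: int]) ((cabs (innerL2 f (atom phi t0 j n))) ^+ 2)%:E =
    (h * \sum_(l < 3) a l)%:E)%E.
  rewrite mulr_sumr -sumEFin; apply: eq_bigr => l _.
  exact: (frame_coef_esum h_gt0 t0_gt0 ht0 fg (phiP l) gs (PM l)).
rewrite E (is_fourier_norm fg) -gG -!EFinM !lee_fin.
have aS l : a l <= \sum_(l < 3) a l.
  by rewrite (bigD1 l) //= lerDl; apply: sumr_ge0 => i _.
have GK : G <= K * \sum_(l < 3) a l.
  have H2 l : L2 (per h (prodJ g (P l))) := L2val_L2 (per2 h_gt0 fg (phiP l) (PM l)).
  have HS l : (sqnormL2 (per h (prodJ g (P l))) <= (\sum_(l < 3) a l)%:E)%E.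
    by rewrite aE lee_fin.
  have := sqnormL2_synthesis_le g2 H2 HS.
  rewrite (_ : sqnormL2 (synthesis h P Q g) = G%:E); last first.
    rewrite gG; apply: sqnormL2_ae; [|by case: (g2)|].
    - apply: cmeasurable_sum => l; apply: cmeasurable_sum => m.
      apply: cmeasurableM; first by case: (Q2 l).
      by apply: cmeasurableZ; case: (L2_translate (- (m%:~R * h)) (H2 l)).
    - by apply: (ae_imp (analysisK g0)) => x <-.
  rewrite lee_fin => /le_trans; apply; rewrite le_eqVlt; apply/orP; left; apply/eqP.
  rewrite /K; move: (size win) (size (index_enum 'I_3)) (\sum_(l < 3) a l) => n m S.
  by rewrite !(mulrnAr, mulrnAl) !mulrA.
have aL l : a l <= L * G.
  rewrite -lee_fin -aE; apply: le_trans (sqnormL2_per_le l g2 (esym gG)) _.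
  by rewrite lee_fin /L -mulrA mulrnAl.
split.
- rewrite mulrAC ler_pdivrMr; last by lra.
  have S0 : 0 <= \sum_(l < 3) a l by apply: sumr_ge0.
  apply: (@le_trans _ _ (h * (K * \sum_(l < 3) a l))); first by rewrite ler_wpM2l // ltW.
  by rewrite -[X in _ <= X]mulrA ler_wpM2l ?(ltW h0) // [X in _ <= X]mulrC mulrDl mul1r lerDl.
- have : \sum_(l < 3) a l <= 3 * (L * G).
    rewrite !big_ord_recl big_ord0; have := aL ord0.
    have := aL (lift ord0 ord0); have := aL (lift ord0 (lift ord0 ord0)).
    move: (a _) (a _) (a _) => u v w; lra.
  move=> H; rewrite mulrDl.
  have : h * \sum_(l < 3) a l <= h * (3 * (L * G)) by rewrite ler_wpM2l // ltW.
  have : 0 <= h / (K + 1) * G by rewrite mulr_ge0 // divr_ge0; lra.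
  move: (h / _ * G) => z z0; lra.
Qed.

(** The preimage of [Q j] under the Fourier transform is band-limited, and [synthesisK] says that
    the frame operator maps it to [phi j]; thus the frame operator is solved explicitly. *)
Lemma dual_pair_exists : exists phistar, dual_generators omega t0 phi phistar.
Proof.
have [psi psiQ] : {psi : 'I_3 -> R -> C & forall j, is_fourier (psi j) (Q j)}.
  by apply: (choice (P := fun j f => is_fourier f (Q j))) => j; exact: fourier_surjective.
exists psi => j; split; first by apply/bandlimitedP; exists (Q j).
have Ps l := in_band_supported (P0 l); have Qs := in_band_supported (Q0 j).
apply: (frame_operator_fourier h_gt0 t0_gt0 ht0 phiP PM Ps (psiQ j) Qs).
have [p2 _] := phiP j.
apply: is_fourier_ae (phiP j); [by case: p2| |exact: aeW|].
- by case: (L2_frameFT h_gt0 phiP PM (psiQ j)).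
- by apply: (ae_imp (synthesisK j)) => x <-.
Qed.

Lemma synthesisB (T : 'I_3 -> R -> C) g1 g2 x :
  synthesis h P T (fun x => g1 x - g2 x) x = synthesis h P T g1 x - synthesis h P T g2 x.
Proof.
have perB l y : per h (prodJ (fun x => g1 x - g2 x) (P l)) y =
    per h (prodJ g1 (P l)) y - per h (prodJ g2 (P l)) y.
  by rewrite /per -sumrB; apply: eq_bigr => k _; rewrite /prodJ; ring.
rewrite /synthesis -sumrB; apply: eq_bigr => l _; rewrite -sumrB.
by apply: eq_bigr => m _; rewrite perB; ring.
Qed.

(* Pairing the fibre (v (x + k h))_k with its image under J^* J gives |J v|^2. *)
Lemma synthesis_inj v : in_band v -> {ae mu, forall x, synthesis h P P v x = 0} ->
  {ae mu, forall x, v x = 0}.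
Proof.
move=> v0 s0.
have aeT (k : int) := ae_translate (k%:~R * h) (ae_and (analysisK v0) s0).
suff : {ae mu, forall x, - (2 * h) <= x < 2 * h -> v x = 0}.
  move=> H; apply: (ae_imp H) => x vx; case: (boolP (- (2 * h) <= x < 2 * h)) => //.
  exact: in_band_supported.
apply: ae_window => //; apply: (ae_imp (ae_forall_in win aeT)) => x Hx xh k kw.
pose w l := analysis h P (fun k => v (x + k%:~R * h)) x l.
have w0 : \sum_(l < 3) (cabs (w l) ^+ 2)%:C = 0 :> C.
  apply: (mulfI (h_neq0 h_gt0)); rewrite mulr0.
  transitivity (\sum_(k <- win) conjc (v (x + k%:~R * h)) *
      (h%:C * \sum_(l < 3) P l (x + k%:~R * h) * w l)).
    rewrite mulr_sumr; under [RHS]eq_bigr do rewrite mulrA mulr_sumr.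
    rewrite exchange_big; apply: eq_bigr => l _ /=.
    rewrite cabs2J [X in _ * X = _]mulrC {1}/w /analysis conjc_sum !mulr_suml mulr_sumr.
    by apply: eq_bigr => i _; rewrite conjcM conjcK; ring.
  rewrite big_seq big1 // => i iw; have [_] := Hx i iw.
  by rewrite synthesisE // => ->; rewrite mulr0.
have wl l : w l = 0.
  have : cabs (w l) ^+ 2 = 0.
    apply/eqP; move: w0; rewrite -rmorph_sum /= => /(congr1 (@complex.Re R)) /= /eqP.
    by rewrite psumr_eq0 => [/allP/(_ l (mem_index_enum l))|i _]; rewrite ?sqr_ge0.
  by move/eqP; rewrite sqrf_eq0 => /eqP/ComplexField.Normc.eq0_normc.
(* [analysisK] recovers [v] from its periodised products, which have just been shown to vanish. *)
have [-> _] := Hx k kw; rewrite synthesisE // big1 ?mulr0 // => l _.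
by rewrite -/(w l) wl mulr0.
Qed.

(** The sum defining the frame operator is unique, so the transform of [phistar j] and [Q j] have
    the same synthesis [P j]; [synthesis_inj] applies to their difference. *)
Lemma dual_pair_unique phistar : dual_generators omega t0 phi phistar ->
  forall j, {ae mu, forall xi, fourier (phistar j) xi = Q j xi}.
Proof.
move=> dual j; have [/bandlimitedP[g fg g0] Sg] := dual j.
have Ps l := in_band_supported (P0 l); have gs := in_band_supported g0.
have phi2 l : L2 (phi l) by have [] := phiP l.
have [q qF] := fourier_surjective (L2_frameFT h_gt0 phiP PM fg).
have Sq := frame_operator_fourier h_gt0 t0_gt0 ht0 phiP PM Ps fg gs qF.
have qphi := frame_operator_unique phi2 Sq Sg.
have F2 := L2_frameFT h_gt0 phiP PM fg.
have phiF : is_fourier (phi j) (frameFT h P g).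
  by apply: is_fourier_ae qF => //; [case: (phi2 j)|case: F2|exact: aeW].
have v0 : in_band (fun x => g x - Q j x) by move=> x xo; rewrite g0 // Q0 // subrr.
have : {ae mu, forall x, synthesis h P P (fun x => g x - Q j x) x = 0}.
  apply: (ae_imp (ae_and (is_fourier_unique phiF (phiP j)) (synthesisK j))) => x [gP QP].
  by rewrite synthesisB QP -gP subrr.
move=> /(synthesis_inj v0) gQ.
apply: (ae_imp (ae_and (fourier_ae fg) gQ)) => x [-> /eqP].
by rewrite subr_eq0 => /eqP.
Qed.

End DualPair.

(** * Measurability and boundedness of the dual functions *)

Section DualBounds.
Context {R : realType}.
Local Notation C := R[i].
Local Notation mu := (@lebesgue_measure R).

Lemma cabsM (z w : C) : cabs (z * w) = cabs z * cabs w.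
Proof. exact: ComplexField.Normc.normcM. Qed.

Lemma cabs_real (r : R) : 0 <= r -> cabs (r%:C : C) = r.
Proof. by move=> r0; rewrite /= expr0n addr0 sqrtr_sqr ger0_norm. Qed.

Lemma cabsD_le (z w : C) (a b : R) : cabs z <= a -> cabs w <= b -> cabs (z + w) <= a + b.
Proof. by move=> za wb; apply: le_trans (le_normcD z w) _; exact: lerD. Qed.

Lemma cabsB_le (z w : C) (a b : R) : cabs z <= a -> cabs w <= b -> cabs (z - w) <= a + b.
Proof.
move=> za wb; apply: cabsD_le => //; rewrite -mulN1r cabsM.
by rewrite (_ : cabs (-1) = 1) ?mul1r //= oppr0 expr0n addr0 sqrrN expr1n sqrtr1.
Qed.

Lemma cabsM_le (z w : C) (a b : R) : cabs z <= a -> cabs w <= b -> cabs (z * w) <= a * b.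
Proof. by move=> za wb; rewrite cabsM ler_pM // cabs_ge0. Qed.

Lemma cabsV (z : C) : cabs z^-1 = (cabs z)^-1.
Proof.
have [->|z0] := eqVneq z 0; first by rewrite invr0 ComplexField.Normc.normc0 invr0.
have n0 : cabs z != 0 by apply: contra_neq z0; exact: ComplexField.Normc.eq0_normc.
apply: (mulfI n0); rewrite -cabsM (mulfV z0) (mulfV n0).
exact: ComplexField.Normc.normc1.
Qed.

Lemma cmeasurableV (f : R -> C) : cmeasurable f -> cmeasurable (fun x => (f x)^-1).
Proof.
move=> mf.
have -> : (fun x => (f x)^-1) = fun x => conjc (f x) * ((cabs (f x) ^+ 2)^-1)%:C.
  apply/funext => x; rewrite fmorphV /= cabs2J.
  have [->|z0] := eqVneq (f x) 0; first by rewrite conjc0 mul0r invr0.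
  have c0 : conjc (f x) != 0 by rewrite conjc_eq0.
  by field; rewrite z0 c0.
apply: cmeasurableM; first exact: cmeasurableJ.
apply: cmeasurable_real; apply: measurableT_comp; first exact: measurable_invr.
exact: measurable_cabs2.
Qed.

Definition cut (B : R) (f : R -> C) (x : R) : C := if cabs (f x) <= B then f x else 0.

Lemma cmeasurable_cut B f : cmeasurable f -> cmeasurable (cut B f).
Proof.
move=> mf; rewrite (_ : cut B f = fun x => (\1_[set x | cabs (f x) <= B] x)%:C * f x).
  apply: cmeasurableM => //; apply: cmeasurable_indic.
  rewrite (_ : [set x | _] = setT `&` (fun x => cabs (f x)) @^-1` `]-oo, B]%classic).
    by apply: (measurable_cabs mf) => //; exact: measurable_itv.
  by rewrite setTI; apply/seteqP; split => x /=; rewrite in_itv.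
apply/funext => x; rewrite /cut indicE.
have -> : (x \in [set y | cabs (f y) <= B]) = (cabs (f x) <= B).
  by apply/idP/idP; rewrite inE.
by case: ifP => _; rewrite ?mul1r ?mul0r.
Qed.

Lemma cabs_cut B f x : 0 <= B -> cabs (cut B f x) <= B.
Proof. by move=> B0; rewrite /cut; case: ifP => // _; rewrite ComplexField.Normc.normc0. Qed.

Lemma cut_id B f x : cabs (f x) <= B -> cut B f x = f x.
Proof. by rewrite /cut => ->. Qed.

Variables (h kappa M : R).
Hypothesis h_gt0 : 0 < h.
Hypothesis kappa_gt0 : 0 < kappa.
Implicit Types (a b c : 'I_3 -> R[i]).

Lemma cabs_inv_le (z : C) : kappa <= cabs z -> cabs (h%:C * z)^-1 <= (h * kappa)^-1.
Proof.
move=> kz; rewrite cabsV cabsM (cabs_real (ltW h_gt0)) lef_pV2 ?posrE.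
- by rewrite ler_wpM2l // ltW.
- by rewrite mulr_gt0 //; exact: lt_le_trans kz.
- exact: mulr_gt0.
Qed.

(** The sum of the bounds for [dual3] and [dual2], so that one constant covers both kinds of cells:
    1/(h kappa) bounds the denominators and [M] the entries. *)
Definition dual_bound : R := (h * kappa)^-1 * (M * M + M * M) +
  (h * kappa)^-1 * ((M * M + M * M + M * M) * M + (M * M + M * M + M * M) * M).

Hypothesis M0 : 0 <= M.

Let inv_ge0 : 0 <= (h * kappa)^-1.
Proof. by rewrite invr_ge0 mulr_ge0 // ltW. Qed.

Lemma cabs_dual3_le a b c j : (forall l, cabs (b l) <= M) -> (forall l, cabs (c l) <= M) ->
  kappa <= cabs (det3 a b c) -> cabs (dual3 h a b c j) <= dual_bound.
Proof.
move=> bM cM kd; apply: (@le_trans _ _ ((h * kappa)^-1 * (M * M + M * M))).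
  rewrite /dual3; apply: cabsM_le; first by apply: cabs_inv_le; rewrite cabsJ.
  by apply: cabsB_le; apply: cabsM_le; rewrite cabsJ.
by rewrite lerDl (mulr_ge0 inv_ge0) // addr_ge0 ?mulr_ge0 ?addr_ge0 ?mulr_ge0.
Qed.

Lemma cabs_dual2_le a b j : (forall l, cabs (a l) <= M) -> (forall l, cabs (b l) <= M) ->
  kappa <= cabs (gram2 a b) -> cabs (dual2 h a b j) <= dual_bound.
Proof.
move=> aM bM kd.
have dM u v : (forall l, cabs (u l) <= M) -> (forall l, cabs (v l) <= M) ->
    cabs (dotc u v) <= M * M + M * M + M * M.
  move=> uM vM; rewrite /dotc sum3; apply: cabsD_le; first apply: cabsD_le;
    by apply: cabsM_le; rewrite ?cabsJ.
apply: (@le_trans _ _ ((h * kappa)^-1 *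
    ((M * M + M * M + M * M) * M + (M * M + M * M + M * M) * M))).
  rewrite /dual2; apply: cabsM_le; first exact: cabs_inv_le.
  by apply: cabsB_le; apply: cabsM_le => //; exact: dM.
by rewrite lerDr (mulr_ge0 inv_ge0) // addr_ge0 ?mulr_ge0.
Qed.

Lemma dual_bound_ge0 : 0 <= dual_bound.
Proof.
by rewrite addr_ge0 ?(mulr_ge0 inv_ge0) ?addr_ge0 ?mulr_ge0 ?addr_ge0 ?mulr_ge0.
Qed.

Section Functions.
Variables (omega : R) (P : 'I_3 -> R -> C).
Hypothesis h_ge : 2 / 3 * omega <= h.
Hypothesis h_lt : h < omega.
Hypothesis P0 : forall l, in_band omega (P l).
Hypothesis mP : forall l, cmeasurable (P l).
Hypothesis PM : forall l x, cabs (P l x) <= M.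

Local Notation win := (window 2).
Local Notation Psi := (Psi omega h P).

Lemma cmeasurable_Psi j : cmeasurable (Psi j).
Proof.
have mPa l (y : R) : cmeasurable (fun x => P l (x + y)).
  by apply: (cmeasurable_comp _ (mP l)); apply: measurable_funD.
have mi (y z : R) : cmeasurable (itvC y z : R -> C) by apply: cmeasurable_indic; exact: measurable_itv.
have mcross (u v : R -> 'I_3 -> C) l : (forall l, cmeasurable (fun x => u x l)) ->
    (forall l, cmeasurable (fun x => v x l)) -> cmeasurable (fun x => crossc (u x) (v x) l).
  by move=> mu_ mv; apply: cmeasurableB; apply: cmeasurableM.
have mdot (u v : R -> 'I_3 -> C) : (forall l, cmeasurable (fun x => u x l)) ->
    (forall l, cmeasurable (fun x => v x l)) -> cmeasurable (fun x => dotc (u x) (v x)).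
  move=> mu_ mv; apply: cmeasurable_sum => l; apply: cmeasurableM => //.
  exact: cmeasurableJ.
have m3 (u v w : R -> 'I_3 -> C) : (forall l, cmeasurable (fun x => u x l)) ->
    (forall l, cmeasurable (fun x => v x l)) -> (forall l, cmeasurable (fun x => w x l)) ->
    cmeasurable (fun x => dual3 h (u x) (v x) (w x) j).
  move=> mu_ mv mw; apply: cmeasurableM.
    apply: cmeasurableV; apply: cmeasurableZ; apply: cmeasurableJ.
    by apply: cmeasurable_sum => l; apply: cmeasurableM => //; exact: mcross.
  by apply: (mcross (fun x => conjv (v x)) (fun x => conjv (w x))) => l; exact: cmeasurableJ.
have m2 (u v : R -> 'I_3 -> C) : (forall l, cmeasurable (fun x => u x l)) ->
    (forall l, cmeasurable (fun x => v x l)) ->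
    cmeasurable (fun x => dual2 h (u x) (v x) j).
  move=> mu_ mv; apply: cmeasurableM.
    apply: cmeasurableV; apply: cmeasurableZ.
    by apply: cmeasurableB; apply: cmeasurableM; exact: mdot.
  by apply: cmeasurableB; apply: cmeasurableM => //; exact: mdot.
have m0 l : cmeasurable (fun x => pv P x l) := mP l.
have ma (y : R) l : cmeasurable (fun x => pv P (x + y) l) := mPa l y.
rewrite /Psi; apply: cmeasurableD; [apply: cmeasurableD; [apply: cmeasurableD; [apply: cmeasurableD |] |] |];
  (apply: cmeasurableM; first exact: mi).
- by apply: (m3 (fun x => pv P x) (fun x => pv P (x + h)) (fun x => pv P (x + 2 * h))).
- by apply: (m2 (fun x => pv P x) (fun x => pv P (x + h))).
- by apply: (m3 (fun x => pv P x) (fun x => pv P (x + h)) (fun x => pv P (x - h))).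
- by apply: (m2 (fun x => pv P x) (fun x => pv P (x - h))).
- by apply: (m3 (fun x => pv P x) (fun x => pv P (x - 2 * h)) (fun x => pv P (x - h))).
Qed.

Lemma Psi_le j x (k : int) : regular_point omega h kappa P x -> k \in win ->
  cabs (Psi j (x + k%:~R * h)) <= dual_bound.
Proof.
move=> reg kw.
have B0 y : ~~ (- omega < y < omega) -> cabs (Psi j y) <= dual_bound.
  move=> yo; rewrite (Psi_out P h_gt0 h_ge h_lt j yo) ComplexField.Normc.normc0.
  exact: dual_bound_ge0.
have pM y l : cabs (pv P y l) <= M by exact: PM.
move: kw; rewrite window2 !inE; case: (regular_pointP h_gt0 h_ge h_lt reg).
- move=> [n2 d p1 p2 p3]; case/or4P => /eqP ->; rewrite ?shiftE; first exact: B0.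
  + by rewrite (p1 j); exact: cabs_dual3_le.
  + by rewrite (p2 j); apply: cabs_dual3_le => //; rewrite det3_cycle.
  + by rewrite (p3 j); apply: cabs_dual3_le => //; rewrite -det3_cycle.
- move=> [n2 n1 d p1 p2]; case/or4P => /eqP ->; rewrite ?shiftE; [exact: B0| | |exact: B0].
  + by rewrite (p1 j); exact: cabs_dual2_le.
  + by rewrite (p2 j); apply: cabs_dual2_le => //; rewrite gram2C.
- move=> [n1 d p1 p2 p3]; case/or4P => /eqP ->; rewrite ?shiftE; last exact: B0.
  + by rewrite (p1 j); exact: cabs_dual3_le.
  + by rewrite (p2 j); apply: cabs_dual3_le => //; rewrite det3_cycle.
  + by rewrite (p3 j); apply: cabs_dual3_le => //; rewrite -det3_cycle.
Qed.

End Functions.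
End DualBounds.

(** * Everywhere bounded duals *)

Section DualSystem.
Context {R : realType}.
Local Notation C := R[i].
Local Notation mu := (@lebesgue_measure R).
Variables (omega h kappa M : R) (P : 'I_3 -> R -> C).
Hypothesis h_gt0 : 0 < h.
Hypothesis kappa_gt0 : 0 < kappa.
Hypothesis M0 : 0 <= M.
Hypothesis h_ge : 2 / 3 * omega <= h.
Hypothesis h_lt : h < omega.
Hypothesis P0 : forall l, in_band omega (P l).
Hypothesis mP : forall l, cmeasurable (P l).
Hypothesis PM : forall l x, cabs (P l x) <= M.
Hypothesis regular_ae : {ae mu, forall x, 0 < x -> x < h -> regular_point omega h kappa P x}.

Local Notation win := (window 2).
Local Notation B := (dual_bound h kappa M).

(* Equal almost everywhere to Psi, but everywhere bounded. *)
Definition dualQ (j : 'I_3) : R -> C := cut B (Psi omega h P j).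

Lemma dualQ_le j x : cabs (dualQ j x) <= B.
Proof. by apply: cabs_cut; exact: dual_bound_ge0. Qed.

Lemma dualQ_in_band j : in_band omega (dualQ j).
Proof. by move=> x xo; rewrite /dualQ /cut (Psi_out P h_gt0 h_ge h_lt j xo) if_same. Qed.

Lemma L2_dualQ j : L2 (dualQ j).
Proof.
have mQ : cmeasurable (dualQ j) by apply: cmeasurable_cut; exact: cmeasurable_Psi.
(* The indicator of [-2h, 2h). It is in L2 and equals 1 on the support of [dualQ j], which is
   therefore a bounded function times one in L2. *)
pose chi x : C := stepf (2 * h) x - stepf (- (2 * h)) x.
have chi2 : L2 chi by apply: L2B; exact: L2_step.
have := L2M_bounded mQ (dualQ_le j) chi2; congr L2; apply/funext => x.
have h0 := h_gt0; have hg := h_ge; have hl := h_lt.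
have hh : - (2 * h) <= 2 * h by lra.
rewrite /chi /stepf -rmorphB /= (step_sub x hh) indic_itvco.
case: (boolP (_ <= x < _)) => [_|xo]; first by rewrite mulr1.
rewrite dualQ_in_band ?mul0r //; apply: contra xo => /andP[x1 x2].
by apply/andP; split; lra.
Qed.

Lemma regular_ae0 : {ae mu, forall x, 0 <= x < h -> regular_point omega h kappa P x}.
Proof.
apply: (ae_imp (ae_and regular_ae (ae_neq 0))) => x [reg x0] /andP[x1 x2].
by apply: reg => //; rewrite lt_neqAle eq_sym x0.
Qed.

Lemma dualQE j x (k : int) : regular_point omega h kappa P x -> k \in win ->
  dualQ j (x + k%:~R * h) = Psi omega h P j (x + k%:~R * h).
Proof. by move=> reg kw; apply: cut_id; exact: Psi_le. Qed.

Lemma in_band_window (g : R -> C) x : in_band omega g -> ~~ (- (2 * h) <= x < 2 * h) -> g x = 0.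
Proof.
move=> g0 xo; apply: g0; apply: contra xo => /andP[x1 x2].
by have h0 := h_gt0; have hg := h_ge; have hl := h_lt; apply/andP; split; lra.
Qed.

Lemma ae_window_eq (f g : R -> C) :
  (forall x, ~~ (- (2 * h) <= x < 2 * h) -> f x = g x) ->
  (forall x (k : int), regular_point omega h kappa P x -> 0 <= x < h -> k \in win ->
     f (x + k%:~R * h) = g (x + k%:~R * h)) ->
  {ae mu, forall x, f x = g x}.
Proof.
move=> fg0 fg; have : {ae mu, forall x, - (2 * h) <= x < 2 * h -> f x = g x}.
  apply: ae_window => //; apply: (ae_imp regular_ae0) => x reg xh k kw.
  by apply: fg => //; exact: reg.
move=> H; apply: (ae_imp H) => x fgx; case: (boolP (- (2 * h) <= x < 2 * h)) => //.
exact: fg0.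
Qed.

Lemma dualQ_analysisK g : in_band omega g ->
  {ae mu, forall xi, g xi = synthesis h P dualQ g xi}.
Proof.
move=> g0; apply: ae_window_eq => [x xo|x k reg xh kw].
  rewrite (in_band_window g0 xo) /synthesis big1 // => l _; rewrite big1 // => m _.
  by rewrite (in_band_window (dualQ_in_band l) xo) mul0r.
rewrite synthesisE //; under eq_bigr do rewrite dualQE //.
rewrite (dual_analysis h_gt0 kappa_gt0 h_ge h_lt reg) // => i; exact: g0.
Qed.

Lemma dualQ_synthesisK j : {ae mu, forall xi, synthesis h P P (dualQ j) xi = P j xi}.
Proof.
apply: ae_window_eq => [x xo|x k reg xh kw].
  rewrite (in_band_window (P0 j) xo) /synthesis big1 // => l _; rewrite big1 // => m _.
  by rewrite (in_band_window (P0 l) xo) mul0r.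
rewrite synthesisE // -(dual_synthesis h_gt0 kappa_gt0 h_ge h_lt P0 j reg kw).
congr (_ * _); apply: eq_bigr => l _; congr (_ * _).
by rewrite /analysis !big_seq; apply: eq_bigr => i iw; rewrite dualQE.
Qed.

End DualSystem.

(** * Identification with the cross product formulas *)

Section DualFormulas.
Context {R : realType}.
Local Notation C := R[i].
Variables (omega h t0 : R) (phi : 'I_3 -> R -> C).
Hypothesis h_def : h = 2 * pi / t0.
Hypothesis h_gt0 : 0 < h.
Hypothesis h_ge : 2 / 3 * omega <= h.
Hypothesis h_lt : h < omega.

Local Notation D := (dualD omega t0 phi).
Local Notation E := (dualE omega t0 phi).
Local Notation fv := (fv phi).

Lemma dualD_Km x : 0 < x -> x < omega - h ->
  D x = (h%:C * conjc (det3 (fv (x - h)) (fv x) (fv (x + h))))^-1.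
Proof.
by move=> x0 x1; apply: (dualD_scale h_def h_gt0); exact: (preGramian_Km phi h_def).
Qed.

Lemma dualD_Kp x : 2 * h - omega < x -> x < h ->
  D x = (h%:C * conjc (det3 (fv (x - 2 * h)) (fv (x - h)) (fv x)))^-1.
Proof.
by move=> x0 x1; apply: (dualD_scale h_def h_gt0); exact: (preGramian_Kp phi h_def).
Qed.

(** Periodicity moves [x] into the basic period: by 2h into K_+ when x < -h, by h into K_- when x >
    -h. Both sides give the same determinant; the point -h is a breakpoint of the periodic
    extension. *)
Lemma dualD_left x : - omega < x -> x < omega - 2 * h -> x != - h ->
  D x = (h%:C * conjc (det3 (fv x) (fv (x + h)) (fv (x + 2 * h))))^-1.
Proof.
move=> x1 x2 xh; have hg := h_ge; have hl := h_lt; have h0 := h_gt0.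
case: (ltgtP x (- h)) xh => // xh _.
- rewrite -(dualD_translate omega phi h_def h_gt0 2 x).
  have e0 : x + 2%:~R * h - 2 * h = x by ring.
  have e1 : x + 2%:~R * h - h = x + h by ring.
  by rewrite dualD_Kp ?e0 ?e1 //; lra.
- rewrite -(dualD_translate omega phi h_def h_gt0 1 x).
  have e0 : x + 1%:~R * h - h = x by ring.
  have e1 : x + 1%:~R * h + h = x + 2 * h by ring.
  have e2 : x + 1%:~R * h = x + h by ring.
  by rewrite dualD_Km ?e0 ?e1 ?e2 //; lra.
Qed.

Lemma dualD_middle x : h - omega < x -> x < omega - h -> x != 0 ->
  D x = (h%:C * conjc (det3 (fv x) (fv (x + h)) (fv (x - h))))^-1.
Proof.
move=> x1 x2 xh; have hg := h_ge; have hl := h_lt; have h0 := h_gt0.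
rewrite -(det3_cycle (fv x)) -(det3_cycle (fv (x + h))).
case: (ltgtP x 0) xh => // xh _.
- rewrite -(dualD_translate omega phi h_def h_gt0 1 x).
  have e0 : x + 1%:~R * h - 2 * h = x - h by ring.
  have e1 : x + 1%:~R * h - h = x by ring.
  have e2 : x + 1%:~R * h = x + h by ring.
  by rewrite dualD_Kp ?e0 ?e1 ?e2 ?[det3 (fv (x - h)) _ _]det3_cycle //; lra.
- by rewrite dualD_Km.
Qed.

Lemma dualD_right x : 2 * h - omega < x -> x < omega -> x != h ->
  D x = (h%:C * conjc (det3 (fv x) (fv (x - 2 * h)) (fv (x - h))))^-1.
Proof.
move=> x1 x2 xh; have hg := h_ge; have hl := h_lt; have h0 := h_gt0.
rewrite -(det3_cycle (fv x)).
case: (ltgtP x h) xh => // xh _; first by rewrite dualD_Kp.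
rewrite -(dualD_translate omega phi h_def h_gt0 (-1) x).
have e0 : x + (-1)%:~R * h - h = x - 2 * h by ring.
have e1 : x + (-1)%:~R * h = x - h by ring.
have e2 : x - h + h = x by ring.
by rewrite dualD_Km ?e0 ?e1 ?e2 //; lra.
Qed.

Lemma dualE_left x : omega - 2 * h < x -> x < h - omega ->
  E x = (h%:C * gram2 (fv x) (fv (x + h)))^-1.
Proof.
move=> x1 x2; rewrite -(dualE_translate omega phi h_def h_gt0 1 x).
have e1 : x + 1%:~R * h - h = x by ring.
have e2 : x + 1%:~R * h = x + h by ring.
by rewrite (dualE_K phi h_def h_gt0) ?e1 ?e2 //; lra.
Qed.

Lemma dualE_right x : omega - h < x -> x < 2 * h - omega ->
  E x = (h%:C * gram2 (fv x) (fv (x - h)))^-1.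
Proof. by move=> x1 x2; rewrite (dualE_K phi h_def h_gt0) // gram2C. Qed.

Implicit Types (a b c : 'I_3 -> R[i]).

Lemma rowvZ (k : C) a : k *: rowv a = rowv (fun j => k * a j).
Proof. by apply/rowP => j; rewrite !mxE. Qed.

Lemma dual3_rowv a b c : rowv (dual3 h a b c) =
  (h%:C * conjc (det3 a b c))^-1 *: crossmul (conj_mx (rowv b)) (conj_mx (rowv c)).
Proof. by rewrite !conj_mx_rowv crossmul_rowv rowvZ. Qed.

(** Triple product expansion: with b' the conjugate of b, (b x a) x b' = (b . b') a - (a . b') b. *)
Lemma dual2_rowv a b : rowv (dual2 h a b) =
  (h%:C * gram2 a b)^-1 *: crossmul (crossmul (rowv b) (rowv a)) (conj_mx (rowv b)).
Proof.
rewrite conj_mx_rowv !crossmul_rowv rowvZ; apply/rowP => j; rewrite !mxE /dual2.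
congr (_ * _); rewrite /dotc !sum3.
by case: (ord3P j) => ->; rewrite !croscE /conjv; ring.
Qed.

Lemma crossmulC (u v : 'rV[C]_3) : crossmul v u = - crossmul u v.
Proof. by apply/rowP => j; rewrite !mxE; ring. Qed.

End DualFormulas.

(** * From the hypotheses of the theorem to a dual pair *)

Section MainProof.
Context {R : realType}.
Local Notation C := R[i].
Local Notation mu := (@lebesgue_measure R).
Variables (omega t0 h : R) (phi : 'I_3 -> R -> C) (gamma sigma eta : R).
Hypothesis t0_gt0 : 0 < t0.
Hypothesis h_def : h = 2 * pi / t0.
Hypothesis h_ge : 2 / 3 * omega <= h.
Hypothesis h_lt : h < omega.
Hypothesis phi_band : forall j, bandlimited omega (phi j).
Hypothesis sigma_gt0 : 0 < sigma.
Hypothesis eta_gt0 : 0 < eta.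
Hypothesis sum_bound : {ae mu, forall xi, xi \in `]- omega, omega[ ->
  \sum_(j < 3) (cabs (fourier (phi j) xi)) ^+ 2 <= gamma}.
Hypothesis minors_bound : {ae mu, forall xi, xi \in `]omega - h, 2 * h - omega[ ->
  sigma <= minors_sqsum 2 (preGramian omega t0 phi xi)}.
Hypothesis det_bound : {ae mu, forall xi,
  (xi \in `]0, omega - h[) \/ (xi \in `]2 * h - omega, h[) ->
  eta <= cabs (\det (preGramian omega t0 phi xi))}.

Local Notation fv := (fv phi).

Lemma step_size_gt0 : 0 < h.
Proof. by rewrite h_def divr_gt0 // mulr_gt0 // pi_gt0. Qed.
Let h_gt0 := step_size_gt0.

Lemma step_size_period : h * t0 = 2 * pi.
Proof. by rewrite h_def divfK // gt_eqF. Qed.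

(* Removing a null set makes the bound and the support hold at every point. *)
Definition cutFT (l : 'I_3) : R -> C :=
  cut (Num.sqrt gamma) (fun x => itvC (- omega) omega x * fourier (phi l) x).

Lemma cmeasurable_cutFT l : cmeasurable (cutFT l).
Proof.
have [f2 _] := phi_band l; have [_ [F2 _]] := fourierP f2.
apply: cmeasurable_cut; apply: cmeasurableM; last by case: F2.
by apply: cmeasurable_indic; exact: measurable_itv.
Qed.

Lemma cutFT_le l x : cabs (cutFT l x) <= Num.sqrt gamma.
Proof. by apply: cabs_cut; exact: sqrtr_ge0. Qed.

Lemma cutFT_in_band l : in_band omega (cutFT l).
Proof.
move=> x; rewrite negb_and -!leNgt /cutFT /cut => /orP[xo|xo].
  by rewrite itvC_le // mul0r if_same.
by rewrite itvC_ge // mul0r if_same.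
Qed.

Lemma cutFT_ae : {ae mu, forall x, forall l, cutFT l x = fourier (phi l) x}.
Proof.
apply: ae_ord => l; have [_ f0] := phi_band l.
apply: (ae_imp (ae_and (ae_and f0 sum_bound) (ae_and (ae_neq (- omega)) (ae_neq omega)))).
move=> x [[x0 xs] [n1 n2]].
case: (boolP (- omega < x < omega)) => [/andP[x1 x2]|].
  rewrite /cutFT cut_id itvC_in ?mul1r //.
  have : x \in `]- omega, omega[ by rewrite in_itv /= x1.
  move=> /xs; rewrite (bigD1 l) //= => sg.
  have s2 : cabs (fourier (phi l) x) ^+ 2 <= gamma.
    by apply: le_trans sg; rewrite lerDl; apply: sumr_ge0 => i _; exact: sqr_ge0.
  by have := ler_wsqrtr s2; rewrite sqrtr_sqr ger0_norm ?cabs_ge0.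
move=> xo; rewrite (cutFT_in_band l xo) x0 //.
move: xo; rewrite negb_and -!leNgt in_itv /= negb_and -!ltNge !lt_neqAle n1 (eq_sym omega) n2.
by [].
Qed.

Lemma cutFT_fourier l : is_fourier (phi l) (cutFT l).
Proof.
have [f2 _] := phi_band l.
apply: is_fourier_ae (fourierP f2); [by case: f2|exact: cmeasurable_cutFT|exact: aeW|].
by apply: (ae_imp cutFT_ae) => x ->.
Qed.

(** The shift by 2h occurs in the first formula and lies outside [window 2], which stops at 1; hence
    [window 3]. *)
Lemma cutFT_shift_ae :
  {ae mu, forall x, forall k : int, k \in window 3 -> pv cutFT (x + k%:~R * h) = fv (x + k%:~R * h)}.
Proof.
have aeT (k : int) := ae_translate (k%:~R * h) cutFT_ae.
apply: (ae_imp (ae_forall_in (window 3) aeT)) => x Hx k /Hx E.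
by apply/funext => l; exact: E.
Qed.

(** The powers of sqrt h undo the scaling of the pre-Gramian: a third power for a determinant, a
    fourth for squared 2 x 2 minors. The minimum serves all three kinds of cells. *)
Definition lower_const : R := Num.min (eta / Num.sqrt h ^+ 3) (sigma / Num.sqrt h ^+ 4).

Lemma lower_const_gt0 : 0 < lower_const.
Proof. by rewrite lt_min !divr_gt0 ?exprn_gt0 ?sqrtr_gt0. Qed.

Lemma cutFT_regular : {ae mu, forall x, 0 < x -> x < h ->
  regular_point omega h lower_const cutFT x}.
Proof.
have hg := h_ge; have hl := h_lt; have h0 := h_gt0.
have s0 n : 0 < Num.sqrt h ^+ n by rewrite exprn_gt0 // sqrtr_gt0.
have detk a b c x : eta <= cabs (\det (preGramian omega t0 phi x)) ->
    preGramian omega t0 phi x = (Num.sqrt h)%:C *: rows3 (rowv a) (rowv b) (rowv c) ->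
    lower_const <= cabs (det3 a b c).
  move=> + Jx; rewrite Jx det_scale_rows3 cabsM.
  have -> : (Num.sqrt h)%:C ^+ 3 = (Num.sqrt h ^+ 3)%:C :> C by rewrite rmorphXn.
  rewrite (cabs_real (ltW (s0 3%N))) => H.
  by rewrite ge_min ler_pdivrMr // mulrC H.
have gramk a b x : sigma <= minors_sqsum 2 (preGramian omega t0 phi x) ->
    preGramian omega t0 phi x = (Num.sqrt h)%:C *: rows3 (rowv a) (rowv b) 0 ->
    lower_const <= cabs (gram2 a b).
  move=> + Jx; rewrite Jx; move: (minors_sqsum_rows3 (Num.sqrt h) a b); move: (minors_sqsum _ _) => m E H.
  have m0 : 0 <= m by apply: le_trans H; exact: ltW.
  rewrite ge_min; apply/orP; right; rewrite ler_pdivrMr // mulrC.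
  by rewrite -[X in X * _](cabs_real (ltW (s0 4%N))) -cabsM -E cabs_real.
apply: (ae_imp (ae_and cutFT_shift_ae (ae_and (ae_and minors_bound det_bound)
  (ae_and (ae_neq (omega - h)) (ae_neq (2 * h - omega)))))).
move=> x [Ex [[xm xd] [n1 n2]]] x0 xh.
have E0 : pv cutFT x = fv x by have := Ex 0 isT; rewrite shift0.
have E1 : pv cutFT (x + h) = fv (x + h) by have := Ex 1 isT; rewrite shift1.
have Em : pv cutFT (x - h) = fv (x - h) by have := Ex (-1) isT; rewrite shiftm1.
have Em2 : pv cutFT (x - 2 * h) = fv (x - 2 * h) by have := Ex (-2) isT; rewrite shiftm2.
rewrite /regular_point E0 E1 Em Em2.
case: (ltgtP x (omega - h)) n1 => // x1 _; last case: (ltgtP x (2 * h - omega)) n2 => // x2 _.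
- apply: Or31; split => //; apply: (detk _ _ _ x); last exact: (preGramian_Km phi h_def).
  by apply: xd; left; rewrite in_itv /= x0.
- apply: Or32; split => //; apply: (gramk _ _ x); last exact: (preGramian_K phi h_def).
  by apply: xm; rewrite in_itv /= x1.
- apply: Or33; split => //; apply: (detk _ _ _ x); last exact: (preGramian_Kp phi h_def).
  by apply: xd; right; rewrite in_itv /= x2.
Qed.

Local Notation Q := (dualQ omega h lower_const (Num.sqrt gamma) cutFT).

Let omega_le : omega <= 2 * h.
Proof. by have hg := h_ge; have hl := h_lt; have h0 := h_gt0; lra. Qed.

Let QN := dualQ_le omega cutFT h_gt0 lower_const_gt0 (sqrtr_ge0 gamma).
Let Q0 := dualQ_in_band lower_const (Num.sqrt gamma) cutFT h_gt0 h_ge h_lt.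
Let Q2 := L2_dualQ h_gt0 lower_const_gt0 (sqrtr_ge0 gamma) h_ge h_lt cmeasurable_cutFT.
Let QA := dualQ_analysisK h_gt0 lower_const_gt0 (sqrtr_ge0 gamma) h_ge h_lt cutFT_le cutFT_regular.
Let QS := dualQ_synthesisK h_gt0 lower_const_gt0 (sqrtr_ge0 gamma) h_ge h_lt
  cutFT_in_band cutFT_le cutFT_regular.

Lemma frame_of_bounds : is_frame omega t0 phi.
Proof.
exact: (dual_pair_frame h_gt0 t0_gt0 step_size_period omega_le cutFT_fourier cutFT_le QN Q2 QA).
Qed.

Lemma dual_generators_exist : exists phistar, dual_generators omega t0 phi phistar.
Proof.
exact: (dual_pair_exists h_gt0 t0_gt0 step_size_period omega_le cutFT_fourier cutFT_le cutFT_in_band Q0 Q2 QS).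
Qed.

Lemma fourier_dual_generators phistar : dual_generators omega t0 phi phistar ->
  {ae mu, forall xi, forall j, fourier (phistar j) xi = Psi omega h cutFT j xi}.
Proof.
move=> dual.
have F j := dual_pair_unique h_gt0 t0_gt0 step_size_period omega_le cutFT_fourier cutFT_le
  cutFT_in_band Q0 QA QS dual j.
apply: ae_ord => j.
have QP : {ae mu, forall x, Q j x = Psi omega h cutFT j x}.
  apply: (ae_window_eq h_gt0 cutFT_regular) => [x xo|x k reg xh kw].
    rewrite (in_band_window h_gt0 h_ge h_lt (Q0 j) xo).
    by rewrite (in_band_window h_gt0 h_ge h_lt (Psi_out cutFT h_gt0 h_ge h_lt j) xo).
  exact: (dualQE h_gt0 lower_const_gt0 (sqrtr_ge0 gamma) h_ge h_lt cutFT_le j reg kw).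
by apply: (ae_imp (ae_and (F j) QP)) => x [-> ->].
Qed.

End MainProof.

(** Existence of dual generators belongs to the conclusion, so that the formulas, stated for every
    [phistar], are not vacuous. *)
Theorem theorem4p4 (R : realType) (omega t0 h : R) (phi : 'I_3 -> R -> R[i])
    (delta gamma sigma eta : R)
    (omega_gt0 : 0 < omega) (t0_gt0 : 0 < t0) (h_def : h = 2 * pi / t0)
    (h_ge : 2 / 3 * omega <= h) (h_lt : h < omega)
    (phi_band : forall j, bandlimited omega (phi j))
    (delta_gt0 : 0 < delta) (gamma_gt0 : 0 < gamma)
    (sigma_gt0 : 0 < sigma) (eta_gt0 : 0 < eta)
    (sum_bounds : {ae @lebesgue_measure R, forall xi, xi \in `]- omega, omega[ ->
       delta <= \sum_(j < 3) (cabs (fourier (phi j) xi)) ^+ 2 <= gamma})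
    (minors_bound : {ae @lebesgue_measure R, forall xi,
       xi \in `]omega - h, 2 * h - omega[ ->
       sigma <= minors_sqsum 2 (preGramian omega t0 phi xi)})
    (det_bound : {ae @lebesgue_measure R, forall xi,
       (xi \in `]0, omega - h[) \/ (xi \in `]2 * h - omega, h[) ->
       eta <= cabs (\det (preGramian omega t0 phi xi))}) :
  let F := fourier_row phi in
  let Fbar := fun xi => conj_mx (F xi) in
  let D := dualD omega t0 phi in
  let E := dualE omega t0 phi in
  [/\ is_frame omega t0 phi,
      exists phistar, dual_generators omega t0 phi phistar,
      forall phistar, dual_generators omega t0 phi phistar ->
        {ae @lebesgue_measure R, forall xi,
          [/\ xi \in `]- omega, omega - 2 * h[ ->
                fourier_row phistar xi =
                D xi *: crossmul (translate h Fbar xi) (translate (2 * h) Fbar xi),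
              xi \in `]omega - 2 * h, h - omega[ ->
                fourier_row phistar xi =
                E xi *: crossmul (crossmul (translate h F xi) (F xi))
                                 (translate h Fbar xi),
              xi \in `]h - omega, omega - h[ ->
                fourier_row phistar xi =
                D xi *: crossmul (translate h Fbar xi) (translate (- h) Fbar xi),
              xi \in `]omega - h, 2 * h - omega[ ->
                fourier_row phistar xi =
                - E xi *: crossmul (translate (- h) Fbar xi)
                                   (crossmul (translate (- h) F xi) (F xi)) &
              xi \in `]2 * h - omega, omega[ ->
                fourier_row phistar xi =
                D xi *: crossmul (translate (- (2 * h)) Fbar xi)
                                 (translate (- h) Fbar xi)]} &
      h = 2 * omega / 3 ->
        `]omega - h, 2 * h - omega[%classic = set0 /\
        `]omega - 2 * h, h - omega[%classic = set0].
Proof.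
move=> F Fbar D E.
have sum_le : {ae @lebesgue_measure R, forall xi, xi \in `]- omega, omega[ ->
    \sum_(j < 3) (cabs (fourier (phi j) xi)) ^+ 2 <= gamma}.
  by apply: (ae_imp sum_bounds) => x H /H /andP[].
have h0 : 0 < h := step_size_gt0 t0_gt0 h_def.
split.
- exact: (frame_of_bounds t0_gt0 h_def h_ge h_lt phi_band sigma_gt0 eta_gt0 sum_le
    minors_bound det_bound).
- exact: (dual_generators_exist t0_gt0 h_def h_ge h_lt phi_band sigma_gt0 eta_gt0 sum_le
    minors_bound det_bound).
- move=> phistar dual.
  have FQ := fourier_dual_generators t0_gt0 h_def h_ge h_lt phi_band sigma_gt0 eta_gt0 sum_le
    minors_bound det_bound dual.
  have shift := cutFT_shift_ae h phi_band sum_le.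
  (* The points -h, 0 and h are left out: they are interior to the intervals of the formulas with D
     but are endpoints of periods of the pre-Gramian. *)
  apply: (ae_imp (ae_and (ae_and FQ shift) (ae_and (ae_neq (- h)) (ae_and (ae_neq 0) (ae_neq h))))).
  move=> x [[Fx Ex] [nm [n0 n1]]].
  have Fr : fourier_row phistar x = rowv (fun j => Psi omega h (cutFT omega phi gamma) j x).
    by apply/rowP => j; rewrite !mxE Fx.
  set P := cutFT omega phi gamma in Fr Ex.
  have E0 : pv P x = fv phi x by have := Ex 0 isT; rewrite shift0.
  have E1 : pv P (x + h) = fv phi (x + h) by have := Ex 1 isT; rewrite shift1.
  have E2 : pv P (x + 2 * h) = fv phi (x + 2 * h) by have := Ex 2 isT.
  have Em : pv P (x - h) = fv phi (x - h) by have := Ex (-1) isT; rewrite shiftm1.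
  have Em2 : pv P (x - 2 * h) = fv phi (x - 2 * h) by have := Ex (-2) isT; rewrite shiftm2.
  have rowE (T : 'I_3 -> R[i]) : (forall j, Psi omega h P j x = T j) ->
      fourier_row phistar x = rowv T.
    by move=> PT; rewrite Fr; apply/rowP => j; rewrite !mxE PT.
  split; rewrite in_itv /= => /andP[x1 x2].
  + rewrite (rowE _ (fun j => Psi1 P h_ge h_lt j x1 x2)) E0 E1 E2 dual3_rowv.
    by rewrite /D (dualD_left phi h_def h0 h_ge h_lt x1 x2 nm).
  + rewrite (rowE _ (fun j => Psi2 P h_ge h_lt j x1 x2)) E0 E1 dual2_rowv.
    by rewrite /E (dualE_left phi h_def h0 h_ge h_lt x1 x2).
  + rewrite (rowE _ (fun j => Psi3 P h_ge h_lt j x1 x2)) E0 E1 Em dual3_rowv.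
    by rewrite /D (dualD_middle phi h_def h0 h_ge h_lt x1 x2 n0).
  + rewrite (rowE _ (fun j => Psi4 P h_ge h_lt j x1 x2)) E0 Em dual2_rowv.
    (* The minus sign reverses the outer cross product, since [dual2_rowv] puts the conjugated
       factor on the right. *)
    by rewrite /E (dualE_right phi h_def h0 h_ge h_lt x1 x2) scaleNr -scalerN -crossmulC.
  + rewrite (rowE _ (fun j => Psi5 P h_ge h_lt j x1 x2)) E0 Em Em2 dual3_rowv.
    by rewrite /D (dualD_right phi h_def h0 h_ge h_lt x1 x2 n1).
- by move=> hE; split; apply: set_itv_ge; rewrite bnd_simp -leNgt; lra.
Qed.
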